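(* Let $d\ge 2$ and let $\Omega\subset\mathbb{R}^d$ be a bounded, connected, open set with boundary $\Gamma$, let $\sigma$ be the $(d-1)$-dimensional Hausdorff measure on $\Gamma$, and assume $\sigma(\Gamma)<\infty$. Then there exists a (single-valued) operator $D_0$ on $L_2(\Gamma)$ such that the following holds. Given $\varphi,\psi\in L_2(\Gamma)$ one has $\varphi\in D(D_0)$ and $D_0\varphi=\psi$ if and only if there exists a $u\in H^1(\Omega)$ satisfying (1) $\Delta u=0$ in the sense of distributions on $\Omega$, (2) $\varphi$ is a trace of $u$, and (3) $u$ has a normal derivative in $L_2(\Gamma)$ and $\frac{\partial u}{\partial\nu}=\psi$. Moreover, the operator $D_0$ is positive and self-adjoint.
   Context: All spaces are real. $L_2(\Gamma)=L_2(\Gamma,\sigma)$, $H^1(\Omega)$ is the Sobolev space with norm $\|u\|_{H^1(\Omega)}^2=\int_\Omega|u|^2+\int_\Omega|\nabla u|^2$, and $H^1(\Omega)\cap C(\overline\Omega)$ is the set of $u\in C(\overline\Omega)$ whose restriction to $\Omega$ lies in $H^1(\Omega)$. An operator $A$ on a Hilbert space is positive if $(A\varphi,\varphi)\ge0$ for all $\varphi\in D(A)$. Trace: for $u\in H^1(\Omega)$, a function $\varphi\in L_2(\Gamma)$ is called a trace of $u$ if there is a sequence $(u_n)$ in $H^1(\Omega)\cap C(\overline\Omega)$ with $\lim u_n=u$ in $H^1(\Omega)$ and $\lim u_n|_\Gamma=\varphi$ in $L_2(\Gamma)$ (a function $u$ may have several traces). Normal derivative: let $u\in H^1(\Omega)$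 with distributional Laplacian $\Delta u\in L_2(\Omega)$. Then $u$ has a normal derivative in $L_2(\Gamma)$ if there is a $\psi\in L_2(\Gamma)$ such that $\int_\Omega(\Delta u)\,v+\int_\Omega\nabla u\cdot\nabla v=\int_\Gamma\psi\,v\,d\sigma$ for all $v\in H^1(\Omega)\cap C(\overline\Omega)$. Such $\psi$ is unique and one writes $\frac{\partial u}{\partial\nu}:=\psi$. *)

(* Defs.v *)
From HB Require Import structures.
From mathcomp Require Import all_boot all_order all_algebra.
From mathcomp Require Import all_classical all_reals all_analysis measurable_realfun.
Set Implicit Arguments. Unset Strict Implicit. Unset Printing Implicit Defensive.
Import Order.TTheory GRing.Theory Num.Theory.
Import numFieldNormedType.Exports.
Local Open Scope classical_set_scope.
Local Open Scope ring_scope.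

Definition borel_display : measure_display. Proof. exact. Qed.

Section borel.
Variables (R : realType) (m n : nat).
Let M := 'M[R]_(m, n).

Let borel0 : <<s @open M >> set0. Proof. exact: sigma_algebra0. Qed.

Let borelC A : <<s @open M >> A -> <<s @open M >> (~` A).
Proof. exact: sigma_algebraC. Qed.

Let borelU (F : (set M)^nat) :
  (forall i, <<s @open M >> (F i)) -> <<s @open M >> (\bigcup_i F i).
Proof. exact: sigma_algebra_bigcup. Qed.

HB.instance Definition _ := @isMeasurable.Build borel_display
  'M[R]_(m, n) <<s @open 'M[R]_(m, n) >> borel0 borelC borelU.

Definition halfspaces : set (set 'M[R]_(m, n)) :=
  [set A | exists i j (a : R), A = [set x : 'M[R]_(m, n) | a < x i j]].

Lemma open_halfspaces (U : set M) : open U -> <<s halfspaces >> U.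
Proof.
move=> oU.
pose S := (<<s halfspaces >> : set (set M)).
have SC A : S A -> S (~` A) by exact: sigma_algebraC.
have SU (F : (set M)^nat) : (forall i, S (F i)) -> S (\bigcup_i F i).
  exact: sigma_algebra_bigcup.
have SI (F : (set M)^nat) : (forall i, S (F i)) -> S (\bigcap_i F i).
  move=> SF; rewrite -(setCK (\bigcap_i _)) setC_bigcap; apply: (SC _); apply: (SU _) => i.
  exact: (SC _).
have SUc (I : countType) (F : I -> set M) : (forall i, S (F i)) -> S (\bigcup_i F i).
  move=> SF.
  pose G k := if @unpickle I k is Some i then F i else set0.
  rewrite (_ : \bigcup_i F i = \bigcup_k G k).
    apply: (SU _) => k; rewrite /G; case: unpickle => // ; exact: sigma_algebra0.
  apply/seteqP; split=> [x [i _ Fx]|x [k _]].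
    by exists (pickle i) => //; rewrite /G pickleK.
  by rewrite /G; case: unpickle => // i Fx; exists i.
have SIc (I : countType) (F : I -> set M) : (forall i, S (F i)) -> S (\bigcap_i F i).
  move=> SF; rewrite -(setCK (\bigcap_i _)) setC_bigcap; apply: (SC _); apply: (SUc _) => i.
  exact: (SC _).
have SI2 A B : S A -> S B -> S (A `&` B).
  by move=> SA SB; rewrite -bigcap2E; apply: (SI _) => -[|[|i]] //=; rewrite -setC0; apply: (SC _);
    exact: sigma_algebra0.
have Sgt i j a : S [set x : M | a < x i j].
  by apply: sub_sigma_algebra; exists i, j, a.
have Slt i j a : S [set x : M | x i j < a].
  rewrite (_ : mkset _ = \bigcup_k ~` [set x : M | a - k.+1%:R^-1 < x i j]).
    by apply: (SU _) => k; exact: (SC _).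
  apply/seteqP; split=> [x /= xa|x [k _ /= /negP]].
    have /ltr_add_invr[k kax] : x i j < a by [].
    by exists k => //=; apply/negP; rewrite -leNgt lerBrDr ltW.
  by rewrite -leNgt => /le_lt_trans; apply; rewrite ltrBlDr ltrDl invr_gt0 ltr0n.
have Sball (c : M) (e : R) : S (\bigcap_(ij : 'I_m * 'I_n)
    [set x : M | `|c ij.1 ij.2 - x ij.1 ij.2| < e]).
  apply: (SIc _) => -[i j] /=.
  rewrite (_ : mkset _ = [set x : M | c i j - e < x i j] `&` [set x | x i j < c i j + e]).
    by apply: (SI2 _); [exact: Sgt|exact: Slt].
  by apply/seteqP; split=> x /=; rewrite ltr_distlC => /andP.
pose B (p : 'M[rat]_(m, n) * nat) : set M := \bigcap_(ij : 'I_m * 'I_n)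
    [set x : M | `|ratr (p.1 ij.1 ij.2) - x ij.1 ij.2| < p.2.+1%:R^-1].
have SB p : S (B p).
  rewrite (_ : B p = \bigcap_(ij : 'I_m * 'I_n)
    [set x : M | `|(map_mx ratr p.1 : M) ij.1 ij.2 - x ij.1 ij.2| < p.2.+1%:R^-1]).
    exact: Sball.
  by apply: eq_bigcapr => ij _; apply/seteqP; split=> x /=; rewrite mxE.
rewrite (_ : U = \bigcup_(p in [set p | B p `<=` U]) B p).
  rewrite bigcup_mkcond; apply: (SUc _) => p.
  by case: ifPn => _; [exact: SB|exact: sigma_algebra0].
apply/seteqP; split=> [x Ux|x [p] /[apply]//].
have /nbhs_ballP[e /= e0 xeU] : nbhs x U by apply: open_nbhs_nbhs.
have /ltr_add_invr[k ke] : 0 < e / 2 by rewrite divr_gt0.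
rewrite add0r in ke.
have qE i j : exists q : rat, `|ratr q - x i j| < k.+1%:R^-1.
  have /rat_in_itvoo[q] : x i j < x i j + k.+1%:R^-1 by rewrite ltrDl invr_gt0.
  rewrite in_itv/= => /andP[q1 q2]; exists q.
  by rewrite ger0_norm ?subr_ge0 ?(ltW q1)// ltrBlDl.
pose q := \matrix_(i, j) sval (cid (qE i j)).
have qx i j : `|ratr (q i j) - x i j| < k.+1%:R^-1.
  by rewrite mxE; case: cid.
exists (q, k) => /=.
- move=> y qy; apply: xeU; split => // i j.
  rewrite /ball/= -(subrKA (ratr (q i j))) (le_lt_trans (ler_normD _ _))//.
  rewrite (splitr e) ltrD// (lt_trans _ ke)//.
    by rewrite distrC; exact: qx.
  exact: (qy (i, j)).
- by move=> [i j] _ /=; exact: qx.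
Qed.

Lemma borel_halfspaces : @measurable _ 'M[R]_(m, n) = <<s halfspaces >>.
Proof.
apply/seteqP; split.
  by apply: smallest_sub; [exact: smallest_sigma_algebra|exact: open_halfspaces].
apply: smallest_sub; first exact: smallest_sigma_algebra.
move=> _ [i [j [a ->]]]; apply: sub_sigma_algebra.
rewrite (_ : mkset _ = (fun x : M => x i j) @^-1` [set y | a < y])//.
apply: open_comp; last exact: open_gt.
by move=> x _; exact: coord_continuous.
Qed.

Lemma open_borel (U : set 'M[R]_(m, n)) : open U -> measurable U.
Proof. exact: sub_sigma_algebra. Qed.

Lemma measurable_coord i j : measurable_fun setT (fun x : 'M[R]_(m, n) => x i j).
Proof.
apply: (measurability _ (RGenOpens.measurableE R)) => _ [_ [a [b ->]] <-].
rewrite setTI; apply: open_borel; apply: open_comp; last exact: interval_open.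
by move=> x _; exact: coord_continuous.
Qed.

Lemma measurable_fun_mx d (T : measurableType d) (f : T -> 'M[R]_(m, n)) :
  (forall i j, measurable_fun setT (fun t => f t i j)) -> measurable_fun setT f.
Proof.
move=> mf; apply: (measurability _ borel_halfspaces) => _ [_ [i [j [a ->]]] <-].
have := mf i j measurableT `]a, +oo[%classic (measurable_itv _).
by rewrite !setTI; congr measurable; apply/seteqP; split=> x /=; rewrite in_itv/= andbT.
Qed.

End borel.

Section lebesgue_rV.
Variable R : realType.

Definition cons_rV n (p : measurableTypeR R * 'rV[R]_n) : 'rV[R]_n.+1 :=
  row_mx (p.1%:M : 'M[R]_1) p.2.

Lemma cons_rVE n (p : measurableTypeR R * 'rV[R]_n) (j : 'I_(1 + n)) :
  cons_rV p 0 j = match fintype.split j with inl _ => p.1 | inr k => p.2 0 k end.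
Proof.
by rewrite mxE; case: fintype.split => // k; rewrite mxE ord1 eqxx.
Qed.

Lemma measurable_cons_rV n : measurable_fun setT (@cons_rV n).
Proof.
apply: measurable_fun_mx => i j; rewrite (ord1 i).
under eq_fun do rewrite (@cons_rVE n).
case: fintype.split => k; first exact: measurable_fst.
exact: (measurableT_comp (measurable_coord 0 k) measurable_snd).
Qed.

HB.instance Definition _ n := isMeasurableFun.Build _ _ _ _ (@cons_rV n)
  (@measurable_cons_rV n).

Section step.
Variables (n : nat) (mu : {sigma_finite_measure set 'rV[R]_n -> \bar R}).

Definition lebesgue_step : set 'rV[R]_n.+1 -> \bar R :=
  pushforward (@lebesgue_measure R \x mu)%E (@cons_rV n).

Let lebesgue_step0 : lebesgue_step set0 = 0%E.
Proof. by rewrite /lebesgue_step /pushforward preimage_set0 measure0. Qed.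

Let lebesgue_step_ge0 A : (0 <= lebesgue_step A)%E.
Proof. by rewrite /lebesgue_step /pushforward measure_ge0. Qed.

Let lebesgue_step_sigma_additive : semi_sigma_additive lebesgue_step.
Proof.
exact: (@measure_semi_sigma_additive _ _ _ [the measure _ _ of
  pushforward (@lebesgue_measure R \x mu)%E (@cons_rV n)]).
Qed.

HB.instance Definition _ := isMeasure.Build _ _ _ lebesgue_step
  lebesgue_step0 lebesgue_step_ge0 lebesgue_step_sigma_additive.

Let lebesgue_step_sigma_finite : sigma_finite setT lebesgue_step.
Proof.
have /sigma_finiteP[F [TF ndF Foo]] := sigma_finiteT (@lebesgue_measure R).
have /sigma_finiteP[G [TG ndG Goo]] := sigma_finiteT mu.
pose g (x : 'rV[R]_n.+1) : measurableTypeR R * 'rV[R]_n :=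
  (x 0 0, @rsubmx R 1 1 n x).
have mg : measurable_fun setT g.
  apply: measurable_fun_pair; first exact: measurable_coord.
  apply: measurable_fun_mx => i j.
  by under eq_fun do rewrite mxE; exact: measurable_coord.
have gK p : g (cons_rV p) = p.
  case: p => a x; rewrite /g; congr pair; last by rewrite /cons_rV row_mxKr.
  by rewrite (@cons_rVE n); case: splitP.
exists (fun k => g @^-1` (F k `*` G k)).
  rewrite -preimage_bigcup -[LHS](preimage_setT g); congr (_ @^-1` _).
  apply/esym/seteqP; split=> // -[x y] _.
  have [k _ Fx] : (\bigcup_k F k) x by rewrite -TF.
  have [l _ Gy] : (\bigcup_k G k) y by rewrite -TG.
  exists (maxn k l) => //; split => /=.
    by move: x Fx; exact/subsetPset/ndF/leq_maxl.
  by move: y Gy; exact/subsetPset/ndG/leq_maxr.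
move=> k; have [mF Fk] := Foo k; have [mG Gk] := Goo k; split.
  by rewrite -[X in measurable X]setTI; apply: mg => //; exact: measurableX.
rewrite /lebesgue_step /pushforward (_ : _ @^-1` _ = F k `*` G k); last first.
  rewrite -comp_preimage (_ : g \o _ = id)//.
  by apply/funext => p; exact: gK.
by rewrite product_measure1E// lte_mul_pinfty// ge0_fin_numE.
Qed.

HB.instance Definition _ := Measure_isSigmaFinite.Build _ _ _ lebesgue_step
  lebesgue_step_sigma_finite.

End step.

(* the n-fold product of Lebesgue measure on R *)
Fixpoint lebesgue_rV n : {sigma_finite_measure set 'rV[R]_n -> \bar R} :=
  if n is n.+1 then lebesgue_step (lebesgue_rV n) else dirac (0 : 'rV[R]_0).

End lebesgue_rV.

(* Caratheodory's criterion, with separation measured by a real function f *)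
Section metric_outer_measure.
Local Open Scope ereal_scope.
Variables (T : Type) (R : realType) (mu : {outer_measure set T -> \bar R}).
Variable f : T -> R.
Hypothesis mu_sep : forall A B (e : R), (0 < e)%R ->
  (forall x y, A x -> B y -> f x + e <= f y)%R ->
  mu A + mu B <= mu (A `|` B).

Lemma caratheodory_gt (a : R) : mu.-caratheodory [set x | (a < f x)%R].
Proof.
apply: le_caratheodory_measurable => X.
set D := X `&` _; set C := X `&` _.
have [->|Xoo] := eqVneq (mu X) +oo; first by rewrite leey.
have Xfin : mu X \is a fin_num by rewrite ge0_fin_numE ?ltey ?outer_measure_ge0.
pose r k : R := (a + k.+1%:R^-1)%R.
have rS k : (r k.+1 < r k)%R by rewrite /r ltrD2l ltf_pV2 ?posrE// ltr_nat.
have ar k : (a < r k)%R by rewrite ltrDl invr_gt0.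
pose Dk k := X `&` [set x | (r k < f x)%R].
pose Sk k := X `&` [set x | (r k.+1 < f x <= r k)%R].
have DX k : Dk k `<=` X by move=> x [].
have muDX k : mu (Dk k) <= mu X by exact: le_outer_measure.
have DD k : mu (Dk k) <= mu (Dk k.+1).
  by apply: le_outer_measure => x [Xx /= rx]; split => //=; rewrite (lt_trans (rS k)).
have step k : mu (Dk k) + mu (Sk k.+1) <= mu (Dk k.+2).
  rewrite addeC; apply: (le_trans (mu_sep (e := (r k - r k.+1)%R) _ _)).
  - by rewrite subr_gt0.
  - by move=> x y [_ /= /andP[_ xr]] [_ /= ry]; rewrite (le_trans _ (ltW ry))// -lerBrDr subKr.
  - apply: le_outer_measure => x [[Xx /= /andP[rx _]]|[Xx /= rx]]; split => //=.
    by rewrite (lt_trans (rS _))// (lt_trans (rS _)).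
have sumS n : \sum_(0 <= k < n) mu (Sk k.+1) <= mu (Dk n) + mu (Dk n.+1).
  elim: n => [|n ih]; first by rewrite big_nil adde_ge0 ?outer_measure_ge0.
  rewrite big_nat_recr//= (le_trans (leeD2r _ ih))//.
  by rewrite addeAC addeC leeD2l// addeC.
have sumSoo : \sum_(0 <= k <oo) mu (Sk k.+1) < +oo.
  apply: (@le_lt_trans _ _ (mu X + mu X)).
    apply: lime_le; first by apply: is_cvg_nneseries => *; exact: outer_measure_ge0.
    by apply: nearW => n; rewrite (le_trans (sumS n))// leeD.
  by rewrite lte_add_pinfty// -ge0_fin_numE ?outer_measure_ge0.
have tail0 := nneseries_tail_cvg sumSoo (fun k _ => outer_measure_ge0 mu (Sk k.+1)).
have cover n : mu D <= mu (Dk n.+1) + \sum_(n <= k <oo) mu (Sk k.+1).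
  pose F k := if (k < n)%N then Dk n.+1 else Sk k.+1.
  have DF : D `<=` Dk n.+1 `|` \bigcup_(k in ~` `I_n) Sk k.+1.
    move=> x [Xx /= afx].
    have [rx|xr] := ltP (r n.+1) (f x); first by left.
    right.
    have ex : exists k, (r k < f x)%R.
      by have /ltr_add_invr[k] := afx; exists k.
    have := ex_minnP ex => -[k rk kmin].
    have nk : (n.+1 < k)%N.
      rewrite ltnNge; apply/negP => kn.
      have : (f x <= r k)%R.
        by rewrite (le_trans xr)// /r lerD2l lef_pV2 ?posrE// ler_nat.
      by move/(lt_le_trans rk); rewrite ltxx.
    case: k rk kmin nk => // -[//|k] rk kmin nk.
    exists k; first by move=> /=; apply/negP; rewrite -leqNgt.
    split => //=; rewrite rk/= leNgt; apply/negP => /kmin.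
    by rewrite ltnn.
  apply: (le_trans (le_outer_measure mu _ _ DF)).
  apply: (le_trans (outer_measureU2 mu _ _)); rewrite leeD2l//.
  exact: (outer_measure_sigma_subadditive_tail mu n (fun k => Sk k.+1)).
have CD n : mu C + mu (Dk n) <= mu X.
  apply: (le_trans (mu_sep (e := (r n - a)%R) _ _)).
  - by rewrite subr_gt0.
  - move=> x y [_ /= /negP]; rewrite -leNgt => xa [_ /= ry].
    by rewrite (le_trans _ (ltW ry))// -lerBrDr subKr.
  - by apply: le_outer_measure => x [] [].
have muCfin : mu C \is a fin_num.
  rewrite ge0_fin_numE ?outer_measure_ge0// (@le_lt_trans _ _ (mu X)) ?ltey//.
  by apply: le_outer_measure => x [].
have main n : mu D + mu C <= mu X + \sum_(n <= k <oo) mu (Sk k.+1).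
  rewrite (le_trans (leeD2r _ (cover n)))// addeAC leeD2r// addeC.
  exact: CD.
have lim0 : (fun n => mu X + \sum_(n <= k <oo) mu (Sk k.+1)) @ \oo --> mu X + 0.
  by apply: cvgeD => //; [rewrite fin_num_adde_defr|exact: cvg_cst].
rewrite -[leRHS]adde0 -(cvg_lim _ lim0)//.
apply: lime_ge; first by apply/cvg_ex; exists (mu X + 0).
exact: nearW.
Qed.

End metric_outer_measure.

Section hausdorff.
Variables (R : realType) (n : nat).
Implicit Types (x y : 'rV[R]_n) (A B : set 'rV[R]_n).

(* the norm carried by 'rV[R]_n in the library is the sup norm *)
Definition euclid x : R := Num.sqrt (\sum_(i < n) x 0 i ^+ 2).

Lemma coord_le_euclid x i : `|x 0 i| <= euclid x.
Proof.
rewrite -sqrtr_sqr ler_wsqrtr// (bigD1 i)//= lerDl sumr_ge0// => j _.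
exact: sqr_ge0.
Qed.

End hausdorff.

Section hausdorff_measure.
Local Open Scope ereal_scope.
Variables (R : realType) (n : nat) (s : nat).
Implicit Types (A B : set 'rV[R]_n).

Definition diameter A : \bar R :=
  ereal_sup [set (euclid (x - y))%:E | x in A & y in A].

(* Volume of the unit ball of R^s: the factor [unit_ball_volume / 2 ^ s] below
   normalises the s-dimensional Hausdorff measure so that it is Lebesgue measure
   on R^s and surface measure on smooth hypersurfaces *)
Definition unit_ball_volume : \bar R :=
  lebesgue_rV R s [set x | (euclid x <= 1)%R].

Definition hausdorff_weight A : \bar R :=
  if A == set0 then 0 else unit_ball_volume * (2^-1%:E * diameter A) ^+ s.

Definition diam_cover (delta : R) A : set (set 'rV[R]_n)^nat :=
  [set F | (forall k, diameter (F k) <= delta%:E) /\ A `<=` \bigcup_k F k].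

Definition hausdorff_content (delta : R) A : \bar R :=
  ereal_inf [set \sum_(0 <= k <oo) hausdorff_weight (F k) | F in diam_cover delta A].

Definition hausdorff A : \bar R :=
  ereal_sup [set hausdorff_content delta A | delta in [set delta | (0 < delta)%R]].

Lemma diameter0 : diameter set0 = -oo.
Proof.
by rewrite /diameter image2E set0X image_set0 ereal_sup0.
Qed.

Lemma diameter_ge0 A : A !=set0 -> 0 <= diameter A.
Proof.
move=> [x Ax]; apply: ereal_sup_ubound; exists x => //; exists x => //.
rewrite subrr /euclid big1 ?sqrtr0// => i _; by rewrite mxE expr0n.
Qed.

Lemma hausdorff_weight0 : hausdorff_weight set0 = 0.
Proof. by rewrite /hausdorff_weight eqxx. Qed.

Lemma hausdorff_weight_ge0 A : 0 <= hausdorff_weight A.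
Proof.
rewrite /hausdorff_weight; case: ifPn => // /set0P A0.
by rewrite mule_ge0 ?measure_ge0 ?expe_ge0 ?mule_ge0 ?diameter_ge0 ?lee_fin ?invr_ge0.
Qed.

Lemma hausdorff_content_ge0 delta A : 0 <= hausdorff_content delta A.
Proof.
apply: le_ereal_inf_tmp => _ [F _ <-]; apply: nneseries_ge0 => k _ _.
exact: hausdorff_weight_ge0.
Qed.

Lemma hausdorff_content0 delta : hausdorff_content delta set0 = 0.
Proof.
apply/eqP; rewrite eq_le hausdorff_content_ge0 andbT.
apply: ereal_inf_lbound; exists (fun=> set0).
  by split => // k; rewrite diameter0 leNye.
by apply: eseries0 => k _ _; exact: hausdorff_weight0.
Qed.

Lemma le_hausdorff_content delta A B : A `<=` B ->
  hausdorff_content delta A <= hausdorff_content delta B.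
Proof.
move=> AB; apply: ereal_inf_le_tmp => _ [F [dF BF] <-]; exists F => //.
by split => //; exact: subset_trans BF.
Qed.

Lemma hausdorff_content_anti delta delta' A : (delta' <= delta)%R ->
  hausdorff_content delta A <= hausdorff_content delta' A.
Proof.
move=> dd; apply: ereal_inf_le_tmp => _ [F [dF AF] <-]; exists F => //.
by split => // k; rewrite (le_trans (dF k)).
Qed.

Lemma hausdorff_content_sigma_subadditive delta :
  sigma_subadditive (hausdorff_content delta).
Proof.
move=> A; have [[i ioo]|] := pselect (exists i, hausdorff_content delta (A i) = +oo).
  rewrite (eseries_pinfty _ _ ioo) ?leey// => k _.
  by rewrite -ltNye (lt_le_trans _ (hausdorff_content_ge0 _ _)).
rewrite -forallNE => Aoo.
apply/lee_addgt0Pr => e e0.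
rewrite (le_trans _ (epsilon_trick _ _ (ltW e0)))//; last first.
  by move=> k; exact: hausdorff_content_ge0.
pose P k (B : (set 'rV[R]_n)^nat) := diam_cover delta (A k) B /\
  \sum_(0 <= j <oo) hausdorff_weight (B j) <=
  hausdorff_content delta (A k) + (e / (2 ^ k.+1)%:R)%:E.
have [G PG] : {G : ((set 'rV[R]_n)^nat)^nat & forall k, P k (G k)}.
  apply: (@choice _ _ P) => k.
  have fin : hausdorff_content delta (A k) \is a fin_num.
    by rewrite ge0_fin_numE ?hausdorff_content_ge0// ltey; exact/eqP.
  have ek : (0 < e / (2 ^ k.+1)%:R)%R by rewrite divr_gt0// ltr0n expn_gt0.
  have [_ [B cB <-] lB] := lb_ereal_inf_adherent ek fin.
  by exists B; split => //; exact/ltW.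
have [f fbij] : exists f : nat -> nat * nat, set_bij setT setT f.
  by have /card_set_bijP := card_esym card_nat2.
apply: (@le_trans _ _ (\esum_(i in setT) (hausdorff_weight \o uncurry G) i)).
  apply: ereal_inf_lbound; exists (uncurry G \o f) => /=.
    split => [k|t [k _ Akt]] /=.
      by case: (f k) => i j /=; exact: ((PG i).1.1 j).
    have [j _ Gt] := (PG k).1.2 t Akt.
    have [_ _ /(_ (k, j) I)[m _ fm]] := fbij.
    by exists m => //=; rewrite fm.
  rewrite nneseries_esumT//; last by move=> *; exact: hausdorff_weight_ge0.
  rewrite (reindex_esum setT setT f)//.
rewrite (_ : esum _ _ =
    \sum_(0 <= i <oo) \sum_(0 <= j <oo) hausdorff_weight (G i j)); last first.
  rewrite nneseries_esumT; last first.
    by move=> *; apply: nneseries_ge0 => *; exact: hausdorff_weight_ge0.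
  under [RHS]eq_esum => i _.
    rewrite nneseries_esumT; last by move=> *; exact: hausdorff_weight_ge0.
    over.
  rewrite esum_esum//; last by move=> *; exact: hausdorff_weight_ge0.
  rewrite (_ : _ `*`` _ = setT).
    by apply: eq_esum => -[].
  by apply/seteqP.
by apply: lee_nneseries => [k _ _|k _]; [apply: nneseries_ge0 => *; exact: hausdorff_weight_ge0|exact: (PG k).2].
Qed.

Lemma hausdorff_ge_content delta A : (0 < delta)%R ->
  hausdorff_content delta A <= hausdorff A.
Proof. by move=> d0; apply: ereal_sup_ubound; exists delta. Qed.

Let hausdorff0 : hausdorff set0 = 0.
Proof.
apply/eqP; rewrite eq_le; apply/andP; split.
  by apply: ge_ereal_sup => _ [delta _ <-]; rewrite hausdorff_content0.
by rewrite (le_trans _ (@hausdorff_ge_content 1%R _ _))// hausdorff_content_ge0.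
Qed.

Let hausdorff_ge0 A : 0 <= hausdorff A.
Proof.
by rewrite (le_trans _ (@hausdorff_ge_content 1%R _ _))// hausdorff_content_ge0.
Qed.

Let le_hausdorff : {homo hausdorff : A B / A `<=` B >-> A <= B}.
Proof.
move=> A B AB; apply: ge_ereal_sup => _ [delta d0 <-].
by rewrite (le_trans (le_hausdorff_content _ AB))// hausdorff_ge_content.
Qed.

Let hausdorff_sigma_subadditive : sigma_subadditive hausdorff.
Proof.
move=> F; apply: ge_ereal_sup => _ [delta d0 <-].
rewrite (le_trans (hausdorff_content_sigma_subadditive _ _))//.
apply: lee_nneseries => [k _ _|k _]; first exact: hausdorff_content_ge0.
exact: hausdorff_ge_content.
Qed.

HB.instance Definition _ := isOuterMeasure.Build R 'rV[R]_n hausdorff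
  hausdorff0 hausdorff_ge0 le_hausdorff hausdorff_sigma_subadditive.

Lemma hausdorff_content_sep i (e delta : R) A B : (delta < e)%R ->
  (forall x y, A x -> B y -> x 0 i + e <= y 0 i)%R ->
  hausdorff_content delta A + hausdorff_content delta B <=
  hausdorff_content delta (A `|` B).
Proof.
move=> de sepAB; apply: le_ereal_inf_tmp => _ [F [dF ABF] <-].
pose G (X : set 'rV[R]_n) k := if F k `&` X != set0 then F k else set0.
have cG X : X `<=` A `|` B -> diam_cover delta X (G X).
  move=> XAB; split => [k|x Xx].
    by rewrite /G; case: ifPn => //= _; rewrite diameter0 leNye.
  have [k _ Fx] := ABF _ (XAB _ Xx); exists k => //.
  by rewrite /G ifT//; apply/set0P; exists x.
have le X : X `<=` A `|` B ->
    hausdorff_content delta X <= \sum_(0 <= k <oo) hausdorff_weight (G X k).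
  by move=> XAB; apply: ereal_inf_lbound; exists (G X) => //; exact: cG.
rewrite (le_trans (leeD (le A _) (le B _)))//.
rewrite -nneseriesD; [|by move=> *; exact: hausdorff_weight_ge0..].
apply: lee_nneseries => [k _ _|k _].
  by rewrite adde_ge0 ?hausdorff_weight_ge0.
rewrite /G; case: ifPn => [/set0P[x [Fx Ax]]|_]; last first.
  by rewrite hausdorff_weight0 add0e; case: ifPn; rewrite ?hausdorff_weight0 ?hausdorff_weight_ge0.
case: ifPn => [/set0P[y [Fy By]]|_]; last by rewrite hausdorff_weight0 adde0.
have : (euclid (y - x))%:E <= delta%:E.
  by apply: le_trans (dF k); apply: ereal_sup_ubound; exists y => //; exists x.
rewrite lee_fin => yxd; exfalso.
have := le_trans (coord_le_euclid (y - x) i) yxd.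
rewrite !mxE leNgt (lt_le_trans de)// (le_trans _ (ler_norm _))// lerBrDl.
exact: sepAB.
Qed.

Lemma hausdorff_sep i (e : R) A B : (0 < e)%R ->
  (forall x y, A x -> B y -> x 0 i + e <= y 0 i)%R ->
  hausdorff A + hausdorff B <= hausdorff (A `|` B).
Proof.
move=> e0 sepAB.
have key (d1 d2 : R) : (0 < d1)%R -> (0 < d2)%R ->
    hausdorff_content d1 A + hausdorff_content d2 B <= hausdorff (A `|` B).
  move=> d10 d20; pose d : R := Order.min (Order.min d1 d2) (e / 2)%R.
  have d0 : (0 < d)%R by rewrite !lt_min d10 d20 divr_gt0.
  apply: (@le_trans _ _ (hausdorff_content d A + hausdorff_content d B)).
    by apply: leeD; apply: hausdorff_content_anti; rewrite !ge_min lexx ?orbT.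
  rewrite (le_trans (hausdorff_content_sep _ sepAB))//.
    by rewrite gt_min ltr_pdivrMr// ltr_pMr// ltr1n orbT.
  exact: hausdorff_ge_content.
have [->|ABoo] := eqVneq (hausdorff (A `|` B)) +oo; first by rewrite leey.
have fin X : X `<=` A `|` B -> hausdorff X \is a fin_num.
  move=> XAB; rewrite ge0_fin_numE// (le_lt_trans (le_hausdorff XAB))//.
  by rewrite ltey.
rewrite -leeBrDr ?fin//; apply: ge_ereal_sup => _ [d1 d10 <-].
rewrite leeBrDr ?fin// addeC.
have fin1 : hausdorff_content d1 A \is a fin_num.
  rewrite ge0_fin_numE ?hausdorff_content_ge0//.
  by rewrite (le_lt_trans (hausdorff_ge_content _ d10))// -ge0_fin_numE// fin.
rewrite -leeBrDr//; apply: ge_ereal_sup => _ [d2 d20 <-].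
by rewrite leeBrDr// addeC key.
Qed.

Lemma borel_caratheodory_hausdorff :
  @measurable _ 'rV[R]_n `<=` hausdorff.-caratheodory.
Proof.
rewrite borel_halfspaces; apply: smallest_sub.
  split; first exact: caratheodory_measurable_set0.
    by move=> A mA; rewrite setTD; exact: caratheodory_measurable_setC.
  by move=> F mF; exact: caratheodory_measurable_bigcup.
move=> _ [i [j [a ->]]]; rewrite (ord1 i).
have := @caratheodory_gt _ _ [the outer_measure _ _ of hausdorff]
  (fun x : 'rV[R]_n => x 0%R j) (fun A B e => @hausdorff_sep j e A B) a.
exact.
Qed.

End hausdorff_measure.

(* [hausdorff s] is an outer measure on all subsets of R^n; the s-dimensional
   Hausdorff measure is its restriction to the Borel sets *)
Section hausdorff_borel.
Local Open Scope ereal_scope.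
Variables (R : realType) (n s : nat).

Definition hausdorff_measure (A : set 'rV[R]_n) : \bar R := hausdorff s A.

Let hausdorff_measure0 : hausdorff_measure set0 = 0.
Proof. exact: outer_measure0. Qed.

Let hausdorff_measure_ge0 A : 0 <= hausdorff_measure A.
Proof. exact: outer_measure_ge0. Qed.

Let hausdorff_measure_sigma_additive : semi_sigma_additive hausdorff_measure.
Proof.
move=> F mF tF mUF.
by apply: (@caratheodory_measure_sigma_additive _ _ (hausdorff s)) => // [k|];
  exact: borel_caratheodory_hausdorff.
Qed.

HB.instance Definition _ := isMeasure.Build _ 'rV[R]_n R hausdorff_measure
  hausdorff_measure0 hausdorff_measure_ge0 hausdorff_measure_sigma_additive.

End hausdorff_borel.
Arguments hausdorff_measure {R n} s A.

(* Elements of L_2(D, mu) are represented by functions on the ambient space T, of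
   which only the values on D matter; equality in L_2(D, mu) is
   [f = g %[ae mu in D]] *)
Section L2.
Context {d : measure_display} {T : measurableType d} {R : realType}.
Variables (mu : {measure set T -> \bar R}) (D : set T).
Implicit Types f g : T -> R.

Definition L2 : set (T -> R) := [set f | f \_ D \in Lfun mu 2%:E].

Definition L2_norm f : \bar R := 'N[mu]_2%:E[EFin \o (f \_ D)].

Definition L2_dot f g : R := \int[mu]_(x in D) (f x * g x).

(* A single-valued linear operator in L_2(D, mu), not necessarily bounded or
   densely defined. [L2_op] is only meaningful on [L2_dom]; the fields [L2_dom_ae]
   and [L2_op_ae] say that domain and operator descend to classes of functions
   modulo equality almost everywhere. *)
Record L2_operator := L2Operator {
  L2_dom : set (T -> R);
  L2_op :> (T -> R) -> (T -> R);
  L2_dom_sub : L2_dom `<=` L2;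
  L2_op_L2 : forall f, L2_dom f -> L2 (L2_op f);
  L2_dom_ae : forall f g, L2_dom f -> L2 g -> f = g %[ae mu in D] -> L2_dom g;
  L2_op_ae : forall f g, L2_dom f -> L2_dom g -> f = g %[ae mu in D] ->
    L2_op f = L2_op g %[ae mu in D];
  L2_dom0 : L2_dom (fun=> 0);
  L2_dom_linear : forall (a : R) f g, L2_dom f -> L2_dom g ->
    L2_dom (fun x => a * f x + g x);
  L2_op_linear : forall (a : R) f g, L2_dom f -> L2_dom g ->
    L2_op (fun x => a * f x + g x) = (fun x => a * L2_op f x + L2_op g x)
      %[ae mu in D]
}.

Definition L2_positive (A : L2_operator) :=
  forall f, L2_dom A f -> 0 <= L2_dot (A f) f.

Definition L2_dense (S : set (T -> R)) :=
  forall f, L2 f -> forall e : R, 0 < e ->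
  exists2 g, S g & (L2_norm (f \- g)%R < e%:E)%E.

Definition L2_adjoint (A : L2_operator) g h :=
  [/\ L2 g, L2 h & forall f, L2_dom A f -> L2_dot (A f) g = L2_dot f h].

Definition L2_self_adjoint (A : L2_operator) :=
  L2_dense (L2_dom A) /\
  forall g h, L2 g -> L2 h ->
    (L2_adjoint A g h <-> L2_dom A g /\ A g = h %[ae mu in D]).

End L2.

Section sobolev.
Context {R : realType} {d : nat}.
Implicit Types (f g eta u : 'rV[R]_d -> R) (Omega : set 'rV[R]_d).

Definition partial (i : 'I_d) f : 'rV[R]_d -> R := 'D_(delta_mx 0 i) f.

Definition smooth f := forall s : seq 'I_d, let g := foldr partial f s in
  continuous g /\ forall i x, derivable g x (delta_mx 0 i).

Definition test_function Omega eta :=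
  let supp := closure [set x | eta x != 0] in
  [/\ smooth eta, compact supp & supp `<=` Omega].

Definition weak_gradient Omega u (G : 'rV[R]_d -> 'rV[R]_d) :=
  forall eta, test_function Omega eta -> forall i,
  \int[lebesgue_rV R d]_(x in Omega) (u x * partial i eta x) =
  - \int[lebesgue_rV R d]_(x in Omega) (G x 0 i * eta x).

(* An element of H^1(Omega) is bundled with (a representative of) its weak
   gradient, which it determines up to equality almost everywhere *)
Record H1 Omega := {
  H1_fun :> 'rV[R]_d -> R;
  H1_grad : 'rV[R]_d -> 'rV[R]_d;
  H1_fun_L2 : L2 (lebesgue_rV R d) Omega H1_fun;
  H1_grad_L2 : forall i, L2 (lebesgue_rV R d) Omega (fun x => H1_grad x 0 i);
  H1_weak_gradient : weak_gradient Omega H1_fun H1_grad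
}.

Definition H1_dist Omega (u v : H1 Omega) : R := Num.sqrt
  (\int[lebesgue_rV R d]_(x in Omega) (u x - v x) ^+ 2 +
   \int[lebesgue_rV R d]_(x in Omega)
     \sum_(i < d) (H1_grad u x 0 i - H1_grad v x 0 i) ^+ 2).

(* the function u chosen on R^d is continuous on the closure of Omega; in
   particular its values on the boundary are then those of the continuous
   extension of u *)
Definition H1_continuous Omega (u : H1 Omega) :=
  {within closure Omega, continuous u}.

Definition laplacian f : 'rV[R]_d -> R :=
  fun x => \sum_(i < d) partial i (partial i f) x.

Definition distributional_laplacian Omega u f :=
  forall eta, test_function Omega eta ->
  \int[lebesgue_rV R d]_(x in Omega) (u x * laplacian eta x) =
  \int[lebesgue_rV R d]_(x in Omega) (f x * eta x).

Definition boundary Omega : set 'rV[R]_d := closure Omega `\` Omega°.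

Definition surface_measure : {measure set 'rV[R]_d -> \bar R} :=
  hausdorff_measure d.-1.

Definition is_trace Omega (u : H1 Omega) (phi : 'rV[R]_d -> R) :=
  L2 surface_measure (boundary Omega) phi /\
  exists u_ : (H1 Omega)^nat,
    [/\ forall n, H1_continuous (u_ n),
        H1_dist (u_ n) u @[n --> \oo] --> 0 &
        L2_norm surface_measure (boundary Omega) (u_ n \- phi)
          @[n --> \oo] --> 0%E].

Definition is_normal_derivative Omega (u : H1 Omega) (psi : 'rV[R]_d -> R) :=
  L2 surface_measure (boundary Omega) psi /\
  exists f, [/\ L2 (lebesgue_rV R d) Omega f,
    distributional_laplacian Omega u f &
    forall v : H1 Omega, H1_continuous v ->
      \int[lebesgue_rV R d]_(x in Omega) (f x * v x) +
      \int[lebesgue_rV R d]_(x in Omega)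
        \sum_(i < d) H1_grad u x 0 i * H1_grad v x 0 i =
      \int[surface_measure]_(x in boundary Omega) (psi x * v x)].

End sobolev.
Arguments surface_measure R d : clear implicits.

(* Main.v *)
Require Import Defs.
From mathcomp Require Import all_boot all_order all_algebra.
From mathcomp Require Import all_classical all_reals all_analysis.
From mathcomp Require Import measurable_realfun ring lra.
Set Implicit Arguments. Unset Strict Implicit. Unset Printing Implicit Defensive.
Import Order.TTheory GRing.Theory Num.Theory.
Import numFieldNormedType.Exports.
Local Open Scope classical_set_scope.
Local Open Scope ring_scope.

(* Let V be the set of functions of H^1(Omega) that are continuous on the closure of
   Omega, and D(u, v) the Dirichlet integral. On almost every line parallel to the first
   axis, u in V is absolutely continuous inside Omega, so |u| is bounded on the line by
   its value at some boundary point plus the integral of |grad u|. As projecting the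
   boundary along the axis does not increase Hausdorff measure, up to a constant, this
   gives Maz'ya's inequality int_Omega u^2 <= C (D(u, u) + int_Gamma u^2). Hence a
   sequence in V that is Cauchy for D + lambda (., .)_Gamma converges in H^1(Omega),
   together with its boundary values, and the Riesz representation theorem solves
   D(u, v) + lambda (phi, v)_Gamma = lambda (psi, v)_Gamma for all v in V, where phi is
   a trace of u: then phi is in the domain of D_0 and D_0 phi = lambda (psi - phi).
   The case lambda = 1 makes 1 + D_0 surjective, which with symmetry gives
   self-adjointness; the domain is dense because phi tends to psi in V as lambda tends
   to infinity and V is dense in L_2(Gamma). That density also makes D_0 single-valued:
   if phi = 0 then D(u, u) = 0, hence psi is orthogonal to V. *)

(** * L2 spaces and positive forms *)

(** Nothing is known of the boundary beyond its finite measure, so a function of H^1(Omega) may have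
    several traces, and phi cannot be computed from u. All limits are therefore limits of pairs: one
    sequence in V converges to u in H^1(Omega) and to phi in L_2(Gamma), and identities proved on V
    are extended along such sequences. As V with its form is neither separated nor complete, the
    Riesz theorem is proved for a semidefinite form on a bare type; it returns a Cauchy minimising
    sequence, whose limits come from Riesz-Fischer. Functions in V have only a weak gradient. What
    is used of absolute continuity is a bound on the oscillation over a segment inside Omega, found
    by testing with a smoothed indicator of the segment times a plateau in the other variables. Each
    such test has its own null set of lines, so segments and plateaus must come from a countable
    family: rational ends and boxes. The Hausdorff measure is compared with volume through cubes
    alone, which costs the factor 4^n / omega_n, where omega_n is the volume of the unit ball. The
    projection of a Borel set need not be Borel, whence the measurable supersets and majorants. *)

Section L2_theory.
Context {d : measure_display} {T : measurableType d} {R : realType}.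
Variables (mu : {measure set T -> \bar R}) (D : set T).
Hypothesis mD : measurable D.
Implicit Types f g h : T -> R.

Local Notation L2 := (L2 mu D).
Local Notation dot := (L2_dot mu D).

Lemma L2P f : L2 f <->
  measurable_fun D f /\ mu.-integrable D (fun x => (f x ^+ 2)%:E).
Proof.
have sqE : (fun x => (f x ^+ 2)%:E) \_ D = (fun x => ((f \_ D) x ^+ 2)%:E).
  by apply/funext => x; rewrite !patchE; case: ifP => // _; rewrite expr0n.
split=> [Lf|[mf if2]].
  split; last first.
    by apply/integrable_mkcond => //; rewrite sqE; exact: Lfun2_integrable_sqr.
  apply/(measurable_restrictT _ mD).
  by move: Lf => /andP[/[!inE]].
have mf' : measurable_fun setT (f \_ D) by apply/(measurable_restrictT _ mD).
apply/andP; split; rewrite inE//=.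
rewrite /finite_norm unlock poweR_lty//=.
under eq_integral do rewrite powR_mulrn// -normrX ger0_norm ?sqr_ge0//.
have /integrable_lty -> // : mu.-integrable setT (fun x => ((f \_ D) x ^+ 2)%:E).
by rewrite -sqE; exact/(integrable_mkcond _ mD).
Qed.

Lemma L2_measurable f : L2 f -> measurable_fun D f.
Proof. by case/L2P. Qed.

Lemma L2_mul_integrable f g : L2 f -> L2 g ->
  mu.-integrable D (EFin \o (fun x => f x * g x)).
Proof.
move=> Lf Lg; apply/integrable_mkcond => //.
have /Lfun1_integrable := Lfun2_mul_Lfun1 Lf Lg.
congr integrable; apply/funext => x /=.
by rewrite !patchE; case: ifP => // _; rewrite mulr0.
Qed.

Lemma L2_norm_dot f : L2 f -> L2_norm mu D f = (Num.sqrt (dot f f))%:E.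
Proof.
move=> /L2P[mf if2]; rewrite /L2_norm unlock.
have -> : (\int[mu]_x (`|(EFin \o f \_ D) x| `^ 2))%E = (dot f f)%:E.
  rewrite /L2_dot /Rintegral fineK; last exact: integrable_fin_num.
  rewrite [RHS]integral_mkcond; apply: eq_integral => x _ /=.
  rewrite powR_mulrn// -normrX ger0_norm ?sqr_ge0// !patchE.
  by case: ifP => // _; rewrite expr0n.
by rewrite poweR_EFin powR12_sqrt//; apply: Rintegral_ge0 => x _; rewrite -expr2 sqr_ge0.
Qed.

Lemma L2_lin a f g : L2 f -> L2 g -> L2 (fun x => a * f x + g x).
Proof.
move=> Lf Lg; have ffi := L2_mul_integrable Lf Lf; have fgi := L2_mul_integrable Lf Lg.
have ggi := L2_mul_integrable Lg Lg.
apply/L2P; split.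
  by apply: measurable_funD; [apply: measurable_funM => //|]; exact: L2_measurable.
have := integrableD mD (integrableD mD (integrableZl mD (a ^+ 2) ffi)
  (integrableZl mD (2 * a) fgi)) ggi.
congr integrable; apply/funext => x /=.
by rewrite -!EFinM -!EFinD; congr EFin; ring.
Qed.

Lemma L2_cst0 : L2 (fun=> 0).
Proof.
apply/L2P; split => //; under eq_fun do rewrite expr0n/=; exact: integrable0.
Qed.

Lemma L2_scale a f : L2 f -> L2 (fun x => a * f x).
Proof.
move=> Lf; have := L2_lin a Lf L2_cst0.
by congr (L2 _); apply/funext => x; rewrite addr0.
Qed.

Lemma L2_sub f g : L2 f -> L2 g -> L2 (fun x => f x - g x).
Proof.
move=> Lf Lg; have := L2_lin (-1) Lg Lf.
by congr (L2 _); apply/funext => x; rewrite mulN1r addrC.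
Qed.

Lemma L2_add f g : L2 f -> L2 g -> L2 (fun x => f x + g x).
Proof.
move=> Lf Lg; have := L2_lin 1 Lf Lg.
by congr (L2 _); apply/funext => x; rewrite mul1r.
Qed.

Lemma L2_bounded f (M : R) : (mu D < +oo)%E -> measurable_fun D f ->
  (forall x, D x -> `|f x| <= M) -> L2 f.
Proof.
move=> Doo mf fM; apply/L2P; split => //.
apply: measurable_bounded_integrable => //; first exact: measurable_funX.
exists (M ^+ 2); split; first by rewrite num_real.
move=> y My x Dx /=; rewrite normrX (le_trans _ (ltW My))//.
by rewrite lerXn2r ?nnegrE// ?fM// (le_trans _ (fM _ Dx)).
Qed.

Lemma L2_ae f g : L2 f -> measurable_fun D g -> f = g %[ae mu in D] -> L2 g.
Proof.
move=> /L2P[mf if2] mg fg; apply/L2P; split => //.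
apply/integrableP; split; first by apply/measurable_EFinP; exact: measurable_funX.
move/integrableP : if2 => [_]; congr (_ < _)%E.
apply: ae_eq_integral => //.
- by apply: measurableT_comp => //; apply/measurable_EFinP; exact: measurable_funX.
- by apply: measurableT_comp => //; apply/measurable_EFinP; exact: measurable_funX.
- by apply: filterS fg => x /= h Dx; rewrite h.
Qed.

Lemma dotC f g : dot f g = dot g f.
Proof. by apply: eq_Rintegral => x _; rewrite mulrC. Qed.

Lemma dotDl a f g h : L2 f -> L2 g -> L2 h ->
  dot (fun x => a * f x + g x) h = a * dot f h + dot g h.
Proof.
move=> Lf Lg Lh; have fhi := L2_mul_integrable Lf Lh.
have ghi := L2_mul_integrable Lg Lh.
rewrite /L2_dot -RintegralZl// -RintegralD//; last exact: (integrableZl mD a fhi).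
by apply: eq_Rintegral => x _; rewrite mulrDl mulrA.
Qed.

Lemma dotBl f g h : L2 f -> L2 g -> L2 h ->
  dot (fun x => f x - g x) h = dot f h - dot g h.
Proof.
move=> Lf Lg Lh; have := dotDl (-1) Lg Lf Lh.
rewrite mulN1r addrC => <-; congr (dot _ h).
by apply/funext => x; rewrite mulN1r addrC.
Qed.

Lemma dotZl a f h : L2 f -> L2 h -> dot (fun x => a * f x) h = a * dot f h.
Proof.
by move=> Lf Lh; rewrite /L2_dot -RintegralZl//;
  [under eq_Rintegral do rewrite -mulrA|exact: L2_mul_integrable].
Qed.

Lemma dot_ge0 f : 0 <= dot f f.
Proof. by apply: Rintegral_ge0 => x _; rewrite -expr2 sqr_ge0. Qed.

Lemma dot_ae f f' g g' : measurable_fun D f -> measurable_fun D f' ->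
  measurable_fun D g -> measurable_fun D g' ->
  f = f' %[ae mu in D] -> g = g' %[ae mu in D] -> dot f g = dot f' g'.
Proof.
move=> mf mf' mg mg' ff' gg'; congr fine; apply: ae_eq_integral => //.
- by apply/measurable_EFinP; exact: measurable_funM.
- by apply/measurable_EFinP; exact: measurable_funM.
- by apply: filterS2 ff' gg' => x /= h1 h2 Dx; rewrite h1// h2.
Qed.

Lemma dot0_ae f : L2 f -> dot f f = 0 -> f = (fun=> 0) %[ae mu in D].
Proof.
move=> /[dup] Lf /L2P[mf if2] ff0.
have mf2 : measurable_fun D (fun x => (f x ^+ 2)%:E).
  by apply/measurable_EFinP; exact: measurable_funX.
have : (\int[mu]_(x in D) `|(f x ^+ 2)%:E|)%E = 0%E.
  rewrite -[RHS](_ : (dot f f)%:E = _); last by rewrite ff0.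
  rewrite /L2_dot /Rintegral fineK; last exact: integrable_fin_num.
  by apply: eq_integral => x _ /=; rewrite ger0_norm ?sqr_ge0.
move/(ae_eq_integral_abs mu mD mf2).
apply: filterS => x /= h Dx; have /eqP := h Dx.
by rewrite eqe sqrf_eq0 => /eqP.
Qed.

End L2_theory.

(** Cauchy-Schwarz and discriminant arguments bound a square; this is how such bounds are turned
    into convergence. *)
Lemma cvg0_sqr_le (R : realType) (g h : R^nat) :
  (forall n, g n ^+ 2 <= h n) -> h @ \oo --> 0 -> g @ \oo --> 0.
Proof.
move=> gh h0; apply/cvgr0Pnorm_le => e e0.
have e2 : 0 < e ^+ 2 by rewrite exprn_gt0.
move/cvgr0Pnorm_le : h0 => /(_ _ e2); apply: filterS => n hn.
rewrite -(ler_pXn2r (n := 2)) ?nnegrE// ?(ltW e0)// -normrX ger0_norm ?sqr_ge0//.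
by rewrite (le_trans (gh n))// (le_trans (ler_norm _)).
Qed.


(** * Riesz representation for positive semidefinite forms *)

Section psd_riesz.
Context {R : realType} {X : Type}.
Variables (comb : R -> X -> X -> X) (B : X -> X -> R) (l : X -> R) (C : R) (x0 : X).
Hypothesis Bcomb : forall a x y z, B (comb a x y) z = a * B x z + B y z.
Hypothesis Bsym : forall x y, B x y = B y x.
Hypothesis Bpos : forall x, 0 <= B x x.

Let Bcombr a x y z : B z (comb a x y) = a * B z x + B z y.
Proof. by rewrite Bsym Bcomb (Bsym x) (Bsym y). Qed.

(** The polynomial [B (t x + y) (t x + y)] in t is nonnegative. Its leading coefficient may vanish
    for nonzero x, since B is only semidefinite, and that case is treated apart. *)
Lemma psd_CS x y : B x y ^+ 2 <= B x x * B y y.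
Proof.
have pos t : 0 <= t ^+ 2 * B x x + 2 * t * B x y + B y y.
  have := Bpos (comb t x y); rewrite Bcomb !Bcombr (Bsym y x).
  by move=> h; rewrite (le_trans h)// le_eqVlt; apply/orP; left; apply/eqP; ring.
have := Bpos x; rewrite le_eqVlt => /predU1P[Bx0|Bx0].
  rewrite -Bx0 mul0r; have [->|Bxy] := eqVneq (B x y) 0; first by rewrite expr0n.
  (* At this t the polynomial, which is now affine, takes the value -1. *)
  exfalso; have := pos (- (B y y + 1) / (2 * B x y)).
  rewrite -Bx0 mulr0 add0r.
  have -> : 2 * (- (B y y + 1) / (2 * B x y)) * B x y + B y y = -1 by field.
  by rewrite ler0N1.
have := pos (- B x y / B x x).
have -> : (- B x y / B x x) ^+ 2 * B x x + 2 * (- B x y / B x x) * B x y + B y y =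
    (B x x * B y y - B x y ^+ 2) / B x x by field; rewrite gt_eqF.
by rewrite pmulr_lge0 ?invr_gt0// subr_ge0.
Qed.

Hypothesis lcomb : forall a x y, l (comb a x y) = a * l x + l y.
Hypothesis lbound : forall x, l x ^+ 2 <= C * B x x.

(** A minimising sequence of [B x x - 2 * l x] is Cauchy by the parallelogram identity, and
    near-minimality in the direction w gives the limit of [B (v n) w]. The type X carries no vector
    space laws: [comb a x y] stands for a x + y, and only its effect on B and l is used. No quotient
    or completion is formed; the limit is left to the concrete spaces. *)
Lemma psd_riesz : exists v : nat -> X,
  (forall e, 0 < e -> exists N, forall m n, (N <= m)%N -> (N <= n)%N ->
     B (comb (-1) (v m) (v n)) (comb (-1) (v m) (v n)) <= e) /\
  forall w, B (v n) w @[n --> \oo] --> l w.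
Proof.
pose J x := B x x - 2 * l x.
have Jlb x : - `|C| <= J x.
  rewrite /J lerBrDr; have := lbound x; have := Bpos x.
  set b := B x x; set L := l x => b0 Lb.
  have {}Lb : L ^+ 2 <= `|C| * b by rewrite (le_trans Lb)// ler_wpM2r// ler_norm.
  have C0 : 0 <= `|C| by [].
  (* From L ^ 2 <= |C| b and (b - |C|) ^ 2 >= 0 one gets 2 L <= b + |C|. *)
  rewrite addrC lerBlDr; have [|h] := leP (2 * L) (b + `|C|); first by rewrite addrC; lra.
  have : (b + `|C|) ^+ 2 < (2 * L) ^+ 2 by rewrite ltrXn2r ?nnegrE ?addr_ge0//; lra.
  by have := sqr_ge0 (b - `|C|); rewrite sqrrB sqrrD exprMn; lra.
have Jinf : has_inf (range J).
  by split; [exists (J x0), x0|exists (- `|C|) => _ [x _ <-]].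
pose i := inf (range J).
have Ji x : i <= J x by apply: ge_inf; [exact: Jinf.2|exists x].
have /choice[v vJ] : forall n, exists x, J x < i + n.+1%:R^-1.
  move=> n; have n0 : 0 < n.+1%:R^-1 :> R by rewrite invr_gt0.
  by have [_ [x _ <-] Jx] := inf_adherent n0 Jinf; exists x.
exists v; split.
  move=> e e0; have [N Ne] : exists N, N.+1%:R^-1 < e / 4.
    have /ltr_add_invr[N] : 0 < e / 4 by rewrite divr_gt0.
    by rewrite add0r; exists N.
  have small n : (N <= n)%N -> J (v n) < i + e / 4.
    move=> Nn; rewrite (lt_trans (vJ n))// ltrD2l (le_lt_trans _ Ne)//.
    by rewrite lef_pV2 ?posrE// ler_nat.
  exists N => m n /small Jm /small Jn.
  (* The midpoint of [v m] and [v n], with [v n - v n] in the place of zero. By the parallelogram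
     identity the form at [v n - v m] is 2 J(v m) + 2 J(v n) - 4 J(z), at most e. *)
  pose z := comb 2^-1 (v m) (comb 2^-1 (v n) (comb (-1) (v n) (v n))).
  have := Ji z; rewrite /J /z lcomb !lcomb !Bcomb !Bcombr in Jm Jn *.
  rewrite (Bsym (v n) (v m)); move: Jm Jn; rewrite /J.
  by move: (B (v m) (v m)) (B (v n) (v n)) (B (v m) (v n)) (l (v m)) (l (v n)); move=> *; lra.
move=> w; apply/subr_cvg0.
pose b := B w w.
apply: (@cvg0_sqr_le _ _ (fun n => (b + 1) * n.+1%:R^-1)).
  move=> n; set g := B (v n) w - l w; have b0 : 0 <= b by exact: Bpos.
  have key t : 0 <= t ^+ 2 * b + 2 * t * g + n.+1%:R^-1.
    have := Ji (comb t w (v n)); have := vJ n.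
    rewrite /J lcomb Bcomb !Bcombr (Bsym w (v n)) -/b /g.
    move: (B (v n) (v n)) (B (v n) w) (l (v n)) (l w) => p q r s h1 h2.
    have : 0 <= t * (t * b + q) + (t * q + p) - 2 * (t * s + r) - (p - 2 * r) + n.+1%:R^-1.
      move: (_ - 2 * (t * s + r)) h1 h2 => A; move: (n.+1%:R^-1) (p - 2 * r) => ? ?.
      lra.
    by move=> h; rewrite (le_trans h)// le_eqVlt; apply/orP; left; apply/eqP; ring.
  (* Nearly the minimiser - g / b; the denominator b + 1 is nonzero even when b = 0, and still gives
     g ^ 2 <= (b + 1) / (n + 1). *)
  have := key (- g / (b + 1)).
  have b1 : b + 1 != 0 by rewrite gt_eqF// ltr_wpDl.
  move: n.+1%:R^-1 => e.
  have -> : (- g / (b + 1)) ^+ 2 * b + 2 * (- g / (b + 1)) * g + e =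
     e - g ^+ 2 * ((b + 2) / (b + 1) ^+ 2) by field.
  have b1p : 0 < b + 1 by rewrite ltr_wpDl.
  rewrite subr_ge0 => h; rewrite mulrC -ler_pdivrMr//; apply: le_trans h.
  rewrite ler_wpM2l ?sqr_ge0// ler_pdivlMr ?exprn_gt0//.
  by rewrite expr2 mulKf// lerD2l ler1n.
rewrite -[X in _ --> X](mulr0 (b + 1)); apply: cvgMr; exact: cvg_harmonic.
Qed.

End psd_riesz.

Lemma cvg_geometric_increments (R : realType) (u : R^nat) (c : R) :
  (forall j, `|u j.+1 - u j| <= c * 2^-1 ^+ j) -> cvgn u.
Proof.
move=> uc; have c0 : 0 <= c.
  by have := uc 0%N; rewrite expr0 mulr1; apply: le_trans.
have : cvgn (series (telescope u)).
  apply: normed_cvg; apply: (@series_le_cvg _ _ (geometric c 2^-1)) => //.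
  - by move=> n; exact: normr_ge0.
  - by move=> n; rewrite /= mulr_ge0// exprn_ge0.
  - by apply: is_cvg_geometric_series; rewrite ger0_norm// invf_lt1// ltr1n.
rewrite telescopeK => /cvg_ex[l ul]; apply/cvg_ex; exists (l + u 0%N).
apply: (cvg_trans _ (cvgD ul (cvg_cst (u 0%N)))).
by apply: near_eq_cvg; near=> n; rewrite /= subrK.
Unshelve. all: by end_near.
Qed.

(** * Completeness of L2 *)

Section L2_complete.
Context {d : measure_display} {T : measurableType d} {R : realType}.
Variables (mu : {measure set T -> \bar R}) (D : set T).
Hypothesis mD : measurable D.
Implicit Types f g h : T -> R.

Local Notation L2 := (L2 mu D).
Local Notation dot := (L2_dot mu D).
Local Notation sq f := (dot f f).

Lemma L2_sq_integral f : L2 f -> (sq f)%:E = (\int[mu]_(x in D) (f x ^+ 2)%:E)%E.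
Proof.
by move=> /L2P[//|mf if2]; rewrite /L2_dot /Rintegral fineK; last exact: integrable_fin_num.
Qed.

(* Riesz-Fischer *)
Lemma L2_complete (f_ : nat -> T -> R) : (forall n, L2 (f_ n)) ->
  (forall e, 0 < e -> exists N, forall m n, (N <= m)%N -> (N <= n)%N ->
     sq (fun x => f_ m x - f_ n x) <= e) ->
  exists2 f, L2 f & sq (fun x => f_ n x - f x) @[n --> \oo] --> 0.
Proof.
move=> Lf cf.
have /choice[N HN] : forall j, exists N, forall m n, (N <= m)%N -> (N <= n)%N ->
    sq (fun x => f_ m x - f_ n x) <= 8^-1 ^+ j.
  by move=> j; apply: cf; rewrite exprn_gt0.
(* Partial sums make the indices nondecreasing, and at the same time at least [N j] and at least
   j. *)
pose k j := (\sum_(i < j.+1) (N i).+1)%N.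
have Nk j : (N j <= k j)%N.
  by rewrite /k big_ord_recr/= (leq_trans _ (leq_addl _ _)).
have kS j : (k j <= k j.+1)%N by rewrite /k [leqRHS]big_ord_recr/= leq_addr.
have jk j : (j <= k j)%N.
  elim: j => // j ih; rewrite /k big_ord_recr/= -/(k j) addnS ltnS.
  by rewrite (leq_trans ih)// leq_addr.
pose g j := f_ (k j).
have Lg j : L2 (g j) by exact: Lf.
have LDg j : L2 (fun x => g j.+1 x - g j x) by exact: L2_sub.
(* The squared increments have integral at most 8^-j. The weight 4^j leaves the summable 2^-j, and
   where the sum S is finite it gives |g (j+1) - g j| <= sqrt S * 2^-j. *)
pose h j x := (4 ^+ j * (g j.+1 x - g j x) ^+ 2)%:E.
have h0 j x : (0 <= h j x)%E by rewrite lee_fin mulr_ge0// ?sqr_ge0// exprn_ge0.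
have mh j : measurable_fun D (h j).
  apply/measurable_EFinP; apply: measurable_funM => //.
  by apply: measurable_funX; exact: (L2_measurable mD (LDg j)).
have Ih j : (\int[mu]_(x in D) h j x <= (2^-1 ^+ j)%:E)%E.
  under eq_integral do rewrite /h EFinM.
  rewrite ge0_integralZl//.
  2: by apply/measurable_EFinP; apply: measurable_funX; exact: (L2_measurable mD (LDg j)).
  2: by move=> x Dx; rewrite lee_fin sqr_ge0.
  rewrite -L2_sq_integral// -EFinM lee_fin.
  apply: (@le_trans _ _ (4 ^+ j * 8^-1 ^+ j)); last first.
    by rewrite -exprMn; apply: lerXn2r; rewrite ?nnegrE; lra.
  by rewrite ler_wpM2l ?exprn_ge0//; apply: HN => //; rewrite (leq_trans (Nk j)).
pose S x := (\sum_(j <oo) h j x)%E.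
have mS : measurable_fun D S.
  exact: (@ge0_emeasurable_sum _ _ _ D h xpredT).
have S0 x : (0 <= S x)%E by apply: nneseries_ge0 => *; exact: h0.
have IS : (\int[mu]_(x in D) S x < +oo)%E.
  rewrite integral_nneseries//.
  apply: (@le_lt_trans _ _ (\sum_(j <oo) (2^-1 ^+ j)%:E)%E).
    by apply: lee_nneseries => [j _ _|j _]; [exact: integral_ge0|exact: Ih].
  apply: (@le_lt_trans _ _ 2%:E); last by rewrite ltry.
  apply: lime_le; first by apply: is_cvg_nneseries => j _ _; rewrite lee_fin exprn_ge0.
  apply: nearW => n; rewrite sumEFin lee_fin.
  have := @geometric_seriesE R 1 2^-1 _; rewrite /geometric /series => /(_ _) /= gE.
  have /gE /(congr1 (@^~ n)) /= : 2^-1 != 1 :> R by rewrite lt_eqF//; lra.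
  under eq_bigr do rewrite mul1r.
  move=> ->; rewrite mul1r (_ : 1 - 2^-1 = 2^-1 :> R); last by field.
  by rewrite invrK ler_piMl// gerBl exprn_ge0.
pose E := D `&` [set x | (S x < +oo)%E].
have mE : measurable E by exact: emeasurable_fun_infty_o.
have ED : E `<=` D by move=> x [].
have aeE : {ae mu, forall x, D x -> E x}.
  have : mu.-integrable D S.
    apply/integrableP; split => //.
    by under eq_integral do rewrite gee0_abs//.
  move/(integrable_ae mD); apply: filterS => x /= Sx Dx; split => //=.
  by have := Sx Dx; rewrite ge0_fin_numE.
(* Cutting off outside E makes the sequence converge at every point, so that its limit is
   measurable. *)
pose g' j := g j \_ E.
have mg' j : measurable_fun D (g' j).
  by apply/measurable_restrict => //; apply: measurable_funS (L2_measurable mD (Lg j)).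
have cg' x : cvgn (g' ^~ x).
  have [xE|xE] := boolP (x \in E); last first.
    apply/cvg_ex; exists 0; rewrite (_ : g' ^~ x = cst 0); first exact: cvg_cst.
    by apply/funext => j; rewrite /g' patchE (negbTE xE).
  have [Dx Sx] : E x by rewrite -inE.
  apply: (@cvg_geometric_increments _ _ (Num.sqrt (fine (S x)))) => j.
  rewrite /g' !patchE xE.
  have : (h j x <= S x)%E.
    have := @nneseries_lim_ge R (h ^~ x) xpredT 0 j.+1 (fun i _ _ => h0 i x).
    apply: le_trans; rewrite big_nat_recr//= leeDr// sume_ge0//.
  have Sfin : S x \is a fin_num by rewrite ge0_fin_numE.
  have fS0 : 0 <= fine (S x) by exact/fine_ge0/S0.
  rewrite -(fineK Sfin) lee_fin => hS.
  rewrite -sqrtr_sqr -[2^-1 ^+ j]ger0_norm ?exprn_ge0// -sqrtr_sqr -sqrtrM//.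
  rewrite ler_wsqrtr// -exprM mulnC exprM exprVn (_ : 2 ^+ 2 = 4); last by ring.
  by rewrite exprVn ler_pdivlMr ?exprn_gt0// mulrC.
pose f x := limn (g' ^~ x).
have g'f x : g' ^~ x @ \oo --> f x by exact: cg'.
have mf : measurable_fun D f by apply: (measurable_fun_cvg mg') => x _; exact: g'f.
have g'g j : g' j = g j %[ae mu in D].
  by apply: filterS aeE => x /= h1 Dx; rewrite /g' patchE mem_set//; exact: h1.
have Lg' j : L2 (g' j) by apply: (L2_ae mD (Lg j)) => //; apply: filterS (g'g j) => x /= h1 /h1.
(* Fatou's lemma along the subsequence carries a bound on the distance from [f_ n] to the later
   terms over to the limit. *)
have main n e : (exists M, forall m, (M <= m)%N -> sq (fun x => f_ n x - f_ m x) <= e) ->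
    (\int[mu]_(x in D) ((f_ n x - f x) ^+ 2)%:E <= e%:E)%E.
  move=> [M Me]; pose w j x := ((f_ n x - g' j x) ^+ 2)%:E.
  have mw j : measurable_fun D (w j).
    apply/measurable_EFinP; apply: measurable_funX; apply: measurable_funB => //.
    exact: L2_measurable.
  have := @fatou _ _ _ mu D mD w mw (fun j x _ => _); set lhs := (X in (_ -> X <= _)%E -> _).
  have -> : lhs = (\int[mu]_(x in D) ((f_ n x - f x) ^+ 2)%:E)%E.
    apply: eq_integral => x _.
    have : w ^~ x @ \oo --> ((f_ n x - f x) ^+ 2)%:E.
      apply: cvg_EFin; first by apply: nearW.
      have fx : f_ n x - g' j x @[j --> \oo] --> f_ n x - f x.
        by apply: cvgB; [exact: cvg_cst|exact: g'f].
      have -> : fine \o w^~ x = (fun j => (f_ n x - g' j x) * (f_ n x - g' j x)).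
        by apply/funext => j /=; rewrite expr2.
      by rewrite expr2; exact: cvgM.
    by move/cvg_limn_einf_sup => [].
  move/(_ _)/le_trans; apply; first by move=> j x; rewrite lee_fin sqr_ge0.
  rewrite limn_einf_lim; apply: lime_le; first exact: is_cvg_einfs.
  exists M => // j /= Mj; apply: ereal_inf_le.
  exists (\int[mu]_(x in D) w j x)%E; first by exists j => /=.
  have LD : L2 (fun x => f_ n x - g' j x) by exact: L2_sub.
  rewrite -L2_sq_integral// lee_fin (le_trans _ (Me (k j) _)) ?(leq_trans Mj)//.
  have mD1 : measurable_fun D (fun x => f_ n x - g' j x) by exact: (L2_measurable mD LD).
  have mD2 : measurable_fun D (fun x => f_ n x - f_ (k j) x).
    by apply: (L2_measurable mD); exact: L2_sub.
  by rewrite le_eqVlt; apply/orP; left; apply/eqP; apply: dot_ae => //;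
    apply: filterS (g'g j) => x /= h1 Dx; rewrite h1.
have Lf0 : exists n, L2 (fun x => f_ n x - f x).
  have [M HM] := cf 1 ltr01; exists M; apply/L2P => //; split.
    by apply: measurable_funB => //; exact: L2_measurable.
  apply/integrableP; split.
    by apply/measurable_EFinP; apply: measurable_funX; apply: measurable_funB => //; exact: L2_measurable.
  under eq_integral do rewrite gee0_abs ?lee_fin ?sqr_ge0//.
  apply: (@le_lt_trans _ _ 1%:E); last by rewrite ltry.
  by apply: main; exists M => m Mm; exact: HM.
have Lff : L2 f.
  have [n Ln] := Lf0; have := L2_sub mD (Lf n) Ln.
  by congr (L2 _); apply/funext => x; rewrite subKr.
exists f => //; apply/cvgr0Pnorm_le => e e0.
have [M HM] := cf e e0; exists M => // n /= Mn.
rewrite ger0_norm ?dot_ge0// -lee_fin L2_sq_integral//; last exact: L2_sub.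
by apply: main; exists M => m Mm; exact: HM.
Qed.

End L2_complete.

(** * Smooth cutoff functions *)

Section smooth1.
Context {R : realType}.
Implicit Types (a b : R -> R).

(** Asks for n + 1 derivatives. Recursing on the derivative makes the closure properties inductions
    on n. *)
Fixpoint derivable_upto n a : Prop :=
  (forall x, derivable a x 1) /\ (if n is m.+1 then derivable_upto m (derive1 a) else True).

Definition smooth1 a := forall n, derivable_upto n a.

Lemma derivable_uptoS n a : derivable_upto n.+1 a -> derivable_upto n a.
Proof.
elim: n a => [|n ih] a [da ha]; split; [exact: da|exact: I|exact: da|exact: ih].
Qed.

Lemma derivable_uptoD n a b : derivable_upto n a -> derivable_upto n b ->
  derivable_upto n (fun x => a x + b x).
Proof.
elim: n a b => [|n ih] a b [da ha] [db hb]; (split; first by move=> x; exact: derivableD).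
  exact: I.
rewrite (_ : derive1 _ = (fun x => (derive1 a) x + (derive1 b) x)); first exact: ih.
by apply/funext => x; rewrite !derive1E deriveD; [|exact: da|exact: db].
Qed.

Lemma derivable_uptoM n a b : derivable_upto n a -> derivable_upto n b ->
  derivable_upto n (fun x => a x * b x).
Proof.
elim: n a b => [|n ih] a b ha hb; have [da ha'] := ha; have [db hb'] := hb;
  (split; first by move=> x; exact: derivableM).
  exact: I.
rewrite (_ : derive1 _ = (fun x => a x * (derive1 b) x + b x * (derive1 a) x)).
  by apply: derivable_uptoD; apply: ih; [exact: derivable_uptoS|exact: hb'|
    exact: derivable_uptoS|exact: ha'].
by apply/funext => x; rewrite !derive1E deriveM; [|exact: da|exact: db].
Qed.

Lemma derivable_upto_cst n (c : R) : derivable_upto n (fun=> c).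
Proof.
elim: n c => [|n ih] c; (split; first by move=> x; exact: derivable_cst); first exact: I.
rewrite (_ : derive1 _ = cst 0); first exact: ih.
by apply/funext => x; exact: derive1_cst.
Qed.

Lemma is_derive_affine (p q x : R) : is_derive x (1 : R) (fun x : R => p * x + q) p.
Proof.
apply: is_derive_eq (is_deriveD (is_deriveZ p (is_derive_id x 1)) (is_derive_cst q x 1)) _.
by rewrite addr0 [_ *: _]mulr1.
Qed.

Lemma derivable_upto_affine n a (p q : R) : derivable_upto n a ->
  derivable_upto n (fun x => a (p * x + q)).
Proof.
have daff := is_derive_affine p q.
have dcomp b (x : R) : (forall x, derivable b x 1) ->
    is_derive x (1 : R) (fun x => b (p * x + q)) ('D_1 b (p * x + q) * p).
  move=> db; apply: (@is_derive1_comp _ b (fun x => p * x + q)).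
  exact/derivableP/db.
elim: n a => [|n ih] a [da ha]; (split; first by move=> x; case: (dcomp a x da)).
  exact: I.
rewrite (_ : derive1 _ = (fun x => p * (derive1 a) (p * x + q))).
  by apply: derivable_uptoM; [exact: derivable_upto_cst|exact: ih].
by apply/funext => x; rewrite !derive1E; case: (dcomp a x da) => _ ->; rewrite mulrC.
Qed.

Lemma smooth1_derivable a : smooth1 a -> forall x, derivable a x 1.
Proof. by move=> /(_ 0%N)[]. Qed.

Lemma smooth1_derive a : smooth1 a -> smooth1 (derive1 a).
Proof. by move=> sa n; case: (sa n.+1). Qed.

Lemma smooth1_continuous a : smooth1 a -> continuous a.
Proof.
move=> sa x; apply: differentiable_continuous; apply/derivable1_diffP.
exact: smooth1_derivable.
Qed.

Lemma smooth1M a b : smooth1 a -> smooth1 b -> smooth1 (fun x => a x * b x).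
Proof. by move=> sa sb n; exact: derivable_uptoM. Qed.

Lemma smooth1D a b : smooth1 a -> smooth1 b -> smooth1 (fun x => a x + b x).
Proof. by move=> sa sb n; exact: derivable_uptoD. Qed.

Lemma smooth1_affine a p q : smooth1 a -> smooth1 (fun x => a (p * x + q)).
Proof. by move=> sa n; exact: derivable_upto_affine. Qed.

Lemma smooth1_cst (c : R) : smooth1 (fun=> c).
Proof. by move=> n; exact: derivable_upto_cst. Qed.

Lemma smooth1_primitive a b : smooth1 b -> (forall x : R, is_derive x (1 : R) a (b x)) ->
  smooth1 a.
Proof.
move=> sb ab n; have ab' : (derive1 a) = b.
  by apply/funext => x; rewrite derive1E; case: (ab x).
have da x : derivable a x 1 by case: (ab x).
by case: n => [|n]; split; [exact: da|exact: I|exact: da|rewrite ab'; exact: sb].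
Qed.

(** The induction on P is for all k at once, since the factor X of [p * 'X + c] is moved into the
    power of y. For constants, y^k exp(-y) <= k! by the exponential series. *)
Lemma poly_expRN_bounded (P : {poly R}) k :
  exists C, forall y, 0 < y -> `|P.[y]| * y ^+ k * expR (- y) <= C.
Proof.
elim/poly_ind: P k => [|p c ih] k.
  by exists 0 => y _; rewrite horner0 normr0 !mul0r.
have [C HC] := ih k.+1.
exists (C + `|c| * k`!%:R) => y y0; rewrite hornerMXaddC.
apply: (@le_trans _ _ ((`|p.[y] * y| + `|c|) * y ^+ k * expR (- y))).
  by rewrite ler_wpM2r ?expR_ge0// ler_wpM2r ?exprn_ge0 ?(ltW y0)// ler_normD.
rewrite !mulrDl lerD//.
  by rewrite normrM (gtr0_norm y0) -(mulrA `|_|) -exprS; exact: HC.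
rewrite -mulrA ler_wpM2l// expRN ler_pdivrMr ?expR_gt0//.
case: k {ih HC} => [|k]; first by rewrite expr0 fact0 mul1r (le_trans _ (expR_ge1Dx y))// lerDl ltW.
rewrite -ler_pdivrMl ?ltr0n ?fact_gt0// mulrC (le_trans _ (expR_ge1Dxn k (ltW y0)))//.
by rewrite lerDr.
Qed.

(* [flat 1] is the classical function x |-> exp (-1/x); the family over all
   polynomials is closed under differentiation *)
Definition flat (P : {poly R}) (x : R) : R :=
  if 0 < x then P.[x^-1] * expR (- x^-1) else 0.

(** The bounded product with k = 2, at y = 1/x. A quadratic bound is what makes the difference
    quotient at 0 tend to 0. *)
Lemma flat_le_sqr P : exists2 C, 0 <= C & forall x, `|flat P x| <= C * x ^+ 2.
Proof.
have [C HC] := poly_expRN_bounded P 2.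
have C0 : 0 <= `|C| by [].
exists `|C| => // x; rewrite /flat; case: ifPn => [x0|_]; last first.
  by rewrite normr0 mulr_ge0// sqr_ge0.
rewrite normrM (ger0_norm (expR_ge0 _)) -ler_pdivrMr ?exprn_gt0//.
rewrite (le_trans _ (ler_norm _))// (le_trans _ (HC x^-1 _)) ?invr_gt0//.
by rewrite exprVn mulrAC.
Qed.

(** For x > 0 the chain rule gives x^-2 (P - P')(1/x) exp(-1/x), which is again a member of the
    family. *)
Lemma is_derive_flat P x : is_derive x (1 : R) (flat P) (flat ('X^2 * (P - P^`())) x).
Proof.
have [x0|x0|x0] := ltgtP x 0.
- rewrite {2}/flat ltNge (ltW x0)/=.
  have near0 : \near x, (cst 0 : R -> R) x = flat P x.
    by near=> y; rewrite /flat ltNge ltW//=; near: y; exact: lt_nbhsl.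
  exact: near_eq_is_derive near0 (is_derive_cst _ _ _).
- rewrite {2}/flat x0.
  have nearx : \near x, P.[x^-1] * expR (- x^-1) = flat P x.
    by near=> y; rewrite /flat ifT//; near: y; exact: lt_nbhsr.
  apply: (near_eq_is_derive nearx).
  have xn0 : id x != 0 by rewrite gt_eqF.
  have dV := is_deriveV xn0 (is_derive_id x (1 : R)).
  have d1 := @is_derive1_comp _ (horner P) (fun y => y^-1) x _ _ (is_derive_poly P _) dV.
  have d2 := @is_derive1_comp _ expR (fun y => - y^-1) x _ _ (is_derive_expR _) (is_deriveN dV).
  apply: is_derive_eq (is_deriveM d1 d2) _.
  rewrite /= hornerM hornerXn !hornerE/= exprVn.
  rewrite /GRing.scale/=.
  by ring.
- subst x; rewrite {2}/flat ltxx.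
  have [C C0 HC] := flat_le_sqr P.
  suff dl : (fun h => h^-1 *: ((flat P \o shift 0) (h *: 1) - flat P 0)) @ 0^' --> (0 : R).
    by apply: DeriveDef; [apply/cvg_ex; exists 0|exact: cvg_lim].
  apply/cvgr0Pnorm_le => e e0.
  near=> h; rewrite /= {2}/flat ltxx subr0 addr0.
  rewrite normrZ normfV (_ : h *: 1 = h); last exact: mulr1.
  have hn0 : h != 0 by near: h; exact: nbhs_dnbhs_neq.
  rewrite ler_pdivrMl ?normr_gt0// (le_trans (HC h))//.
  rewrite -real_normK ?num_real// expr2 mulrCA ler_wpM2l//.
  have : `|h| <= e / (C + 1).
    near: h; apply: dnbhs0_le; by rewrite divr_gt0// ltr_wpDl.
  rewrite ler_pdivlMr ?ltr_wpDl//; apply: le_trans.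
  by rewrite mulrC ler_wpM2l// lerDl.
Unshelve. all: by end_near. Qed.

Lemma smooth1_flat P : smooth1 (flat P).
Proof.
have dP Q x : derivable (flat Q) x 1 by case: (is_derive_flat Q x).
move=> n; elim: n P => [|n ih] P; (split; first exact: dP); first exact: I.
rewrite (_ : derive1 _ = flat ('X^2 * (P - P^`()))); first exact: ih.
by apply/funext => x; rewrite derive1E; case: (is_derive_flat P x).
Qed.

End smooth1.

Lemma cvg_prodr (R : realType) (T I : Type) (F : set_system T) (r : seq I)
    (f : I -> T -> R) (l : I -> R) : Filter F ->
  (forall i, f i x @[x --> F] --> l i) ->
  (\prod_(i <- r) f i x) @[x --> F] --> \prod_(i <- r) l i.
Proof.
move=> FF fl; elim: r => [|i r ih].
  by rewrite big_nil; under eq_fun do rewrite big_nil; exact: cvg_cst.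
by rewrite big_cons; under eq_fun do rewrite big_cons; exact: cvgM.
Qed.

(** * Tensor products of functions of one variable; plateaus *)

Section product_functions.
Context {R : realType} {n : nat}.
Implicit Types (a : 'I_n -> R -> R) (p q x : 'rV[R]_n).

(** All test functions constructed below have this form: a partial derivative only differentiates
    one factor, so smoothness reduces to one variable. *)
Definition prodf a x : R := \prod_i a i (x 0 i).

Definition cbox p q : set 'rV[R]_n := [set x | forall i, p 0 i <= x 0 i <= q 0 i].
Definition obox p q : set 'rV[R]_n := [set x | forall i, p 0 i < x 0 i < q 0 i].

Lemma cbox_compact p q : compact (cbox p q).
Proof.
have := @rV_compact _ n (fun i => `[p 0 i, q 0 i]%classic) (fun i => @segment_compact _ _ _).
by congr compact; apply/seteqP; split=> x /= h i; have := h i; rewrite in_itv.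
Qed.

Lemma closed_cbox p q : closed (cbox p q).
Proof. by apply: compact_closed; [exact: norm_hausdorff|exact: cbox_compact]. Qed.

Lemma prodf_continuous a : (forall i, continuous (a i)) -> continuous (prodf a).
Proof.
move=> ca x; apply: (@cvg_prodr _ _ _ (nbhs x) _ _ _ (nbhs_filter x)) => i.
apply: (@continuous_comp _ _ _ (fun x : 'rV[R]_n => x 0 i) (a i)).
  exact: coord_continuous.
exact: ca.
Qed.

Lemma prodf_line a x j (h : R) : prodf a (h *: delta_mx 0 j + x) =
  (\prod_(i | i != j) a i (x 0 i)) * a j (1 * h + x 0 j).
Proof.
rewrite /prodf (bigD1 j)//= mulrC; congr (_ * _).
  apply: eq_bigr => i ij; rewrite !mxE eqxx (negbTE ij) mulr0 add0r//.
by rewrite !mxE !eqxx mulr1 mul1r.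
Qed.

Lemma is_derive_prodf a x j : (forall i, smooth1 (a i)) ->
  is_derive x (delta_mx 0 j) (prodf a)
    (prodf (fun i => if i == j then derive1 (a i) else a i) x).
Proof.
move=> sa; pose C := \prod_(i | i != j) a i (x 0 i).
pose b (h : R) := C * a j (1 * h + x 0 j).
have eqb : (fun h : R => prodf a (h *: delta_mx 0 j + x)) = b.
  by apply/funext => h; rewrite prodf_line.
have daj : derivable (a j) (1 * 0 + x 0 j) 1 by exact: smooth1_derivable.
have dsh := is_derive_affine 1 (x 0 j) 0.
have db := is_deriveZ C (@is_derive1_comp _ (a j) (fun h : R => 1 * h + x 0 j) 0 _ _
  (derivableP daj) dsh).
have db' : is_derive (0 : R) (1 : R) b (C * ('D_1 (a j) (1 * 0 + x 0 j) * 1)) := db.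
have dlim : (fun h : R => h^-1 *: ((prodf a \o shift x) (h *: delta_mx 0 j) - prodf a x)) =
    (fun h : R => h^-1 *: ((b \o shift 0) (h *: 1) - b 0)).
  apply/funext => h; rewrite /= -eqb addr0 scale0r add0r.
  by rewrite [_ *: 1]mulr1.
apply: DeriveDef; first by rewrite /derivable dlim; case: db'.
transitivity ('D_1 b 0); first by rewrite /derive dlim.
case: db' => _ ->; rewrite mulr1 mulr0 add0r -derive1E /prodf (bigD1 j)//= eqxx mulrC.
by congr (_ * _); apply: eq_bigr => i /negbTE ->.
Qed.

Lemma partial_prodf a j : (forall i, smooth1 (a i)) ->
  partial j (prodf a) = prodf (fun i => if i == j then derive1 (a i) else a i).
Proof.
by move=> sa; apply/funext => x; rewrite /partial; case: (is_derive_prodf x j sa).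
Qed.

Lemma smooth_prodf a : (forall i, smooth1 (a i)) -> smooth (prodf a).
Proof.
move=> sa s /=.
have [b sb ->] : exists2 b, forall i, smooth1 (b i) & foldr partial (prodf a) s = prodf b.
  elim: s => [|j s [b sb /= ->]]; first by exists a.
  exists (fun i => if i == j then derive1 (b i) else b i); last exact: partial_prodf.
  by move=> i; case: ifP => _ //; exact: smooth1_derive.
split; first by apply: prodf_continuous => i; exact: smooth1_continuous.
by move=> j x; case: (is_derive_prodf x j sb).
Qed.

Lemma test_prodf (Omega : set 'rV[R]_n) a p q : (forall i, smooth1 (a i)) ->
  (forall i t, a i t != 0 -> p 0 i <= t <= q 0 i) -> cbox p q `<=` Omega ->
  test_function Omega (prodf a).
Proof.
move=> sa apq pqO.
have supp : closure [set x | prodf a x != 0] `<=` cbox p q.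
  rewrite [X in _ `<=` X](iffLR (closure_id _))//; last exact: closed_cbox.
  apply: closureS => x /= px i; apply: apq; apply: contra_neq px => ai0.
  by rewrite /prodf (bigD1 i)//= ai0 mul0r.
split; first exact: smooth_prodf.
  by apply: subclosed_compact supp; [exact: closed_closure|exact: cbox_compact].
exact: subset_trans pqO.
Qed.

(** A product of exp(-1/y) at y = (k + 1)(x - s) and at y = (k + 1)(t - x). It stays below 1 and
    tends pointwise to the indicator of ]s, t[ as k grows, which is all that dominated convergence
    needs. *)
Definition plateau1 (k : nat) (s t : R) (x : R) : R :=
  flat 1 (k.+1%:R * x + - (k.+1%:R * s)) * flat 1 (- k.+1%:R * x + k.+1%:R * t).

Lemma smooth1_plateau1 k s t : smooth1 (plateau1 k s t).
Proof. by apply: smooth1M; apply: smooth1_affine; exact: smooth1_flat. Qed.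

Lemma flat1_ge0 (x : R) : 0 <= flat (R := R) 1 x.
Proof. by rewrite /flat hornerC mul1r; case: ifP => // _; exact: expR_ge0. Qed.

Lemma flat1_le1 (x : R) : flat (R := R) 1 x <= 1.
Proof.
rewrite /flat hornerC mul1r; case: ifP => // x0.
by rewrite expR_le1 oppr_le0 invr_ge0 ltW.
Qed.

Lemma plateau1_ge0 k s t (x : R) : 0 <= plateau1 k s t x.
Proof. by rewrite mulr_ge0// flat1_ge0. Qed.

Lemma plateau1_le1 k s t (x : R) : plateau1 k s t x <= 1.
Proof. by rewrite mulr_ile1// ?flat1_ge0 ?flat1_le1. Qed.

Lemma plateau1_eq0 k s t (x : R) : ~~ (s < x < t) -> plateau1 k s t x = 0.
Proof.
have k0 : 0 < k.+1%:R :> R by [].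
rewrite negb_and -!leNgt => /orP[xs|tx]; rewrite /plateau1 /flat.
  by rewrite ltNge subr_le0 ler_pM2l// xs/= mul0r.
by rewrite [X in _ * X]ifF ?mulr0// mulNr addrC subr_gt0 ltr_pM2l// ltNge tx.
Qed.

Lemma cvg_plateau1 s t (x : R) : s < x < t -> plateau1 k s t x @[k --> \oo] --> (1 : R).
Proof.
move=> /andP[sx xt].
have main (e : R) : 0 < e -> flat 1 (k.+1%:R * e) @[k --> \oo] --> (1 : R).
  move=> e0.
  have -> : (fun k => flat 1 (k.+1%:R * e)) = (fun k => expR (- (e^-1 * k.+1%:R^-1))) :> R^nat.
    apply/funext => k; rewrite /flat mulr_gt0// hornerC mul1r invfM mulrC//.
  rewrite -[X in _ --> X](@expR0 R).
  have cvg0 : - (e^-1 * k.+1%:R^-1) @[k --> \oo] --> (0 : R).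
    rewrite -[X in _ --> X]oppr0; apply: cvgN.
    by rewrite -[X in _ --> X](mulr0 e^-1); apply: cvgMr; exact: cvg_harmonic.
  exact: (cvg_comp _ _ cvg0 (@continuous_expR R 0)).
have := cvgM (main (x - s) _) (main (t - x) _).
rewrite mulr1 !subr_gt0 => /(_ _ sx xt).
rewrite (_ : (_ \* _) = (fun k => plateau1 k s t x))//; apply/funext => k /=.
by rewrite /plateau1 mulrBr [- _ * x + _]addrC mulNr mulrBr.
Qed.

Definition plateau k p q := prodf (fun i => plateau1 k (p 0 i) (q 0 i)).

Lemma plateau_ge0 k p q x : 0 <= plateau k p q x.
Proof. by apply: prodr_ge0 => i _; exact: plateau1_ge0. Qed.

Lemma plateau_le1 k p q x : plateau k p q x <= 1.
Proof. by apply: prodr_ile1 => i _; rewrite plateau1_ge0 plateau1_le1. Qed.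

Lemma plateau_eq0 k p q x : ~ obox p q x -> plateau k p q x = 0.
Proof.
move=> /existsNP[i /negP h]; rewrite /plateau /prodf (bigD1 i)//= plateau1_eq0//.
by rewrite mul0r.
Qed.

Lemma smooth_plateau k p q : smooth (plateau k p q).
Proof. by apply: smooth_prodf => i; exact: smooth1_plateau1. Qed.

Lemma test_plateau (Omega : set 'rV[R]_n) k p q : cbox p q `<=` Omega ->
  test_function Omega (plateau k p q).
Proof.
apply: test_prodf => [i|i t]; first exact: smooth1_plateau1.
apply: contraNT => h; apply/eqP/plateau1_eq0; apply: contra h => /andP[h1 h2].
by rewrite !ltW.
Qed.

Lemma cvg_plateau p q x : plateau k p q x @[k --> \oo] --> (\1_(obox p q) x : R).
Proof.
have [xb|xb] := pselect (obox p q x); last first.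
  rewrite indicE memNset// (_ : (fun k => _) = cst 0); first exact: cvg_cst.
  by apply/funext => k; exact: plateau_eq0.
rewrite indicE mem_set//= -[X in _ --> X](_ : \prod_(i < n) (1 : R) = 1); last by rewrite big1.
by apply: cvg_prodr => i; exact/cvg_plateau1/xb.
Qed.

End product_functions.

Section Rdominated.
Context {d : measure_display} {T : measurableType d} {R : realType}.
Variables (mu : {measure set T -> \bar R}) (D : set T).
Hypothesis mD : measurable D.

Lemma Rdominated_cvg (f_ : nat -> T -> R) (f g : T -> R) :
  (forall n, measurable_fun D (f_ n)) ->
  (forall x, D x -> f_ ^~ x @ \oo --> f x) ->
  mu.-integrable D (EFin \o g) ->
  (forall n x, D x -> `|f_ n x| <= g x) ->
  mu.-integrable D (EFin \o f) /\
  \int[mu]_(x in D) f_ n x @[n --> \oo] --> \int[mu]_(x in D) f x.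
Proof.
move=> mf ff gi fg.
have mfE n : measurable_fun D (EFin \o f_ n) by exact/measurable_EFinP.
have ffE x : D x -> (EFin \o f_ ^~ x) @ \oo --> (f x)%:E.
  by move=> Dx; apply: cvg_EFin; [exact: nearW|exact: ff].
have mf' : measurable_fun D (EFin \o f).
  by apply/measurable_EFinP; exact: (measurable_fun_cvg mf).
have aeff : {ae mu, forall x, D x -> (fun n => (EFin \o f_ n) x) @ \oo --> (EFin \o f) x}.
  by apply: aeW => x; exact: ffE.
have aefg : {ae mu, forall x n, D x -> (`|(EFin \o f_ n) x| <= (EFin \o g) x)%E}.
  by apply: aeW => x n Dx; rewrite lee_fin fg.
have [fi _ /fine_cvgP[_ cf]] : [/\ mu.-integrable D (EFin \o f),
    [sequence \int[mu]_(x in D) (`|(EFin \o f_ n) x - (EFin \o f) x|)%E]_n @ \oo --> 0%E &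
    [sequence \int[mu]_(x in D) ((EFin \o f_ n) x)]_n @ \oo -->
      (fine (\int[mu]_(x in D) ((EFin \o f) x)))%:E]%E.
  have [fi h1 h2] := dominated_convergence mD mfE mf' aeff gi aefg.
  by split => //; rewrite fineK//; exact: integrable_fin_num.
by split.
Qed.

End Rdominated.

(** * Boxes, and functions whose integrals over boxes vanish *)

Section boxes.
Context {R : realType} {n : nat}.
Implicit Types (p q x : 'rV[R]_n) (Omega : set 'rV[R]_n).

Lemma open_obox p q : open (obox p q).
Proof.
rewrite openE => x xpq; apply: (@filter_forall _ _ (fun i y => p 0 i < y 0 i < q 0 i) (nbhs x)) => i.
have /andP[px xq] := xpq i.
have nx : nbhs (x 0 i) [set t | p 0 i < t < q 0 i].
  have := @near_in_itvoo R (p 0 i) (q 0 i) (x 0 i); rewrite in_itv/= px => /(_ xq).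
  by apply: filterS => t; rewrite /= in_itv.
exact: (@coord_continuous R 1 n 0 i x _ nx).
Qed.

Lemma measurable_obox p q : measurable (obox p q).
Proof. by apply: open_borel; exact: open_obox. Qed.

Lemma obox_sub_cbox p q : obox p q `<=` cbox p q.
Proof. by move=> x h i; have /andP[h1 h2] := h i; rewrite !ltW. Qed.

Lemma setI_obox p q p' q' : obox p q `&` obox p' q' =
  obox (\row_i Num.max (p 0 i) (p' 0 i)) (\row_i Num.min (q 0 i) (q' 0 i)).
Proof.
apply/seteqP; split=> x.
  move=> [h h'] i; rewrite !mxE gt_max lt_min.
  by have /andP[-> ->] := h i; have /andP[-> ->] := h' i.
move=> h; split=> i; have := h i; rewrite !mxE gt_max lt_min.
  by move=> /andP[/andP[-> _] /andP[-> _]].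
by move=> /andP[/andP[_ ->] /andP[_ ->]].
Qed.

Lemma cbox_setI_sub p q p' q' :
  cbox (\row_i Num.max (p 0 i) (p' 0 i)) (\row_i Num.min (q 0 i) (q' 0 i)) `<=` cbox p' q'.
Proof.
move=> x h i; have := h i; rewrite !mxE ge_max le_min.
by move=> /andP[/andP[_ ->] /andP[_ ->]].
Qed.

Lemma borel_obox : @measurable _ 'rV[R]_n `<=` <<s [set obox pq.1 pq.2 | pq in setT] >>.
Proof.
rewrite borel_halfspaces; apply: smallest_sub; first exact: smallest_sigma_algebra.
move=> _ [i [j [a ->]]]; rewrite (ord1 i).
pose p (k : nat) : 'rV[R]_n := \row_l (if l == j then a else - k%:R).
pose q (k : nat) : 'rV[R]_n := \row_l k%:R.
rewrite (_ : mkset _ = \bigcup_k obox (p k) (q k)).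
  apply: sigma_algebra_bigcup => k; apply: sub_sigma_algebra.
  by exists (p k, q k).
apply/seteqP; split=> x /=.
  move=> ax; pose F l := (Num.truncn `|x 0 l|).+1; pose N := (\max_l F l)%N.
  have xN l : `|x 0 l| < N%:R.
    rewrite (lt_le_trans (truncnS_gt _))// ler_nat.
    exact: (@leq_bigmax _ F).
  exists N => // l; rewrite !mxE; have := xN l; rewrite ltr_norml => /andP[h1 h2].
  by rewrite h2; case: eqP => [->|_]; rewrite ?ax ?h1.
by move=> [k _ /(_ j)]; rewrite !mxE eqxx => /andP[].
Qed.

Definition rbox (c : 'rV[rat]_n * 'rV[rat]_n) : ('rV[R]_n * 'rV[R]_n) :=
  (map_mx ratr c.1, map_mx ratr c.2).

Lemma open_rbox Omega x : open Omega -> Omega x -> exists c,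
  obox (rbox c).1 (rbox c).2 x /\ cbox (rbox c).1 (rbox c).2 `<=` Omega.
Proof.
move=> oO Ox; have /nbhs_ballP[e /= e0 xeO] : nbhs x Omega by exact: open_nbhs_nbhs.
have e2 : 0 < e / 2 by rewrite divr_gt0.
have qP i : exists q : rat, x 0 i < ratr q < x 0 i + e / 2.
  have /rat_in_itvoo[q] : x 0 i < x 0 i + e / 2 by rewrite ltrDl.
  by rewrite in_itv; exists q.
have pP i : exists q : rat, x 0 i - e / 2 < ratr q < x 0 i.
  have /rat_in_itvoo[q] : x 0 i - e / 2 < x 0 i by rewrite gtrBl.
  by rewrite in_itv; exists q.
have [p Hp] := choice pP; have [q Hq] := choice qP.
exists (\row_i p i, \row_i q i); split => [i|y xy].
  by rewrite /= !mxE; have /andP[_ ->] := Hp i; have /andP[-> _] := Hq i.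
apply: xeO; split => // i j; rewrite (ord1 i) /ball/=.
have := xy j; rewrite /= !mxE => /andP[h1 h2].
have /andP[h3 _] := Hp j; have /andP[_ h4] := Hq j.
rewrite ltr_distlC; lra.
Qed.

Variable mu : {measure set 'rV[R]_n -> \bar R}.

(** Open boxes are stable under intersection and generate the Borel sets, and the sets over which g
    has integral 0 form a lambda system. The measure is arbitrary because this serves Lebesgue
    measure inside Omega as well as Hausdorff measure on the boundary. *)
Lemma obox_integral0_ae (D : set 'rV[R]_n) (g : 'rV[R]_n -> R) : measurable D ->
  mu.-integrable D (EFin \o g) ->
  (forall p q, \int[mu]_(x in D) (g x * \1_(obox p q) x) = 0) ->
  g = (fun=> 0) %[ae mu in D].
Proof.
move=> mD gi g0.
have mg : measurable_fun D g by apply/measurable_EFinP; exact: (measurable_int mu).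
pose H := [set A : set 'rV[R]_n | measurable A /\ \int[mu]_(x in D) (g x * \1_A x) = 0].
have gAi A : measurable A -> mu.-integrable D (EFin \o (fun x => g x * \1_A x)).
  move=> mA; apply: (le_integrable mD _ _ gi).
    by apply/measurable_EFinP; apply: measurable_funM.
  move=> x Dx; rewrite /= lee_fin normrM ler_piMr// indicE.
  by case: (_ \in _); rewrite ?normr1 ?normr0.
have ndH : ndseq_closed H.
  move=> F ndF HF; split; first by apply: bigcupT_measurable => k; case: (HF k).
  have nF x : (\1_(F k) x : R) @[k --> \oo] --> (\1_(\bigcup_k F k) x : R).
    have [[k _ Fkx]|nFx] := pselect ((\bigcup_k F k) x).
      apply: cvg_near_cst; exists k => // m /= km; rewrite !indicE !mem_set//; first by exists k.
      by move: x Fkx; exact/subsetPset/ndF.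
    apply: cvg_near_cst; apply: nearW => m; rewrite !indicE !memNset// => Fmx.
    by apply: nFx; exists m.
  have [|||_] := Rdominated_cvg mD (f_ := fun k x => g x * \1_(F k) x)
    (f := fun x => g x * \1_(\bigcup_k F k) x) _ _ (integrable_norm gi).
  - by move=> k; apply: measurable_funM => //; apply: measurable_indic; case: (HF k).
  - by move=> x _; apply: cvgMr; exact: nF.
  - move=> k x Dx; rewrite /= normrM ler_piMr// indicE.
    by case: (_ \in _); rewrite ?normr1 ?normr0.
  rewrite (_ : (fun k => _) = cst 0); last by apply/funext => k; case: (HF k).
  by move/(cvg_lim (@norm_hausdorff _ _)) => <-; exact: (cvg_lim (@norm_hausdorff _ _) (cvg_cst _)).
have HT : H setT.
  split; first exact: measurableT.
  pose B k : set 'rV[R]_n := obox (\row_l - k%:R) (\row_l k%:R).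
  rewrite (_ : setT = \bigcup_k B k).
    apply: (ndH B _ _).2 => [|k].
      move=> k m km; apply/subsetPset => x xk i; have := xk i; rewrite !mxE => /andP[h1 h2].
      rewrite (lt_le_trans h2) ?ler_nat// andbT (le_lt_trans _ h1)// lerN2 ler_nat//.
    by split; [exact: measurable_obox|exact: g0].
  apply/seteqP; split=> // x _.
  pose F l := (Num.truncn `|x 0 l|).+1; exists (\max_l F l)%N => // l; rewrite !mxE.
  rewrite -ltr_norml (lt_le_trans (truncnS_gt _))// ler_nat.
  exact: (@leq_bigmax _ F).
have GI : setI_closed [set obox pq.1 pq.2 | pq in [set: 'rV[R]_n * 'rV[R]_n]].
  by move=> _ _ [p _ <-] [q _ <-]; rewrite setI_obox; eexists (_, _).
have lH : lambda_system setT H.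
  split => //.
  move=> A B BA [mA A0] [mB B0]; split; first exact: measurableD.
  rewrite (_ : (fun _ => _) = (fun x => g x * \1_A x - g x * \1_B x)).
    by rewrite RintegralB//; [rewrite A0 B0 subrr|exact: gAi|exact: gAi].
  apply/funext => x; rewrite -mulrBr; congr (_ * _); rewrite !indicE.
  have [Bx|Bx] := pselect (B x).
    by rewrite (mem_set Bx) (mem_set (BA _ Bx)) memNset ?subrr//; case.
  rewrite (memNset Bx) subr0; congr ((_ : bool)%:R); apply/idP/idP.
    by rewrite !inE => -[].
  by rewrite !inE.
have main A : measurable A -> H A.
  move/borel_obox; apply: (lambda_system_subset GI lH) => //.
  by move=> _ [pq _ <-]; split; [exact: measurable_obox|exact: g0].
have mc : measurable_fun D (EFin \o (fun=> 0 : R) : 'rV[R]_n -> _).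
  exact: measurable_cst.
have ae0 : ae_eq mu D (EFin \o g) (EFin \o (fun=> 0 : R)).
  apply: integral_ae_eq gi mc _ => // E ED mE.
  rewrite [RHS](_ : _ = 0%E); last by rewrite integral0.
  have [_ H0] := main E mE.
  rewrite -(setIidr ED) integral_mkcondr -[RHS](_ : 0%R%:E = _)// -H0 /Rintegral fineK; last first.
    exact/integrable_fin_num/gAi.
  apply: eq_integral => x _; rewrite patchE indicE.
  by case: ifPn => _; rewrite /= ?mulr1 ?mulr0.
by apply: filterS ae0 => x /= h Dx; have [] := h Dx.
Qed.

(* [Omega] is covered by the countably many rational boxes whose closure it contains *)
Lemma plateau_integral0_ae (Omega : set 'rV[R]_n) (g : 'rV[R]_n -> R) : open Omega ->
  mu.-integrable Omega (EFin \o g) ->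
  (forall k p q, cbox p q `<=` Omega -> \int[mu]_(x in Omega) (g x * plateau k p q x) = 0) ->
  g = (fun=> 0) %[ae mu in Omega].
Proof.
move=> oO gi g0; have mO := open_borel oO.
have mg : measurable_fun Omega g by apply/measurable_EFinP; exact: (measurable_int mu).
have box0 p q : cbox p q `<=` Omega -> \int[mu]_(x in Omega) (g x * \1_(obox p q) x) = 0.
  move=> pqO.
  have [|||_] := Rdominated_cvg mO (f_ := fun k x => g x * plateau k p q x)
    (f := fun x => g x * \1_(obox p q) x) _ _ (integrable_norm gi).
  - move=> k; apply: measurable_funM => //; apply: measurable_funTS.
    apply: (measurability _ (RGenOpens.measurableE R)) => _ [_ [a [b ->]] <-].
    rewrite setTI; apply: open_borel; apply: open_comp; last exact: interval_open.
    by move=> x _; case: (smooth_plateau k p q [::]) => + _; exact.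
  - by move=> x _; apply: cvgMr; exact: cvg_plateau.
  - move=> k x Dx; rewrite /= normrM ler_piMr// ger0_norm ?plateau_ge0//.
    exact: plateau_le1.
  rewrite (_ : (fun k => _) = cst 0); last by apply/funext => k; exact: g0.
  by move/(cvg_lim (@norm_hausdorff _ _)) => <-; exact: (cvg_lim (@norm_hausdorff _ _) (cvg_cst _)).
pose good c := cbox (rbox c).1 (rbox c).2 `<=` Omega.
pose N c := [set x | good c /\ obox (rbox c).1 (rbox c).2 x /\ g x <> 0].
have negl c : mu.-negligible (N c).
  have [cO|ncO] := pselect (good c); last first.
    by rewrite (_ : N c = set0); [exact: negligible_set0|apply/seteqP; split=> x // []].
  set P := (rbox c).1 in cO *; set Q := (rbox c).2 in cO *.
  have PQO : obox P Q `<=` Omega by apply: subset_trans cO; exact: obox_sub_cbox.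
  have mPQ := measurable_obox P Q.
  have : g = (fun=> 0) %[ae mu in obox P Q].
    apply: obox_integral0_ae => //.
      by apply: integrableS gi.
    (* An arbitrary box meets [obox P Q] in a box whose closed version lies in [cbox P Q], hence in
       Omega, where plateaus are test functions. *)
    move=> p q; rewrite -[RHS](box0 (\row_i Num.max (p 0 i) (P 0 i))
      (\row_i Num.min (q 0 i) (Q 0 i))); last first.
      exact: subset_trans (@cbox_setI_sub _ _ _ _) cO.
    rewrite -setI_obox -[X in Rintegral mu X](setIidr PQO) Rintegral_mkcondr.
    apply: eq_Rintegral => x _; rewrite patchE indicI /=.
    by rewrite [\1_(obox P Q) x]indicE; case: ifPn => _; rewrite ?mulr1 ?mulr0.
  by apply: negligibleS => x [_ [h1 h2]] /= /(_ h1).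
have : mu.-negligible (\bigcup_k (if unpickle k is Some c then N c else set0)).
  by apply: negligible_bigcup => k; case: unpickle => [c|]; [exact: negl|exact: negligible_set0].
apply: negligibleS => x /= /not_implyP[Ox gx].
have [c [xc cO]] := open_rbox oO Ox.
by exists (pickle c) => //; rewrite pickleK.
Qed.

End boxes.

(** * Integration on R^n and weak gradients *)

Section cons_rV_theory.
Context {R : realType} {n : nat}.
Implicit Types (t h : R) (y : 'rV[R]_n).

Definition behead_rV (x : 'rV[R]_n.+1) : 'rV[R]_n := \row_j x 0 (lift ord0 j).

Lemma cons_rV0 t y : cons_rV (t, y) 0 ord0 = t.
Proof.
by rewrite (@cons_rVE R n (t, y)); case: splitP.
Qed.

Lemma cons_rVS t y j : cons_rV (t, y) 0 (lift ord0 j) = y 0 j.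
Proof.
rewrite (@cons_rVE R n (t, y)); case: splitP => k //=; first by rewrite (ord1 k).
by rewrite /bump /= !add1n => -[e]; congr (y 0 _); apply/val_inj.
Qed.

Lemma eq_rVS (x x' : 'rV[R]_n.+1) : x 0 ord0 = x' 0 ord0 ->
  (forall j, x 0 (lift ord0 j) = x' 0 (lift ord0 j)) -> x = x'.
Proof.
move=> e0 eS; apply/rowP => i; have [j ->|->] := unliftP ord0 i; last exact: e0.
exact: eS.
Qed.

Lemma cons_behead (x : 'rV[R]_n.+1) : cons_rV (x 0 ord0, behead_rV x) = x.
Proof. by apply: eq_rVS => [|j]; rewrite ?cons_rV0// cons_rVS mxE. Qed.

Lemma cons_rV_head h t y : h *: delta_mx 0 ord0 + cons_rV (t, y) = cons_rV (h + t, y).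
Proof.
apply: eq_rVS => [|j].
  by rewrite mxE !cons_rV0 !mxE !eqxx mulr1.
by rewrite mxE !cons_rVS !mxE eqxx /= mulr0 add0r.
Qed.

Lemma cons_rV_tail h t y j :
  h *: delta_mx 0 (lift ord0 j) + cons_rV (t, y) = cons_rV (t, h *: delta_mx 0 j + y).
Proof.
apply: eq_rVS => [|k].
  by rewrite mxE !cons_rV0 !mxE eqxx /= mulr0 add0r.
by rewrite mxE !cons_rVS !mxE !eqxx /= (inj_eq lift_inj).
Qed.

Lemma continuous_cons_head y : continuous (fun t => cons_rV (t, y)).
Proof.
have -> : (fun t => cons_rV (t, y)) = (fun t => t *: delta_mx 0 ord0 + cons_rV (0, y)).
  by apply/funext => t; rewrite cons_rV_head addr0.
by move=> t; apply: cvgD; [exact: cvgZr_tmp|exact: cvg_cst].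
Qed.

Lemma continuous_cons_tail t : continuous (fun y => cons_rV (t, y)).
Proof.
move=> y A /= /nbhs_ballP[e /= e0 eA]; apply/nbhs_ballP; exists e => // y' [_ yy'].
apply: eA; split => // i j; rewrite (ord1 i).
have [k ->|->] := unliftP ord0 j; last by rewrite !cons_rV0; exact: ballxx.
by rewrite !cons_rVS; exact: yy'.
Qed.

End cons_rV_theory.

Section fubini_rV.
Context {R : realType} {n : nat}.
Local Open Scope ereal_scope.
Local Notation leb := (@lebesgue_measure R).
Local Notation mu := (lebesgue_rV R n).
Local Notation muS := (lebesgue_rV R n.+1).

Lemma integral_cons (f : 'rV[R]_n.+1 -> \bar R) :
  \int[muS]_x f x = \int[pushforward (leb \x mu) (@cons_rV R n)]_x f x.
Proof. exact: eq_measure_integral. Qed.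

Lemma tonelli_rV (f : 'rV[R]_n.+1 -> \bar R) : measurable_fun setT f ->
  (forall x, 0 <= f x) ->
  \int[muS]_x f x = \int[mu]_y \int[leb]_t f (cons_rV (t, y)).
Proof.
move=> mf f0; rewrite integral_cons ge0_integral_pushforward//.
rewrite preimage_setT fubini_tonelli2//.
  by apply: (measurableT_comp mf); exact: measurable_cons_rV.
by move=> x; exact: f0.
Qed.

Lemma integrable_cons (f : 'rV[R]_n.+1 -> \bar R) : muS.-integrable setT f ->
  (leb \x mu).-integrable setT (f \o @cons_rV R n).
Proof.
move=> /integrableP[mf fi]; apply/integrableP; split.
  by apply: (measurableT_comp mf); exact: measurable_cons_rV.
move: fi; rewrite integral_cons ge0_integral_pushforward ?preimage_setT//.
exact: measurableT_comp.
Qed.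

Lemma fubini_rV1 (f : 'rV[R]_n.+1 -> \bar R) : muS.-integrable setT f ->
  \int[muS]_x f x = \int[leb]_t \int[mu]_y f (cons_rV (t, y)).
Proof.
move=> fi; have := fi => /integrableP[mf _].
rewrite integral_cons integral_pushforward//.
  by rewrite preimage_setT -(integral12_prod_meas1 (integrable_cons fi)).
by rewrite preimage_setT; exact: integrable_cons.
Qed.

Lemma fubini_rV2 (f : 'rV[R]_n.+1 -> \bar R) : muS.-integrable setT f ->
  \int[muS]_x f x = \int[mu]_y \int[leb]_t f (cons_rV (t, y)).
Proof.
move=> fi; have := fi => /integrableP[mf _].
rewrite integral_cons integral_pushforward//.
  by rewrite preimage_setT -(integral21_prod_meas1 (integrable_cons fi)).
by rewrite preimage_setT; exact: integrable_cons.
Qed.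

End fubini_rV.

Section lebesgue_cbox.
Context {R : realType}.

Lemma measurable_cbox n (p q : 'rV[R]_n) : measurable (cbox p q).
Proof.
rewrite -(setCK (cbox p q)); apply: measurableC; apply: open_borel.
by rewrite openC; exact: closed_cbox.
Qed.

Lemma preimage_cons_cbox n (p q : 'rV[R]_n.+1) :
  @cons_rV R n @^-1` cbox p q =
  `[p 0 ord0, q 0 ord0]%classic `*` cbox (behead_rV p) (behead_rV q).
Proof.
apply/seteqP; split=> -[t y] /=.
  move=> h; split; first by have := h ord0; rewrite cons_rV0 in_itv.
  by move=> j; have := h (lift ord0 j); rewrite cons_rVS !mxE.
move=> [/=]; rewrite in_itv/= => h0 hS i.
have [j ->|->] := unliftP ord0 i; last by rewrite cons_rV0.
by have := hS j; rewrite cons_rVS !mxE.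
Qed.

Lemma lebesgue_cbox n (p q : 'rV[R]_n) : (forall i, p 0 i <= q 0 i) ->
  lebesgue_rV R n (cbox p q) = (\prod_i (q 0 i - p 0 i))%:E.
Proof.
elim: n p q => [|n ih] p q pq.
  by rewrite big_ord0 /= diracE mem_set//= => -[].
transitivity ((@lebesgue_measure R \x lebesgue_rV R n)%E (@cons_rV R n @^-1` cbox p q)).
  by [].
rewrite preimage_cons_cbox product_measure1E//; last exact: measurable_cbox.
rewrite ih; last by move=> i; rewrite !mxE.
set P := (\prod_i (_ - _))%:E; set p0 := p 0 ord0; set q0 := q 0 ord0.
transitivity (lebesgue_measure `[p0, q0]%classic * P)%E; first by [].
rewrite lebesgue_measure_itv/= lte_fin big_ord_recl.
have -> : (if (p0 < q0)%R then q0%:E - p0%:E else 0)%E = (q0 - p0)%:E.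
  case: ltP => // qp; congr EFin; apply/esym/eqP; rewrite subr_eq0 eq_le qp.
  by rewrite pq.
rewrite /P -EFinM; congr (EFin (_ * _)); apply: eq_bigr => j _; by rewrite !mxE.
Qed.

Lemma lebesgue_cbox_lty n (p q : 'rV[R]_n) : (lebesgue_rV R n (cbox p q) < +oo)%E.
Proof.
pose p' : 'rV[R]_n := \row_i Num.min (p 0 i) (q 0 i).
apply: (@le_lt_trans _ _ (lebesgue_rV R n (cbox p' q))).
  apply: le_measure; rewrite ?inE; [exact: measurable_cbox..|].
  by move=> x h i; have /andP[h1 ->] := h i; rewrite mxE ge_min h1.
by rewrite lebesgue_cbox ?ltry// => i; rewrite mxE ge_min lexx orbT.
Qed.

End lebesgue_cbox.

Lemma continuous_measurable_rV (R : realType) n (f : 'rV[R]_n -> R) :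
  continuous f -> measurable_fun setT f.
Proof.
move=> cf; apply: (measurability _ (RGenOpens.measurableE R)) => _ [_ [a [b ->]] <-].
rewrite setTI; apply: open_borel; apply: open_comp; last exact: interval_open.
by move=> x _; exact: cf.
Qed.

(** * Integration by parts *)

Section integral_partial.
Context {R : realType}.
Local Notation leb := (@lebesgue_measure R).

Lemma continuous_compact_bound n (K : set 'rV[R]_n) (f : 'rV[R]_n -> R) :
  compact K -> {within K, continuous f} -> exists2 M, 0 <= M & forall x, K x -> `|f x| <= M.
Proof.
move=> cK cf; have /compact_bounded[M [Mr HM]] := continuous_compact cf cK.
exists (`|M| + 1); first by rewrite addr_ge0.
move=> x Kx; apply: HM; last by exists x.
by rewrite (le_lt_trans (ler_norm M))// ltrDl.
Qed.

Lemma continuous_cbox_integrable n (p q : 'rV[R]_n) (f : 'rV[R]_n -> R) :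
  continuous f -> (forall x, f x != 0 -> cbox p q x) ->
  (lebesgue_rV R n).-integrable setT (EFin \o f).
Proof.
move=> cf fpq; have mpq := measurable_cbox p q.
have -> : EFin \o f = (EFin \o f) \_ (cbox p q).
  apply/funext => x; rewrite patchE; case: ifPn => //= xpq.
  by congr EFin; apply/eqP; apply: contraNT xpq => /fpq; rewrite inE.
apply/(integrable_mkcond _ mpq).
apply: measurable_bounded_integrable => //.
- exact: lebesgue_cbox_lty.
- by apply: measurable_funTS; exact: continuous_measurable_rV.
have [M M0 HM] := @continuous_compact_bound n (cbox p q) f (@cbox_compact _ _ p q)
  (continuous_subspaceT cf).
exists M; split; first by rewrite num_real.
by move=> y My x px /=; rewrite (le_trans (HM x px))// ltW.
Qed.

Lemma integral_derive_cpt (f g : R -> R) (a b : R) :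
  (forall t : R, is_derive t (1 : R) f (g t)) -> continuous g ->
  (forall t, f t != 0 -> a <= t <= b) -> (forall t, g t != 0 -> a <= t <= b) ->
  (\int[leb]_t (g t)%:E = 0)%E.
Proof.
move=> fg cg fab gab.
pose M := `|a| + `|b| + 1.
have := ler_norm a; have := ler_norm b; have := ler_normr (- a) a; have := ler_norm (- a).
have := ler_norm (- b); rewrite !normrN => nb na _ b1 a1.
have MM : - M < M by rewrite /M; have := normr_ge0 a; have := normr_ge0 b; lra.
have fM : f M = 0.
  by apply/eqP; apply: contraT => /fab /andP[h1 h2]; rewrite /M in h2; lra.
have fNM : f (- M) = 0.
  by apply/eqP; apply: contraT => /fab /andP[h1 h2]; rewrite /M in h1; lra.
have gM : (fun t => (g t)%:E) = (fun t => (g t)%:E) \_ `[- M, M]%classic.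
  apply/funext => t; rewrite patchE; case: ifPn => // tM; congr EFin; apply/eqP.
  apply: contraNT tM => /gab /andP[h1 h2]; rewrite inE /= in_itv/= /M.
  by apply/andP; split; lra.
have cf : continuous f.
  by move=> t; apply: differentiable_continuous; apply/derivable1_diffP; case: (fg t).
rewrite gM -integral_mkcond (@continuous_FTC2 _ g f)//.
- by rewrite fM fNM subee.
- exact: continuous_subspaceT.
- split; first by move=> t _; case: (fg t).
  + by apply: cvg_at_right_filter; exact: cf.
  + by apply: cvg_at_left_filter; exact: cf.
- by move=> t _; rewrite derive1E; case: (fg t).
Qed.

(* The hypothesis on the support of [partial i f] follows from the one on [f]; it is
   there because it passes to slices in the induction *)
Lemma integral_partial0 n (p q : 'rV[R]_n) (i : 'I_n) (f : 'rV[R]_n -> R) :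
  continuous f -> (forall x, derivable f x (delta_mx 0 i)) -> continuous (partial i f) ->
  (forall x, f x != 0 -> cbox p q x) -> (forall x, partial i f x != 0 -> cbox p q x) ->
  (\int[lebesgue_rV R n]_x (partial i f x)%:E = 0)%E.
Proof.
elim: n p q i f => [|n ih] p q i f; first by case: i.
move=> cf df cpf fpq pfpq.
have ipf := continuous_cbox_integrable cpf pfpq.
(* Along the first axis each line integral vanishes by the fundamental theorem of calculus. Along
   any other axis, Fubini in the other order leaves slices of one dimension less, for the
   induction. *)
have [j ij|ij] := unliftP ord0 i; rewrite {}ij in df cpf pfpq ipf *; last first.
  rewrite fubini_rV2//; apply: integral0_eq => y _.
  apply: (@integral_derive_cpt (fun t => f (cons_rV (t, y))) _ (p 0 ord0) (q 0 ord0)).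
  - move=> t; have -> : (fun h : R => f (cons_rV (h, y))) =
        (fun h : R => f (h *: delta_mx 0 ord0 + cons_rV (0, y))).
      by apply/funext => h; rewrite cons_rV_head addr0.
    have E : (fun h : R => h^-1 *: (((fun h : R => f (h *: delta_mx 0 ord0 + cons_rV (0, y)))
         \o shift t) (h *: 1) - f (t *: delta_mx 0 ord0 + cons_rV (0, y)))) =
       (fun h : R => h^-1 *: ((f \o shift (cons_rV (t, y))) (h *: delta_mx 0 ord0)
          - f (cons_rV (t, y)))).
      apply/funext => h /=; rewrite !cons_rV_head !addr0.
      by rewrite [h *: 1]mulr1.
    by apply: DeriveDef; [rewrite /derivable E; exact: df|rewrite /derive E].
  - by move=> t; apply: (@continuous_comp _ _ _ (fun t => cons_rV (t, y)) (partial ord0 f));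
      [exact: continuous_cons_head|exact: cpf].
  - by move=> t /fpq /(_ ord0); rewrite cons_rV0.
  - by move=> t /pfpq /(_ ord0); rewrite cons_rV0.
rewrite fubini_rV1//; apply: integral0_eq => t _.
have E y : (fun h : R => h^-1 *: (((fun y => f (cons_rV (t, y))) \o shift y)
       (h *: delta_mx 0 j) - f (cons_rV (t, y)))) =
     (fun h : R => h^-1 *: ((f \o shift (cons_rV (t, y))) (h *: delta_mx 0 (lift ord0 j))
       - f (cons_rV (t, y)))).
  by apply/funext => h /=; rewrite cons_rV_tail.
have pE : partial j (fun y => f (cons_rV (t, y))) =
    (fun y => partial (lift ord0 j) f (cons_rV (t, y))).
  by apply/funext => y; rewrite /partial /derive E.
under eq_integral do rewrite -(congr1 (@^~ _) pE).
apply: (ih (behead_rV p) (behead_rV q)).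
- by move=> y; apply: (@continuous_comp _ _ _ (fun y => cons_rV (t, y)) f);
    [exact: continuous_cons_tail|exact: cf].
- by move=> y; rewrite /derivable E; exact: df.
- rewrite pE => y; apply: (@continuous_comp _ _ _ (fun y => cons_rV (t, y))
    (partial (lift ord0 j) f)); [exact: continuous_cons_tail|exact: cpf].
- by move=> y /fpq h k; have := h (lift ord0 k); rewrite cons_rVS !mxE.
- by move=> y; rewrite pE => /pfpq h k; have := h (lift ord0 k); rewrite cons_rVS !mxE.
Qed.

End integral_partial.

Section C1_functions.
Context {R : realType} {n : nat}.
Implicit Types (Omega : set 'rV[R]_n) (f g eta : 'rV[R]_n -> R).
Local Notation mu := (lebesgue_rV R n).

Definition C1 f := continuous f /\
  forall i, (forall x, derivable f x (delta_mx 0 i)) /\ continuous (partial i f).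

Lemma smooth_C1 f : smooth f -> C1 f.
Proof.
move=> sf; split; first by case: (sf [::]).
by move=> i; split; [case: (sf [::])|case: (sf [:: i])].
Qed.

Lemma compact_sub_cbox (K : set 'rV[R]_n) : compact K -> exists p q, K `<=` cbox p q.
Proof.
move=> cK; have bK i : exists M, forall x, K x -> `|x 0 i| <= M.
  have [|M _ HM] := @continuous_compact_bound R n K (fun x => x 0 i) cK.
    by apply: continuous_subspaceT; exact: coord_continuous.
  by exists M.
have [M HM] := choice bK.
exists (\row_i - M i), (\row_i M i) => x Kx i; rewrite !mxE.
by have := HM i x Kx; rewrite ler_norml.
Qed.

Lemma partial_support f i x : partial i f x != 0 -> closure [set y | f y != 0] x.
Proof.
apply: contraNP => nx; apply/eqP.
have : nbhs x (~` closure [set y | f y != 0]).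
  by apply: open_nbhs_nbhs; split => //; rewrite openC; exact: closed_closure.
move=> nx0; rewrite /partial -[RHS](@derive_cst R 'rV[R]_n R (0 : R) x (delta_mx 0 i)).
apply: near_eq_derive; apply: filterS nx0 => y /= ny.
by apply/eqP; apply: contra_notT ny => fy; exact: subset_closure.
Qed.

Lemma smooth_partial f i : smooth f -> smooth (partial i f).
Proof.
by move=> sf s; have := sf (rcons s i); rewrite foldr_rcons.
Qed.

Lemma test_partial Omega eta i : test_function Omega eta ->
  test_function Omega (partial i eta).
Proof.
move=> [se ce eO]; have sub : closure [set x | partial i eta x != 0] `<=`
    closure [set x | eta x != 0].
  rewrite [X in _ `<=` X](iffLR (closure_id _)); last exact: closed_closure.
  by apply: closureS => x; exact: partial_support.
split; [exact: smooth_partial| |exact: subset_trans sub eO].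
by apply: subclosed_compact sub => //; exact: closed_closure.
Qed.

Lemma test_eq0 Omega eta x : test_function Omega eta -> ~ Omega x -> eta x = 0.
Proof.
move=> [_ _ eO] nOx; apply/eqP; apply: contra_notT nOx => ex.
by apply: eO; exact: subset_closure.
Qed.

Lemma Rintegral_support Omega g : (forall x, ~ Omega x -> g x = 0) ->
  \int[mu]_(x in Omega) g x = \int[mu]_x g x.
Proof.
move=> g0; rewrite Rintegral_mkcond; congr Rintegral; apply/funext => x.
by rewrite patchE; case: ifPn => // /negP; rewrite inE => /g0.
Qed.

(** The product [f x * eta x] is supported in a box, so the integral of its partial derivative is 0
    by [integral_partial0]; the product rule splits that integral. *)
Lemma weak_gradient_C1 Omega f : C1 f ->
  weak_gradient Omega f (fun x => \row_i partial i f x).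
Proof.
move=> [cf Cf] eta teta i; have [df cpf] := Cf i.
have teta' := test_partial i teta.
rewrite Rintegral_support; last first.
  by move=> x nx; rewrite (test_eq0 teta' nx) mulr0.
rewrite [X in - X](@Rintegral_support Omega); last first.
  by move=> x nx; rewrite (test_eq0 teta nx) mulr0.
have [se ce eO] := teta; have [p [q Kpq]] := compact_sub_cbox ce.
have [ceta Ceta] := smooth_C1 se; have [deta cpeta] := Ceta i.
have pE x : partial i (fun x => f x * eta x) x = f x * partial i eta x + partial i f x * eta x.
  rewrite /partial; have := deriveM (df x) (deta x).
  by rewrite [X in _ = _ + X -> _]mulrC.
have pE' := funext pE.
have etapq x : eta x != 0 -> cbox p q x by move=> ex; apply: Kpq; exact: subset_closure.
have petapq x : partial i eta x != 0 -> cbox p q x.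
  by move=> /partial_support; exact: Kpq.
have c1 : continuous (fun x => f x * partial i eta x).
  by move=> x; exact: (cvgM (cf x) (cpeta x)).
have c2 : continuous (fun x => partial i f x * eta x).
  by move=> x; exact: (cvgM (cpf x) (ceta x)).
have b1 x : f x * partial i eta x != 0 -> cbox p q x.
  by rewrite mulf_eq0 negb_or => /andP[_ /petapq].
have b2 x : partial i f x * eta x != 0 -> cbox p q x.
  by rewrite mulf_eq0 negb_or => /andP[_ /etapq].
have i1 := continuous_cbox_integrable c1 b1.
have i2 := continuous_cbox_integrable c2 b2.
have fe0 : (\int[mu]_x (partial i (fun x => f x * eta x) x)%:E = 0)%E.
  apply: (@integral_partial0 R n p q) => [x|x||x|x].
  - exact: (cvgM (cf x) (ceta x)).
  - exact: derivableM.
  - by rewrite pE' => x; exact: (cvgD (c1 x) (c2 x)).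
  - by rewrite mulf_eq0 negb_or => /andP[_ /etapq].
  - rewrite pE; apply: contraNP => npq; apply/eqP.
    have /eqP -> : f x * partial i eta x == 0 by apply: contra_notT npq => /b1.
    by rewrite add0r; apply/eqP; apply: contra_notT npq => /b2.
have /eqP : \int[mu]_x (f x * partial i eta x + partial i f x * eta x) = 0.
  by rewrite -pE' /Rintegral fe0.
rewrite RintegralD//.
rewrite addr_eq0 => /eqP ->; congr (- _).
by apply: eq_Rintegral => x _; rewrite mxE.
Qed.

End C1_functions.

Section L2_cvg.
Context {d : measure_display} {T : measurableType d} {R : realType}.
Variables (mu : {measure set T -> \bar R}) (D : set T).
Hypothesis mD : measurable D.
Implicit Types f g h : T -> R.

Local Notation L2 := (L2 mu D).
Local Notation dot := (L2_dot mu D).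

(** Square integrable functions as a subtype, in the shape required by [psd_CS]; Cauchy-Schwarz in
    L2 is then an instance. *)
Definition L2_comb a (f g : {f : T -> R | L2 f}) : {f : T -> R | L2 f} :=
  exist _ (fun x => a * sval f x + sval g x) (L2_lin mD a (svalP f) (svalP g)).

Definition L2_form (f g : {f : T -> R | L2 f}) : R := dot (sval f) (sval g).

Lemma L2_form_comb a (f g h : {f : T -> R | L2 f}) :
  L2_form (L2_comb a f g) h = a * L2_form f h + L2_form g h.
Proof. by rewrite /L2_form dotDl//; exact: svalP. Qed.

Lemma L2_form_sym (f g : {f : T -> R | L2 f}) : L2_form f g = L2_form g f.
Proof. exact: dotC. Qed.

Lemma L2_form_ge0 (f : {f : T -> R | L2 f}) : 0 <= L2_form f f.
Proof. exact: dot_ge0. Qed.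

Lemma dot_CS f g : L2 f -> L2 g -> dot f g ^+ 2 <= dot f f * dot g g.
Proof.
move=> Lf Lg.
exact: (psd_CS L2_form_comb L2_form_sym L2_form_ge0 (exist _ f Lf) (exist _ g Lg)).
Qed.

Lemma cvg_dotl (f_ : nat -> T -> R) f h : (forall n, L2 (f_ n)) -> L2 f -> L2 h ->
  dot (fun x => f_ n x - f x) (fun x => f_ n x - f x) @[n --> \oo] --> 0 ->
  dot (f_ n) h @[n --> \oo] --> dot f h.
Proof.
move=> Lf_ Lf Lh c0; apply/subr_cvg0.
apply: (@cvg0_sqr_le _ _ (fun n => dot (fun x => f_ n x - f x) (fun x => f_ n x - f x) * dot h h)).
  by move=> n; rewrite -dotBl//; apply: dot_CS => //; exact: L2_sub.
by rewrite -[X in _ --> X](mul0r (dot h h)); apply: cvgMl.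
Qed.

End L2_cvg.

Lemma within_closed_measurable (R : realType) n (K : set 'rV[R]_n) (f : 'rV[R]_n -> R) :
  closed K -> {within K, continuous f} -> measurable_fun K f.
Proof.
move=> cK /continuousP cf; apply: (measurability _ (RGenOpens.measurableE R)).
move=> _ [_ [a [b ->] <-]].
have /open_subspaceP[V oV VK] := cf _ (@interval_open R (BRight a) (BLeft b) isT isT).
rewrite setIC -VK; apply: measurableI; first exact: open_borel.
by rewrite -(setCK K); apply: measurableC; apply: open_borel; rewrite openC.
Qed.

(** * Bounded open sets and their Sobolev functions *)

Section domain.
Context {R : realType} {d : nat} (Omega : set 'rV[R]_d).
Hypotheses (oO : open Omega) (bO : bounded_set Omega).
Local Notation mu := (lebesgue_rV R d).
Local Notation Gamma := (boundary Omega).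
Local Notation sigma := (surface_measure R d).

Lemma domain_measurable : measurable Omega.
Proof. exact: open_borel. Qed.

Lemma closed_measurable_rV (K : set 'rV[R]_d) : closed K -> measurable K.
Proof.
by move=> cK; rewrite -(setCK K); apply: measurableC; apply: open_borel; rewrite openC.
Qed.

Lemma closure_domain_cbox : exists p q, closure Omega `<=` cbox p q.
Proof.
have [M [Mr HM]] := bO.
pose N := `|M| + 1; exists (\row_i - N), (\row_i N).
rewrite [X in _ `<=` X](iffLR (closure_id _)); last exact: closed_cbox.
apply: closureS => x Ox i; rewrite !mxE -ler_norml.
have : `|x| <= N by apply: HM => //; rewrite /N (le_lt_trans (ler_norm M))// ltrDl.
apply: le_trans; rewrite [leRHS]mx_normrE.
exact: (le_bigmax _ (fun ij : 'I_1 * 'I_d => `|x ij.1 ij.2|) (0, i)).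
Qed.

Lemma compact_closure_domain : compact (closure Omega).
Proof.
have [p [q pq]] := closure_domain_cbox.
exact: (subclosed_compact (@closed_closure _ _) (@cbox_compact _ _ p q) pq).
Qed.

Lemma boundaryE : Gamma = closure Omega `\` Omega.
Proof. by rewrite /boundary (iffLR (interior_id _) oO). Qed.

Lemma closed_boundary : closed Gamma.
Proof.
rewrite boundaryE setDE; apply: closedI; first exact: closed_closure.
exact: open_closedC.
Qed.

Lemma boundary_measurable : measurable Gamma.
Proof. by apply: closed_measurable_rV; exact: closed_boundary. Qed.

Lemma boundary_sub_closure : Gamma `<=` closure Omega.
Proof. by rewrite boundaryE => x []. Qed.

Lemma boundary_disjoint x : Gamma x -> ~ Omega x.
Proof. by rewrite boundaryE => -[]. Qed.

Lemma domain_lty : (mu Omega < +oo)%E.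
Proof.
have [p [q pq]] := closure_domain_cbox.
apply: (le_lt_trans _ (lebesgue_cbox_lty p q)); apply: le_measure; rewrite ?inE//.
- exact: domain_measurable.
- exact: measurable_cbox.
- by apply: subset_trans pq; exact: subset_closure.
Qed.

Lemma closure_continuous_L2 f : {within closure Omega, continuous f} -> L2 mu Omega f.
Proof.
move=> cf; have mf := within_closed_measurable (@closed_closure _ _) cf.
have [M M0 HM] := continuous_compact_bound compact_closure_domain cf.
apply: (L2_bounded domain_measurable (M := M) domain_lty).
  apply: measurable_funS mf; last exact: subset_closure.
  by apply: closed_measurable_rV; exact: closed_closure.
by move=> x Ox; apply: HM; exact: subset_closure.
Qed.

Lemma closure_continuous_L2_boundary f : (sigma Gamma < +oo)%E ->
  {within closure Omega, continuous f} -> L2 sigma Gamma f.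
Proof.
move=> Goo cf; have mf := within_closed_measurable (@closed_closure _ _) cf.
have [M M0 HM] := continuous_compact_bound compact_closure_domain cf.
apply: (L2_bounded boundary_measurable (M := M) Goo).
  apply: measurable_funS mf; last exact: boundary_sub_closure.
  by apply: closed_measurable_rV; exact: closed_closure.
by move=> x Gx; apply: HM; exact: boundary_sub_closure.
Qed.

Lemma continuous_L2 f : continuous f -> L2 mu Omega f.
Proof. by move=> cf; apply: closure_continuous_L2; exact: continuous_subspaceT. Qed.

Lemma test_L2 eta : test_function Omega eta -> L2 mu Omega eta.
Proof. by move=> [se _ _]; apply: continuous_L2; case: (smooth_C1 se). Qed.

Definition C1_H1 (f : 'rV[R]_d -> R) (Cf : C1 f) : H1 Omega.
Proof.
refine {| H1_fun := f; H1_grad := fun x => \row_i partial i f x;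
  H1_weak_gradient := @weak_gradient_C1 R d Omega f Cf |}.
- by apply: continuous_L2; case: Cf.
- move=> i; have [_ /(_ i)[_ /continuous_L2]] := Cf; congr (L2 _ _ _).
  by apply/funext => x; rewrite mxE.
Defined.

Lemma C1_H1_continuous (f : 'rV[R]_d -> R) (Cf : C1 f) : H1_continuous (C1_H1 Cf).
Proof. by apply: continuous_subspaceT; case: Cf. Qed.

Lemma weak_gradient_comb (a : R) (u v : 'rV[R]_d -> R) (G H : 'rV[R]_d -> 'rV[R]_d) :
  L2 mu Omega u -> L2 mu Omega v ->
  (forall i, L2 mu Omega (fun x => G x 0 i)) -> (forall i, L2 mu Omega (fun x => H x 0 i)) ->
  weak_gradient Omega u G -> weak_gradient Omega v H ->
  weak_gradient Omega (fun x => a * u x + v x) (fun x => a *: G x + H x).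
Proof.
move=> Lu Lv LG LH wu wv eta teta i.
have tp := test_L2 (test_partial i teta); have tt := test_L2 teta.
have := wu eta teta i; have := wv eta teta i.
rewrite -!/(L2_dot mu Omega _ _) -/(L2_dot mu Omega (fun x => G x 0 i) eta).
rewrite -/(L2_dot mu Omega (fun x => H x 0 i) eta) => hv hu.
rewrite (dotDl domain_measurable)// hu hv mulrN -opprD -dotDl//; last exact: domain_measurable.
by congr (- _); apply: eq_Rintegral => x _; rewrite !mxE.
Qed.

Definition H1_comb (a : R) (u v : H1 Omega) : H1 Omega.
Proof.
refine {| H1_fun := fun x => a * u x + v x; H1_grad := fun x => a *: H1_grad u x + H1_grad v x;
  H1_weak_gradient := weak_gradient_comb a (H1_fun_L2 u) (H1_fun_L2 v)
    (H1_grad_L2 u) (H1_grad_L2 v) (@H1_weak_gradient _ _ _ u) (@H1_weak_gradient _ _ _ v) |}.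
- by apply: L2_lin; [exact: domain_measurable|exact: H1_fun_L2..].
- move=> i; have := L2_lin domain_measurable a (H1_grad_L2 u i) (H1_grad_L2 v i).
  by congr (L2 _ _ _); apply/funext => x; rewrite !mxE.
Defined.

Lemma H1_comb_continuous (a : R) (u v : H1 Omega) : H1_continuous u -> H1_continuous v ->
  H1_continuous (H1_comb a u v).
Proof.
move=> cu cv x; apply: cvgD; last exact: cv.
by apply: cvgMr; exact: cu.
Qed.

(** Both sides of the identity defining a weak gradient are inner products with a fixed L2 function,
    so they pass to the limit. This puts the limit of a Cauchy sequence back into H^1(Omega). *)
Lemma weak_gradient_limit (u_ : nat -> H1 Omega) (u : 'rV[R]_d -> R) (G : 'rV[R]_d -> 'rV[R]_d) :
  L2 mu Omega u -> (forall i, L2 mu Omega (fun x => G x 0 i)) ->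
  L2_dot mu Omega (fun x => u_ n x - u x) (fun x => u_ n x - u x) @[n --> \oo] --> 0 ->
  (forall i, L2_dot mu Omega (fun x => H1_grad (u_ n) x 0 i - G x 0 i)
     (fun x => H1_grad (u_ n) x 0 i - G x 0 i) @[n --> \oo] --> 0) ->
  weak_gradient Omega u G.
Proof.
move=> Lu LG cu cG eta teta i; have mO := domain_measurable.
have tp := test_L2 (test_partial i teta); have tt := test_L2 teta.
have c1 := cvg_dotl mO (fun n => H1_fun_L2 (u_ n)) Lu tp cu.
have c2 := cvg_dotl mO (fun n => H1_grad_L2 (u_ n) i) (LG i) tt (cG i).
have eq12 : (fun n => L2_dot mu Omega (u_ n) (partial i eta)) =
    (fun n => - L2_dot mu Omega (fun x => H1_grad (u_ n) x 0 i) eta).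
  by apply/funext => n; exact: (@H1_weak_gradient _ _ _ (u_ n)).
rewrite eq12 in c1.
exact: (cvg_unique (@norm_hausdorff _ _) c1 (cvgN c2)).
Qed.

End domain.

(** * Maz'ya's inequality *)

Section hausdorff_projection.
Context {R : realType} {n : nat}.
Local Notation mu := (lebesgue_rV R n).

(** The ball lies between the cubes of half side 1/(n + 1) and 1. Positivity matters because the
    weight of a set in a cover must bound the volume of a cube. *)
Lemma unit_ball_volume_gt0 : exists2 w : R, 0 < w & unit_ball_volume R n = w%:E.
Proof.
pose U : set 'rV[R]_n := [set x | euclid x <= 1].
have UE : U = [set x : 'rV[R]_n | \sum_(i < n) x 0 i ^+ 2 <= 1].
  apply/seteqP; split=> x; rewrite /U /= /euclid;
    by rewrite -(ler_sqrt (\sum_(i < n) x 0 i ^+ 2) (@ler01 R)) sqrtr1.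
have mU : measurable U.
  have ms : measurable_fun setT (fun x : 'rV[R]_n => \sum_(i < n) x 0 i ^+ 2).
    by apply: measurable_sum => i; apply: measurable_funX; exact: measurable_coord.
  have := ms measurableT `]-oo, 1]%classic (measurable_itv _).
  by rewrite setTI UE; congr measurable; apply/seteqP; split=> x /=; rewrite in_itv.
pose r : R := n.+1%:R^-1; have r0 : 0 < r by rewrite invr_gt0.
pose B1 : set 'rV[R]_n := cbox (\row_i - r) (\row_i r).
pose B2 : set 'rV[R]_n := cbox (\row_i - 1) (\row_i 1).
have B1U : B1 `<=` U.
  rewrite UE => x h /=; apply: (@le_trans _ _ (\sum_(i < n) r)).
    apply: ler_sum => i _; have := h i; rewrite !mxE -ler_norml => xr.
    have r1 : r <= 1 by rewrite invf_le1// ler1n.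
    rewrite -real_normK ?num_real// expr2 (le_trans (ler_piMr _ (le_trans xr r1)))//.
  by rewrite sumr_const card_ord -[r *+ n]mulr_natl ler_pdivrMr// mul1r ler_nat.
have UB2 : U `<=` B2.
  by move=> x /= h i; rewrite !mxE -ler_norml (le_trans (coord_le_euclid x i)).
have lB1 : mu B1 = ((r + r) ^+ n)%:E.
  rewrite lebesgue_cbox; last by move=> i; rewrite !mxE ge0_cp ?ltW.
  by congr EFin; under eq_bigr do rewrite !mxE opprK; rewrite prodr_const card_ord.
have Ufin : (unit_ball_volume R n < +oo)%E.
  apply: le_lt_trans (lebesgue_cbox_lty (\row_i - 1) (\row_i 1)).
  by apply: le_measure; rewrite ?inE//; exact: measurable_cbox.
exists (fine (unit_ball_volume R n)); last first.
  by rewrite fineK// ge0_fin_numE//; exact: measure_ge0.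
rewrite fine_gt0// Ufin andbT; apply: (@lt_le_trans _ _ (mu B1)).
  by rewrite lB1 lte_fin exprn_gt0// addr_gt0.
by apply: le_measure; rewrite ?inE//; exact: measurable_cbox.
Qed.

(** Coordinates differ by at most the Euclidean distance, so the cube of half side the diameter
    about the projection of any point of [F] contains the whole projection. *)
Lemma diameter_cube (F : set 'rV[R]_n.+1) (delta : R) : F !=set0 ->
  (diameter F <= delta%:E)%E -> exists2 r, 0 <= r & diameter F = r%:E /\
  exists c, @behead_rV R n @` F `<=` cbox (c - const_mx r) (c + const_mx r).
Proof.
move=> [x Fx] dF.
have d0 : (0 <= diameter F)%E.
  apply: (@le_trans _ _ (euclid (x - x))%:E); first by rewrite lee_fin sqrtr_ge0.
  by apply: ereal_sup_ubound; exists x => //; exists x.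
have dfin : diameter F \is a fin_num by rewrite ge0_fin_numE// (le_lt_trans dF)// ltry.
exists (fine (diameter F)); first exact: fine_ge0.
split; first by rewrite fineK.
exists (behead_rV x) => _ [y Fy <-] i; rewrite !mxE -ler_distlC.
rewrite distrC -lee_fin fineK//; apply: (@le_trans _ _ (euclid (y - x))%:E).
  by rewrite lee_fin; have := coord_le_euclid (y - x) (lift ord0 i); rewrite !mxE.
by apply: ereal_sup_ubound; exists y => //; exists x.
Qed.

(** The ratio of the volume (2r)^n of the cube to the weight omega_n (r/2)^n of a set of diameter
    r. *)
Definition hausdorff_proj_const : R := 4 ^+ n / fine (unit_ball_volume R n).

Lemma hausdorff_proj_const_ge0 : 0 <= hausdorff_proj_const.
Proof. by rewrite mulr_ge0 ?exprn_ge0// invr_ge0 fine_ge0// measure_ge0. Qed.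

(* The projection along the first axis does not increase the n-dimensional
   Hausdorff measure, up to a constant: replace the sets of an almost optimal
   cover by cubes of twice their diameter *)
Lemma hausdorff_proj (A : set 'rV[R]_n.+1) (e : R) : (0 < n)%N -> 0 < e ->
  (hausdorff n A < +oo)%E ->
  exists E : set 'rV[R]_n, [/\ measurable E, @behead_rV R n @` A `<=` E &
    (mu E <= hausdorff_proj_const%:E * (hausdorff n A + e%:E))%E].
Proof.
move=> n0 e0 Aoo.
(* Covers at scale 1 suffice: their content is at most the Hausdorff measure, and the cubes only
   require finite diameters. *)
have cA := hausdorff_ge_content n A (@ltr01 R).
have cfin : hausdorff_content n 1 A \is a fin_num.
  by rewrite ge0_fin_numE ?hausdorff_content_ge0// (le_lt_trans cA).
have [_ [F [dF AF] <-] sF] := lb_ereal_inf_adherent e0 cfin.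
have [w w0 wE] := unit_ball_volume_gt0.
have H k : exists E : set 'rV[R]_n, [/\ measurable E, @behead_rV R n @` (F k) `<=` E &
    (mu E <= hausdorff_proj_const%:E * hausdorff_weight n (F k))%E].
  have [F0|/set0P Fn0] := eqVneq (F k) set0.
    by exists set0; rewrite F0 image_set0 measure0 hausdorff_weight0 mule0; split.
  have [r r0 [dr [c Fc]]] := diameter_cube Fn0 (dF k).
  exists (cbox (c - const_mx r) (c + const_mx r)); split => //.
    exact: measurable_cbox.
  rewrite lebesgue_cbox; last by move=> i; rewrite !mxE; lra.
  rewrite /hausdorff_weight ifF; last exact/negbTE/set0P.
  rewrite dr wE -EFinM -EFin_expe -!EFinM lee_fin /hausdorff_proj_const wE /=.
  under eq_bigr do rewrite !mxE.
  rewrite (eq_bigr (fun=> 2 * r)); last by move=> i _; ring.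
  rewrite prodr_const card_ord mulrA mulfVK ?gt_eqF// -exprMn mulrA.
  by rewrite (_ : 4 * 2^-1 = 2 :> R)//; field.
have [E HE] := choice H.
exists (\bigcup_k E k); split.
- by apply: bigcupT_measurable => k; case: (HE k).
- move=> _ [x Ax <-]; have [k _ Fkx] := AF _ Ax; exists k => //.
  by have [_ + _] := HE k; apply; exists x.
apply: (@le_trans _ _ (\sum_(0 <= k <oo) mu (E k))%E).
  apply: measure_sigma_subadditive => //; first by move=> k; case: (HE k).
  by apply: bigcupT_measurable => k; case: (HE k).
apply: (@le_trans _ _ (\sum_(0 <= k <oo) hausdorff_proj_const%:E * hausdorff_weight n (F k))%E).
  by apply: lee_nneseries => [k _ _|k _]; [exact: measure_ge0|case: (HE k)].
rewrite nneseriesZl; last by move=> k _; exact: hausdorff_weight_ge0.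
rewrite lee_pmul2l// ?lte_fin.
  by rewrite (le_trans (ltW sF))// leeD2r.
by rewrite /hausdorff_proj_const wE/= divr_gt0// exprn_gt0.
Qed.

End hausdorff_projection.

Section projection_majorant.
Context {R : realType} {n : nat}.
Local Notation mu := (lebesgue_rV R n).
Local Notation sigma := (surface_measure R n.+1).

(** The natural majorant is the supremum of w over each fibre of the projection, whose measurability
    is unclear. Instead K is cut into the level sets [k h <= w < (k + 1) h], each is projected into
    a measurable set by [hausdorff_proj], and m adds the upper levels of the sets containing y. *)
Lemma projection_majorant (K : set 'rV[R]_n.+1) (w : 'rV[R]_n.+1 -> R) (M e : R) :
  (0 < n)%N -> 0 < e -> measurable K -> (sigma K < +oo)%E -> measurable_fun K w ->
  (forall x, K x -> 0 <= w x <= M) ->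
  exists m : 'rV[R]_n -> R, [/\ measurable_fun setT m, forall y, 0 <= m y,
    forall x, K x -> w x <= m (behead_rV x) &
    (\int[mu]_y (m y)%:E <= (@hausdorff_proj_const R n)%:E *
      (\int[sigma]_(x in K) (w x)%:E + e%:E))%E].
Proof.
move=> n0 e0 mK Koo mw wM.
pose S := fine (sigma K).
have SE : sigma K = S%:E by rewrite fineK// ge0_fin_numE.
have S0 : 0 <= S by rewrite fine_ge0.
(* Rounding w up to the next level costs at most h times the measure S of K, which is below e / 2; S
   + 1 keeps the denominator positive. *)
pose h : R := e / (2 * (S + 1)).
have h0 : 0 < h by rewrite divr_gt0// mulr_gt0// ltr_wpDl.
pose N := (Num.truncn (M / h)).+1.
pose A k := K `&` [set x | k%:R * h <= w x < k.+1%:R * h].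
have mA k : measurable (A k).
  have := mw mK `[k%:R * h, k.+1%:R * h[%classic (measurable_itv _).
  by congr measurable; apply/seteqP; split=> x /=; rewrite in_itv.
have AK k : A k `<=` K by move=> x [].
have Aoo k : (sigma (A k) < +oo)%E.
  by apply: le_lt_trans Koo; apply: le_measure; rewrite ?inE.
pose c k : R := k.+1%:R * h.
have c0 k : 0 < c k by rewrite mulr_gt0.
(* The errors of the N projections, weighted by the levels [c k], add up to the other e / 2. *)
pose e' k := e / (2 * N%:R * c k).
have e'0 k : 0 < e' k by apply: divr_gt0 => //; apply: mulr_gt0 => //; apply: mulr_gt0.
have /choice[E HE] := fun k => hausdorff_proj n0 (e'0 k) (Aoo k).
pose m y : R := \sum_(k < N) c k * \1_(E k) y.
have mE k : measurable (E k) by case: (HE k).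
exists m; split.
- apply: measurable_sum => k; apply: measurable_funM => //.
- by move=> y; apply: sumr_ge0 => k _; rewrite mulr_ge0// ltW.
- move=> x Kx; have /andP[w0 wxM] := wM x Kx.
  pose k := Num.truncn (w x / h).
  have /andP[k1 k2] : k%:R <= w x / h < k.+1%:R by apply: truncn_itv; rewrite divr_ge0// ltW.
  rewrite ler_pdivlMr// in k1; rewrite ltr_pdivrMr// in k2.
  have kN : (k < N)%N.
    rewrite ltnS; apply: le_truncn; rewrite ler_pM2r// invr_gt0//.
  rewrite /m (bigD1 (Ordinal kN))//= indicE mem_set; last first.
    by have [_ + _] := HE k; apply; exists x => //; split => //=; rewrite k1.
  rewrite mulr1 (le_trans (ltW k2))// lerDl sumr_ge0// => i _.
  by rewrite mulr_ge0// ltW.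
have intm : (\int[mu]_y (m y)%:E = \sum_(k < N) (c k)%:E * mu (E k))%E.
  under eq_integral do rewrite /m -sumEFin.
  rewrite ge0_integral_sum//.
  - apply: eq_bigr => k _; under eq_integral do rewrite EFinM.
    rewrite ge0_integralZl//.
    + by rewrite integral_indic// setIT.
    + by apply/measurable_EFinP.
    + by rewrite lee_fin ltW.
  - by move=> k; apply/measurable_EFinP; apply: measurable_funM.
  - by move=> k y _; rewrite lee_fin mulr_ge0// ltW.
rewrite intm.
have C0 := @hausdorff_proj_const_ge0 R n.
apply: (@le_trans _ _ (\sum_(k < N) (@hausdorff_proj_const R n)%:E *
    ((c k)%:E * (sigma (A k) + (e' k)%:E)))%E).
  apply: lee_sum => k _; rewrite muleCA; apply: lee_pmul => //.
  - by rewrite lee_fin ltW.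
  - by case: (HE k).
rewrite -ge0_sume_distrr; last first.
  by move=> k _; rewrite mule_ge0// ?lee_fin ?(ltW (c0 _))// adde_ge0// lee_fin ltW.
apply: lee_wpmul2l; first by rewrite lee_fin.
apply: (@le_trans _ _ (\sum_(k < N) (c k)%:E * sigma (A k) + (e / 2)%:E)%E).
  rewrite (eq_bigr (fun k : 'I_N => (c k)%:E * sigma (A k) + (c k * e' k)%:E)%E); last first.
    move=> k _; rewrite EFinM; apply: ge0_muleDr; first exact: measure_ge0.
    by rewrite lee_fin ltW.
  rewrite big_split/= leeD2l// sumEFin lee_fin.
  rewrite (eq_bigr (fun=> e / (2 * N%:R))); last first.
    by move=> k _; rewrite /e'; field; rewrite !gt_eqF//= ?ltr0n.
  rewrite sumr_const card_ord -[_ *+ N]mulr_natl le_eqVlt; apply/orP; left; apply/eqP.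
  by field; rewrite gt_eqF// ltr0n.
(* On [A k] the level [c k] is k h + h, at most w + h, and each point lies in at most one level
   set. *)
have sumA : (\sum_(k < N) (c k)%:E * sigma (A k) <= \int[sigma]_(x in K) (w x + h)%:E)%E.
  rewrite (_ : (\sum_(k < N) _)%E = (\int[sigma]_(x in K) (\sum_(k < N) c k * \1_(A k) x)%:E)%E).
    apply: ge0_le_integral => //.
    - by move=> x _; rewrite lee_fin sumr_ge0// => k _; rewrite mulr_ge0// ltW.
    - apply/measurable_EFinP; apply: measurable_sum => k; apply: measurable_funM => //.
    - by apply/measurable_EFinP; apply: measurable_funD.
    move=> x Kx; rewrite lee_fin; have /andP[w0 _] := wM x Kx.
    pose k := Num.truncn (w x / h).
    have Ank (j : 'I_N) : A j x -> j = k :> nat.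
      move=> [_ /= /andP[j1 j2]]; apply/esym/truncn_def.
      by rewrite ler_pdivlMr// j1 ltr_pdivrMr.
    have [kN|kN] := ltnP k N; last first.
      rewrite big1 ?addr_ge0 ?(ltW h0)// => j _; rewrite indicE memNset ?mulr0//.
      by move/Ank => jk; move: kN; rewrite -jk leqNgt ltn_ord.
    rewrite (bigD1 (Ordinal kN))//= big1 ?addr0; last first.
      move=> j jk; rewrite indicE memNset ?mulr0// => /Ank jk'.
      by move/eqP: jk; apply; apply/val_inj.
    rewrite /c -natr1 mulrDl mul1r mulrDl indicE.
    case: (boolP (x \in A k)) => [|_]; last by rewrite !mulr0 !addr0 addr_ge0// ltW.
    by rewrite inE => -[_ /= /andP[h1 _]]; rewrite !mulr1 lerD2r.
  under eq_integral do rewrite -sumEFin.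
  rewrite ge0_integral_sum//.
  - apply: eq_bigr => k _; under eq_integral do rewrite EFinM.
    rewrite ge0_integralZl//.
    + by rewrite integral_indic// (setIidl (@AK k)).
    + by apply/measurable_EFinP.
    + by rewrite lee_fin ltW.
  - by move=> k; apply/measurable_EFinP; apply: measurable_funM.
  - by move=> k y _; rewrite lee_fin mulr_ge0// ltW.
apply: (le_trans (leeD2r _ sumA)).
under eq_integral do rewrite EFinD.
rewrite ge0_integralD//; first last.
- by move=> x _; rewrite lee_fin ltW.
- by apply/measurable_EFinP.
- by move=> x Kx; rewrite lee_fin; case/andP: (wM x Kx).
rewrite -addeA leeD2l// integral_cst// SE -EFinM -EFinD lee_fin.
have hS : h * (S + 1) = e / 2 by rewrite /h; field; rewrite gt_eqF// ltr_wpDl.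
by move: hS; rewrite mulrDr mulr1; move: (h * S) => hS; lra.
Qed.

End projection_majorant.

(** * Oscillation of a function of one variable with a weak derivative *)

Section smooth_step.
Context {R : realType}.
Local Notation leb := (@lebesgue_measure R).

Definition kernel1 : R -> R := plateau1 0 0 1.

Lemma smooth1_kernel1 : smooth1 kernel1.
Proof. exact: smooth1_plateau1. Qed.

Lemma kernel1_ge0 x : 0 <= kernel1 x.
Proof. exact: plateau1_ge0. Qed.

Lemma kernel1_support x : kernel1 x != 0 -> 0 < x < 1.
Proof. by apply: contraNT => h; apply/eqP; exact: plateau1_eq0. Qed.

Lemma kernel1_half : 0 < kernel1 2^-1.
Proof.
rewrite /kernel1 /plateau1 /flat !hornerC !mul1r !ifT ?mulr_gt0 ?expR_gt0//; lra.
Qed.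

Lemma kernel1_continuous : continuous kernel1.
Proof. exact/smooth1_continuous/smooth1_kernel1. Qed.

Lemma kernel1_affine_continuous (p q : R) : continuous (fun x : R => p * kernel1 (p * x + q)).
Proof.
apply: smooth1_continuous; apply: smooth1M; first exact: smooth1_cst.
by apply: smooth1_affine; exact: smooth1_kernel1.
Qed.

Lemma kernel1_integrable : leb.-integrable setT (EFin \o kernel1).
Proof.
have -> : EFin \o kernel1 = (EFin \o kernel1) \_ `[0, 1]%classic.
  apply/funext => x; rewrite patchE; case: ifPn => //= x01; congr EFin.
  apply/eqP; apply: contraNT x01 => /kernel1_support /andP[h1 h2].
  by rewrite inE /= in_itv/= !ltW.
have h : leb.-integrable `[0, 1] (EFin \o kernel1).
  apply: continuous_compact_integrable; first exact: segment_compact.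
  by apply: continuous_subspaceT; exact: kernel1_continuous.
have mI : measurable (`[0, 1]%classic : set (measurableTypeR R)) by exact: measurable_itv.
exact: (iffLR (integrable_mkcond _ mI) h).
Qed.

Definition step (x : R) : R := \int[leb]_(t in `]-oo, x]) kernel1 t.
(** The kernel is not normalised: its mass appears as a common positive factor and is cancelled in
    [oscillation_le]. *)
Definition step_mass : R := \int[leb]_t kernel1 t.

Lemma is_derive_step x : is_derive x (1 : R) step (kernel1 x).
Proof.
have xx1 : x < x + 1 by rewrite ltrDl.
have ki : leb.-integrable `]-oo, x + 1] (EFin \o kernel1).
  by apply: integrableS kernel1_integrable.
have [dF F'] : derivable step x 1 /\ derive1 step x = kernel1 x.
  apply: (@continuous_FTC1 R kernel1 (@BInfty R true) x (x + 1) xx1 ki).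
    by rewrite ltNyr.
  exact: kernel1_continuous.
by apply: DeriveDef; [exact: dF|rewrite -derive1E; exact: F'].
Qed.

Lemma smooth1_step : smooth1 step.
Proof. exact: smooth1_primitive smooth1_kernel1 is_derive_step. Qed.

Lemma step_eq0 x : x <= 0 -> step x = 0.
Proof.
move=> x0; rewrite /step Rintegral_mkcond (_ : _ \_ _ = cst 0).
  by rewrite Rintegral_cst// mul0r.
apply/funext => t; rewrite patchE; case: ifPn => //; rewrite inE /= in_itv/= => tx.
apply/eqP; apply: contraT => /kernel1_support /andP[t0 _].
by have := lt_le_trans t0 (le_trans tx x0); rewrite ltxx.
Qed.

Lemma step_eq_mass x : 1 <= x -> step x = step_mass.
Proof.
move=> x1; rewrite /step Rintegral_mkcond; congr Rintegral; apply/funext => t.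
rewrite patchE; case: ifPn => //; rewrite notin_setE /= in_itv/= => /negP; rewrite -ltNge => xt.
apply/esym/eqP; apply: contraT => /kernel1_support /andP[_ t1].
by have := lt_trans (le_lt_trans x1 xt) t1; rewrite ltxx.
Qed.

Lemma step_ge0 x : 0 <= step x.
Proof. by apply: Rintegral_ge0 => t _; exact: kernel1_ge0. Qed.

Lemma step_le_mass x : step x <= step_mass.
Proof.
rewrite /step Rintegral_mkcond; apply: le_Rintegral => //.
- have h : leb.-integrable `]-oo, x] (EFin \o kernel1).
    by apply: integrableS kernel1_integrable.
  have mI : measurable (`]-oo, x]%classic : set (measurableTypeR R)) by exact: measurable_itv.
  have := iffLR (integrable_mkcond _ mI) h.
  by rewrite restrict_EFin.
- exact: kernel1_integrable.
- by move=> t _; rewrite patchE; case: ifP => // _; exact: kernel1_ge0.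
Qed.

(** With mass 0 the function [step] would be constant, and its derivative [kernel1] would vanish at
    1/2. *)
Lemma step_mass_gt0 : 0 < step_mass.
Proof.
rewrite lt_neqAle (le_trans (step_ge0 0) (step_le_mass 0)) andbT eq_sym.
apply/eqP => c0; have s0 : step = cst 0.
  by apply/funext => x; apply/eqP; rewrite eq_le step_ge0 andbT -[X in _ <= X]c0 step_le_mass.
have [_] := is_derive_step 2^-1; rewrite s0 derive_cst => k0.
by have := kernel1_half; rewrite -k0 ltxx.
Qed.

(* A smooth approximation of [step_mass * \1_[s, t]], supported in [s, t] *)
Definition hat (s t : R) (k : nat) (x : R) : R :=
  step (k.+1%:R * x + - (k.+1%:R * s)) + -1 * step (k.+1%:R * x + (1 - k.+1%:R * t)).

(** The derivative of [hat]. It approximates [step_mass] times the Dirac mass at s minus the one at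
    t, with both kernels on the inner side of their endpoints. *)
Definition hat' (s t : R) (k : nat) (x : R) : R :=
  k.+1%:R * kernel1 (k.+1%:R * x + - (k.+1%:R * s)) -
  k.+1%:R * kernel1 (k.+1%:R * x + (1 - k.+1%:R * t)).

Lemma smooth1_hat s t k : smooth1 (hat s t k).
Proof.
apply: smooth1D; first by apply: smooth1_affine; exact: smooth1_step.
by apply: smooth1M; [exact: smooth1_cst|apply: smooth1_affine; exact: smooth1_step].
Qed.

Lemma is_derive_step_affine (p q x : R) :
  is_derive x (1 : R) (fun x => step (p * x + q)) (p * kernel1 (p * x + q)).
Proof.
rewrite mulrC; apply: (@is_derive1_comp _ step (fun x => p * x + q)).
  exact: is_derive_step.
exact: is_derive_affine.
Qed.

Lemma derive_hat s t k : derive1 (hat s t k) = hat' s t k.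
Proof.
apply/funext => x; rewrite derive1E.
have := is_deriveD (is_derive_step_affine k.+1%:R (- (k.+1%:R * s)) x)
  (is_deriveZ (-1) (is_derive_step_affine k.+1%:R (1 - k.+1%:R * t) x)).
by case=> _ ->; rewrite /hat' [_ *: _]mulN1r.
Qed.

(** The hypothesis says that a ramp of width 1/(k + 1) fits inside [s, t], so outside the segment
    the two steps cancel or are both 0. *)
Lemma hat_support s t k x : 1 <= k.+1%:R * (t - s) -> hat s t k x != 0 -> s <= x <= t.
Proof.
move=> kts; have k0 : 0 < k.+1%:R :> R by [].
apply: contraNT; rewrite negb_and -!ltNge => /orP[xs|tx]; apply/eqP; rewrite /hat.
  have h : k.+1%:R * x < k.+1%:R * s by rewrite ltr_pM2l.
  by rewrite !step_eq0 ?mulr0 ?addr0//; move: kts; rewrite mulrBr; lra.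
have h : k.+1%:R * t < k.+1%:R * x by rewrite ltr_pM2l.
by rewrite !step_eq_mass ?mulN1r ?subrr//; move: kts; rewrite mulrBr; lra.
Qed.

Lemma hat'_support s t k x : 1 <= k.+1%:R * (t - s) -> hat' s t k x != 0 -> s <= x <= t.
Proof.
move=> kts; have k0 : 0 < k.+1%:R :> R by [].
have kn0 : k.+1%:R != 0 :> R by [].
apply: contraNT => xst; apply/eqP; rewrite /hat'.
have [/eqP ->|/kernel1_support/andP[h1 h2]] := boolP (kernel1 (k.+1%:R * x + - (k.+1%:R * s)) == 0).
  have [/eqP ->|/kernel1_support/andP[h1 h2]] :=
    boolP (kernel1 (k.+1%:R * x + (1 - k.+1%:R * t)) == 0); first by rewrite mulr0 subrr.
  exfalso; move/negP: xst; apply; rewrite -(ler_pM2l k0) -(ler_pM2l k0 x).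
  by move: kts; rewrite mulrBr => ?; apply/andP; split; lra.
exfalso; move/negP: xst; apply; rewrite -(ler_pM2l k0) -(ler_pM2l k0 x).
by move: kts; rewrite mulrBr => ?; apply/andP; split; lra.
Qed.

Lemma hat_le_mass s t k x : `|hat s t k x| <= step_mass.
Proof.
rewrite /hat mulN1r ler_norml; have := step_ge0 (k.+1%:R * x + - (k.+1%:R * s)).
have := step_le_mass (k.+1%:R * x + - (k.+1%:R * s)).
have := step_ge0 (k.+1%:R * x + (1 - k.+1%:R * t)).
have := step_le_mass (k.+1%:R * x + (1 - k.+1%:R * t)).
by move: (step _) (step _) => A B ? ? ? ?; apply/andP; split; lra.
Qed.

Lemma kernel_average (s t z e p q : R) (f : R -> R) : s < t ->
  {within `[s, t], continuous f} -> 0 < p ->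
  step (p * s + q) = 0 -> step (p * t + q) = step_mass ->
  (forall x, s <= x <= t -> kernel1 (p * x + q) != 0 -> `|f x - z| <= e) ->
  `|\int[leb]_(x in `[s, t]) (f x * (p * kernel1 (p * x + q))) - z * step_mass| <= e * step_mass.
Proof.
move=> st cf p0 ss tt fz.
pose w x := p * kernel1 (p * x + q).
have cw : continuous w := @kernel1_affine_continuous p q.
have wi (g : R -> R) : {within `[s, t], continuous g} ->
    leb.-integrable `[s, t] (EFin \o (fun x => g x * w x)).
  move=> cg; apply: continuous_compact_integrable; first exact: segment_compact.
  by move=> x; apply: cvgM; [exact: cg|exact: (continuous_subspaceT cw)].
have w0 x : 0 <= w x by rewrite mulr_ge0 ?kernel1_ge0// ltW.
have Iw : \int[leb]_(x in `[s, t]) w x = step_mass.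
  rewrite /Rintegral (@continuous_FTC2 _ w (fun x => step (p * x + q)))//.
  - by rewrite /= tt ss subr0.
  - exact: continuous_subspaceT.
  - have cs : continuous (fun x => step (p * x + q)).
      move=> x; apply: differentiable_continuous; apply/derivable1_diffP.
      by case: (is_derive_step_affine p q x).
    split; first by move=> x _; case: (is_derive_step_affine p q x).
    + by apply: cvg_at_right_filter; exact: cs.
    + by apply: cvg_at_left_filter; exact: cs.
  - by move=> x _; rewrite derive1E; case: (is_derive_step_affine p q x).
have cc (y : R) : {within `[s, t], continuous (fun=> y : R)}.
  by apply: continuous_subspaceT => x; exact: cvg_cst.
have wint : leb.-integrable `[s, t] (EFin \o w).
  have := wi _ (cc 1); congr integrable; apply/funext => x /=.
  by rewrite mul1r.
have -> : \int[leb]_(x in `[s, t]) (f x * w x) - z * step_mass =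
    \int[leb]_(x in `[s, t]) ((f x - z) * w x).
  rewrite -Iw -RintegralZl//.
  rewrite -RintegralB//; [|exact: wi|exact: wi].
  by apply: eq_Rintegral => x _; rewrite mulrBl.
have cfz : {within `[s, t], continuous (fun x => f x - z)}.
  by move=> x; apply: cvgB; [exact: cf|exact: cvg_cst].
have mI : measurable (`[s, t]%classic : set (measurableTypeR R)) by exact: measurable_itv.
apply: (le_trans (le_normr_Rintegral mI (wi _ cfz))).
rewrite -Iw -RintegralZl//.
apply: le_Rintegral => //.
- exact: (integrable_norm (wi _ cfz)).
- exact: wi _ (cc e).
- move=> x /=; rewrite in_itv/= => xst; rewrite normrM (ger0_norm (w0 x)).
  have [k0|kn0] := eqVneq (kernel1 (p * x + q)) 0; first by rewrite /w k0 !mulr0.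
  by rewrite ler_wpM2r// fz.
Qed.

Lemma within_segment_delta (s t z e : R) (f : R -> R) :
  {within `[s, t], continuous f} -> s <= z <= t -> 0 < e ->
  exists2 delta, 0 < delta & forall x, s <= x <= t -> `|x - z| < delta -> `|f x - f z| <= e.
Proof.
move=> /subspace_continuousP cf zst e0.
have zI : `[s, t]%classic z by rewrite /= in_itv.
have /cvgrPdist_le/(_ _ e0) := cf z zI.
rewrite near_withinE => /nbhs_ballP[delta /= d0 H]; exists delta => // x xst xz.
rewrite distrC; apply: H; last by rewrite /= in_itv.
by rewrite /ball/= distrC.
Qed.

(** Against [hat'] the function f gives approximately [step_mass * (f s - f t)], while the integral
    of g against [hat] is at most [step_mass] times that of |g|. Only the identities for these
    particular functions are assumed, since on a given line only countably many identities are
    available. *)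
Lemma oscillation_le (s t : R) (f g : R -> R) : s < t ->
  {within `[s, t], continuous f} -> leb.-integrable `[s, t] (EFin \o g) ->
  (forall k, 1 <= k.+1%:R * (t - s) ->
    \int[leb]_(x in `[s, t]) (f x * hat' s t k x + g x * hat s t k x) = 0) ->
  `|f t - f s| <= \int[leb]_(x in `[s, t]) `|g x|.
Proof.
move=> st cf gi H; apply/ler_addgt0Pr => e e0; have e2 : 0 < e / 2 by rewrite divr_gt0.
have sst : s <= s <= t by rewrite lexx ltW.
have tst : s <= t <= t by rewrite lexx ltW.
have [d1 d10 H1] := within_segment_delta cf sst e2.
have [d2 d20 H2] := within_segment_delta cf tst e2.
have mI : measurable (`[s, t]%classic : set (measurableTypeR R)) by exact: measurable_itv.
(* With 1/(k + 1) below this minimum, the kernels sit where f is within e / 2 of its values at s and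
   t, and both fit inside [s, t]. *)
pose dl := Num.min (Num.min d1 d2) (t - s).
have dl0 : 0 < dl by rewrite !lt_min d10 d20 subr_gt0.
have /ltr_add_invr[k kdl] : 0 < dl by []; rewrite add0r in kdl.
have k0 : 0 < k.+1%:R :> R by [].
have [kd1 kd2 kts] : [/\ 1 < k.+1%:R * d1, 1 < k.+1%:R * d2 & 1 < k.+1%:R * (t - s)].
  by move: kdl; rewrite !lt_min => /andP[/andP[h1 h2] h3]; split;
    rewrite -ltr_pdivrMl ?mulr1.
have a1 : `|\int[leb]_(x in `[s, t]) (f x * (k.+1%:R * kernel1 (k.+1%:R * x + - (k.+1%:R * s)))) -
    f s * step_mass| <= e / 2 * step_mass.
  apply: (kernel_average st cf k0).
  - by rewrite subrr step_eq0.
  - by apply: step_eq_mass; rewrite -mulrBr ltW.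
  move=> x xst /kernel1_support/andP[h1 h2]; apply: H1 => //.
  have : k.+1%:R * (x - s) < k.+1%:R * d1 by rewrite mulrBr; lra.
  by rewrite ltr_pM2l// ger0_norm// subr_ge0; case/andP: xst.
have a2 : `|\int[leb]_(x in `[s, t]) (f x * (k.+1%:R * kernel1 (k.+1%:R * x + (1 - k.+1%:R * t)))) -
    f t * step_mass| <= e / 2 * step_mass.
  apply: (kernel_average st cf k0).
  - by apply: step_eq0; move: kts; rewrite mulrBr; lra.
  - by apply: step_eq_mass; lra.
  move=> x xst /kernel1_support/andP[h1 h2]; apply: H2 => //.
  have : k.+1%:R * (t - x) < k.+1%:R * d2 by rewrite mulrBr; lra.
  by rewrite ltr_pM2l// distrC ger0_norm// subr_ge0; case/andP: xst.
have cker c : {within `[s, t], continuous (fun x => k.+1%:R * kernel1 (k.+1%:R * x + c))}.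
  exact: continuous_subspaceT (@kernel1_affine_continuous k.+1%:R c).
have fi c : leb.-integrable `[s, t]
    (EFin \o (fun x => f x * (k.+1%:R * kernel1 (k.+1%:R * x + c)))).
  apply: continuous_compact_integrable; first exact: segment_compact.
  by move=> x; apply: cvgM; [exact: cf|exact: cker].
have mhat : measurable_fun (`[s, t]%classic : set (measurableTypeR R)) (hat s t k).
  apply: measurable_funTS; apply: continuous_measurable_fun.
  exact/smooth1_continuous/smooth1_hat.
have mg : measurable_fun (`[s, t]%classic : set (measurableTypeR R)) g.
  by apply/measurable_EFinP; exact: (measurable_int leb).
have ghi : leb.-integrable `[s, t] (EFin \o (fun x => g x * hat s t k x)).
  have := integrableZl mI step_mass (integrable_norm gi); apply: le_integrable => //.
    by apply/measurable_EFinP; exact: measurable_funM.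
  move=> x _ /=; rewrite lee_fin normrM normrM normr_id mulrC ler_wpM2r//.
  by rewrite (le_trans (hat_le_mass _ _ _ _))// ler_norm.
have gh : `|\int[leb]_(x in `[s, t]) (g x * hat s t k x)| <=
    step_mass * \int[leb]_(x in `[s, t]) `|g x|.
  apply: (le_trans (le_normr_Rintegral mI ghi)).
  rewrite -RintegralZl//; last exact: integrable_norm.
  apply: le_Rintegral => //; first exact: integrable_norm.
    exact: (integrableZl mI step_mass (integrable_norm gi)).
  by move=> x _; rewrite normrM mulrC ler_wpM2r// hat_le_mass.
have := H k (ltW kts).
under eq_Rintegral do rewrite /hat' mulrBr.
have fBi : leb.-integrable `[s, t] (EFin \o (fun x =>
    f x * (k.+1%:R * kernel1 (k.+1%:R * x + - (k.+1%:R * s))) -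
    f x * (k.+1%:R * kernel1 (k.+1%:R * x + (1 - k.+1%:R * t))))).
  exact: (integrableB mI (fi _) (fi _)).
rewrite RintegralD// RintegralB//.
have c0 := step_mass_gt0.
move: a1 a2 gh; set J1 := Rintegral _ _ _; set J2 := Rintegral _ _ _.
set J3 := Rintegral _ _ _; set I := Rintegral _ _ _ => a1 a2 a3 J.
rewrite -(ler_pM2r c0) -[X in _ * X](gtr0_norm c0) -normrM mulrBl.
have -> : f t * step_mass - f s * step_mass =
    (J1 - f s * step_mass) - (J2 - f t * step_mass) + J3.
  by transitivity (f t * step_mass - f s * step_mass + (J1 - J2 + J3)); [rewrite J addr0|ring].
apply: (le_trans (ler_normD _ _)).
have ec : (I + e) * step_mass = step_mass * I + (e / 2 * step_mass + e / 2 * step_mass).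
  by field.
rewrite ec (le_trans (lerD (ler_normB _ _) (lexx _)))// [leRHS]addrC.
by apply: lerD => //; exact: lerD.
Qed.

End smooth_step.

Lemma ae_forall_countable d (T : measurableType d) (R : realType)
    (mu : {measure set T -> \bar R}) (I : countType) (P : I -> T -> Prop) :
  (forall i, {ae mu, forall x, P i x}) -> {ae mu, forall x, forall i, P i x}.
Proof.
move=> H.
have : mu.-negligible (\bigcup_k (if @unpickle I k is Some i then ~` [set x | P i x] else set0)).
  by apply: negligible_bigcup => k; case: unpickle => [i|]; [exact: H|exact: negligible_set0].
apply: negligibleS => x /= /existsNP[i nPi]; exists (pickle i) => //.
by rewrite pickleK.
Qed.

(** * Weak gradients on lines parallel to the first axis *)

Section slices.
Context {R : realType} {n : nat} (Omega : set 'rV[R]_n.+1).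
Hypotheses (oO : open Omega) (bO : bounded_set Omega).
Variable u : H1 Omega.
Hypothesis cu : H1_continuous u.
Local Notation leb := (@lebesgue_measure R).
Local Notation mu := (lebesgue_rV R n).
Local Notation muS := (lebesgue_rV R n.+1).
Let G0 x := H1_grad u x 0 ord0.
Let mO : measurable Omega := domain_measurable oO.

(** The integrand of the weak gradient identity for a test function that is [hat] in the first
    variable times a function of the others, with that second factor left out. *)
Definition slice_fun s t k x : R :=
  u x * hat' s t k (x 0 ord0) + G0 x * hat s t k (x 0 ord0).

Lemma continuous_coord_fun (a : R -> R) : continuous a ->
  continuous (fun x : 'rV[R]_n.+1 => a (x 0 ord0)).
Proof.
move=> ca x; apply: (@continuous_comp _ _ _ (fun x : 'rV[R]_n.+1 => x 0 ord0) a).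
  exact: coord_continuous.
exact: ca.
Qed.

Lemma hat_continuous s t k : continuous (@hat R s t k).
Proof. exact/smooth1_continuous/smooth1_hat. Qed.

Lemma hat'_continuous s t k : continuous (@hat' R s t k).
Proof. by rewrite -derive_hat; exact/smooth1_continuous/smooth1_derive/smooth1_hat. Qed.

Lemma integrable_u_hat' s t k b : continuous b ->
  muS.-integrable Omega (EFin \o (fun x => u x * (hat' s t k (x 0 ord0) * b x))).
Proof.
move=> cb; apply: L2_mul_integrable => //; first exact: H1_fun_L2.
apply: continuous_L2 => // x.
exact: (cvgM (@continuous_coord_fun _ (@hat'_continuous s t k) x) (cb x)).
Qed.

Lemma integrable_G_hat s t k b : continuous b ->
  muS.-integrable Omega (EFin \o (fun x => G0 x * (hat s t k (x 0 ord0) * b x))).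
Proof.
move=> cb; apply: L2_mul_integrable => //; first exact: H1_grad_L2.
apply: continuous_L2 => // x.
exact: (cvgM (@continuous_coord_fun _ (@hat_continuous s t k) x) (cb x)).
Qed.

Lemma integrable_slice_fun s t k b : continuous b ->
  muS.-integrable setT (EFin \o (fun x => (slice_fun s t k \_ Omega) x * b x)).
Proof.
move=> cb; have := integrableD mO (integrable_u_hat' s t k cb) (integrable_G_hat s t k cb).
move/(iffLR (integrable_mkcond _ mO)); congr integrable; apply/funext => x /=.
rewrite !patchE; case: ifP => _; last by rewrite mul0r.
by rewrite -EFinD; congr EFin; rewrite /slice_fun; ring.
Qed.

Definition tensor_fun (a : R -> R) (b : 'I_n -> R -> R) (i : 'I_n.+1) : R -> R :=
  if unlift ord0 i is Some j then b j else a.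

Lemma prodf_tensor a b (x : 'rV[R]_n.+1) :
  prodf (tensor_fun a b) x = a (x 0 ord0) * prodf b (behead_rV x).
Proof.
rewrite /prodf big_ord_recl /tensor_fun unlift_none; congr (_ * _).
by apply: eq_bigr => j _; rewrite liftK mxE.
Qed.

Lemma test_tensor s t k k' (p q : 'rV[R]_n) : 1 <= k.+1%:R * (t - s) ->
  (forall r y, s <= r <= t -> cbox p q y -> Omega (cons_rV (r, y))) ->
  test_function Omega
    (prodf (tensor_fun (hat s t k) (fun i => plateau1 k' (p 0 i) (q 0 i)))).
Proof.
move=> kts stO; apply: (@test_prodf _ _ _ _ (cons_rV (s, p)) (cons_rV (t, q))).
- move=> i; rewrite /tensor_fun; case: unlift => [j|]; first exact: smooth1_plateau1.
  exact: smooth1_hat.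
- move=> i r; rewrite /tensor_fun; have [j ->|->] := unliftP ord0 i; last first.
    by rewrite !cons_rV0; exact: hat_support.
  rewrite !cons_rVS; apply: contraNT => h; apply/eqP/plateau1_eq0.
  by apply: contra h => /andP[h1 h2]; rewrite !ltW.
- move=> x h; rewrite -(cons_behead x); apply: stO.
    by have := h ord0; rewrite !cons_rV0.
  by move=> j; have := h (lift ord0 j); rewrite !cons_rVS !mxE.
Qed.

Lemma continuous_plateau_behead k (p q : 'rV[R]_n) :
  continuous (fun x : 'rV[R]_n.+1 => plateau k p q (behead_rV x)).
Proof.
set b := fun i => plateau1 k (p 0 i) (q 0 i).
have := @prodf_continuous R n.+1 (tensor_fun (fun=> 1) b) _.
rewrite (_ : prodf _ = (fun x => plateau k p q (behead_rV x))).
  apply => i; rewrite /tensor_fun; case: unlift => [j|].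
    exact/smooth1_continuous/smooth1_plateau1.
  by move=> x; exact: cvg_cst.
by apply/funext => x; rewrite prodf_tensor mul1r.
Qed.

Lemma behead_cons (r : R) (y : 'rV[R]_n) : behead_rV (cons_rV (r, y)) = y.
Proof. by apply/rowP => j; rewrite mxE cons_rVS. Qed.

Lemma slice_plateau_integral0 s t k k' (p q : 'rV[R]_n) : 1 <= k.+1%:R * (t - s) ->
  (forall r y, s <= r <= t -> cbox p q y -> Omega (cons_rV (r, y))) ->
  \int[muS]_x ((slice_fun s t k \_ Omega) x * plateau k' p q (behead_rV x)) = 0.
Proof.
move=> kts stO.
set b := fun i => plateau1 k' (p 0 i) (q 0 i).
have teta := test_tensor k' kts stO; rewrite -/b in teta.
have := @H1_weak_gradient _ _ _ u _ teta ord0.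
rewrite partial_prodf; last first.
  move=> i; rewrite /tensor_fun; case: unlift => [j|]; first exact: smooth1_plateau1.
  exact: smooth1_hat.
have -> : prodf (fun i => if i == ord0 then derive1 (tensor_fun (hat s t k) b i)
    else tensor_fun (hat s t k) b i) = prodf (tensor_fun (hat' s t k) b).
  apply/funext => x; apply: eq_bigr => i _; rewrite /tensor_fun.
  have [j ->|->] := unliftP ord0 i; last by rewrite eqxx derive_hat.
  by rewrite eq_sym (negbTE (neq_lift _ _)).
under eq_Rintegral do rewrite prodf_tensor.
under [X in _ = - X -> _]eq_Rintegral do rewrite prodf_tensor.
have cb := @continuous_plateau_behead k' p q.
move=> /eqP; rewrite -subr_eq0 opprK -RintegralD//; last 2 first.
- exact: integrable_u_hat'.
- exact: integrable_G_hat.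
move/eqP => <-; rewrite [RHS]Rintegral_mkcond; congr Rintegral; apply/funext => x.
rewrite !patchE; case: ifP => _; last by rewrite mul0r.
have -> : plateau k' p q (behead_rV x) = prodf b (behead_rV x) by [].
by rewrite /slice_fun /G0; ring.
Qed.

Definition slice_int s t k (y : 'rV[R]_n) : R :=
  \int[leb]_r (slice_fun s t k \_ Omega) (cons_rV (r, y)).

(** Tensor test functions and Fubini show that [slice_int] has integral 0 against every plateau in
    the box, so it vanishes almost everywhere there. The null set depends on s, t, k and the box. *)
Lemma slice_int0_ae s t k (p q : 'rV[R]_n) : 1 <= k.+1%:R * (t - s) ->
  (forall r y, s <= r <= t -> cbox p q y -> Omega (cons_rV (r, y))) ->
  slice_int s t k = (fun=> 0) %[ae mu in obox p q].
Proof.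
move=> kts stO; set f := slice_fun s t k \_ Omega.
have fi : muS.-integrable setT (EFin \o f).
  have c1 : continuous (fun _ : 'rV[R]_n.+1 => 1 : R) by exact: cst_continuous.
  have fi1 := @integrable_slice_fun s t k _ c1.
  by apply: (eq_integrable measurableT _ _ _ fi1) => x _ /=; rewrite mulr1.
have fic := integrable_cons fi.
have slices := ae_integrable2 fic.
have mfic := measurable_int _ fic.
(* The line integral of the absolute value is integrable in y and dominates [slice_int], including
   on the null set of lines where the latter is only a default value. *)
pose g := abse \o (EFin \o f \o @cons_rV R n).
have mg : measurable_fun setT g by exact: measurableT_comp.
have g0 x : (0 <= g x)%E by exact: abse_ge0.
have Gi : mu.-integrable setT (fubini_G leb g).
  apply/integrableP; split; first exact: (measurable_fun_fubini_tonelli_G _ mg g0).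
  rewrite (eq_integral (fubini_G leb g)); last first.
    by move=> y _; rewrite gee0_abs//; exact: integral_ge0.
  by rewrite -fubini_tonelli2//; case/integrableP: fic.
have mgG := measurable_fubini_G fic.
have Fi : mu.-integrable setT (EFin \o slice_int s t k).
  apply: le_integrable Gi => //.
    apply/measurable_EFinP; apply: measurableT_comp => //; exact: mgG.
  move=> y _ /=; rewrite [leRHS]gee0_abs; last exact: integral_ge0.
  apply: le_trans (le_abse_integral _ measurableT _) => //; last first.
    exact: (measurableT_comp mfic (pair2_measurable y)).
  rewrite /slice_int /Rintegral.
  by case: (integral _ _ _) => [r| |] //=; rewrite ?normr0 ?leey.
apply: plateau_integral0_ae => //; first exact: open_obox.
  by apply: integrableS Fi => //; exact: measurable_obox.
move=> k' p' q' pq'.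
have pqO r y : s <= r <= t -> cbox p' q' y -> Omega (cons_rV (r, y)).
  by move=> h /pq' /obox_sub_cbox; exact: stO.
have := slice_plateau_integral0 k' kts pqO; rewrite -/f => f0.
rewrite Rintegral_mkcond -[RHS]f0.
congr fine; have cb := @continuous_plateau_behead k' p' q'.
have fbi := @integrable_slice_fun s t k _ cb.
have mF : measurable_fun setT (slice_int s t k) by apply/measurable_EFinP; exact: measurable_int Fi.
have mp : measurable_fun setT (@plateau R n k' p' q').
  by apply: continuous_measurable_rV; case: (smooth_C1 (smooth_plateau k' p' q')).
rewrite fubini_rV2//; apply: ae_eq_integral => //.
- apply/measurable_EFinP; apply/(measurable_restrictT _ (measurable_obox _ _)).
  by apply: measurable_funTS; exact: measurable_funM.
- exact: (measurable_fubini_G (integrable_cons fbi)).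
apply: filterS slices => y /= iy _.
have -> : (((fun y : 'rV[R]_n => slice_int s t k y * plateau k' p' q' y) \_ (obox p q)) y)%:E =
    (slice_int s t k y * plateau k' p' q' y)%:E.
  rewrite patchE; case: ifPn => // yn; rewrite plateau_eq0 ?mulr0// => yp.
  by move/negP: yn; apply; rewrite inE; apply: pq'; exact: obox_sub_cbox.
have ify := integrable_fin_num measurableT iy.
transitivity ((\int[leb]_r (f (cons_rV (r, y)))%:E) * (plateau k' p' q' y)%:E)%E.
  by rewrite EFinM; congr (_ * _)%E; exact: (fineK ify).
rewrite -(integralZr measurableT iy); apply: eq_integral => r _.
by rewrite behead_cons EFinM.
Qed.

End slices.

(** The point [a] is the left end of the component of U containing t, obtained as the supremum of
    the points below t outside U; the lower bound m provides such points. On a line through Omega it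
    yields a boundary point. *)
Lemma open_left_endpoint (R : realType) (U : set R) (m t : R) : open U ->
  (forall r, U r -> m <= r) -> U t -> exists2 a, a < t & ~ U a /\ forall r, a < r <= t -> U r.
Proof.
move=> oU Um Ut; pose A := [set r | r <= t /\ ~ U r].
have mt : m <= t by exact: Um.
have Am : A (m - 1).
  by split; [rewrite (le_trans _ mt)// gerBl|move/Um; rewrite lerBrDr gerDl; lra].
have supA : has_sup A by split; [exists (m - 1)|exists t => r []].
have at' : sup A <= t by apply: ge_sup => [|r []//]; exists (m - 1).
have nUa : ~ U (sup A).
  move=> Ua; have /nbhs_ballP[e /= e0 eU] : nbhs (sup A) U by exact: open_nbhs_nbhs.
  have [r Ar er] := sup_adherent e0 supA.
  case: (Ar) => _; apply; apply: eU; rewrite /ball/= ger0_norm ?subr_ge0; first by rewrite ltrBlDl -ltrBlDr.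
  by apply: ub_le_sup => //; case: supA.
exists (sup A); first by rewrite lt_neqAle at' andbT; apply: contra_not_neq nUa => ->.
split => // r /andP[ar rt]; apply: contrapT => nUr.
have : r <= sup A by apply: ub_le_sup; [case: supA|].
by rewrite leNgt ar.
Qed.

(** * Pointwise bound by a boundary value and a line integral *)

Section slice_bound.
Context {R : realType} {n : nat} (Omega : set 'rV[R]_n.+1).
Hypotheses (oO : open Omega) (bO : bounded_set Omega).
Variable u : H1 Omega.
Hypothesis cu : H1_continuous u.
Local Notation leb := (@lebesgue_measure R).
Local Notation mu := (lebesgue_rV R n).
Local Notation muS := (lebesgue_rV R n.+1).
Let G0 x := H1_grad u x 0 ord0.
Let mO : measurable Omega := domain_measurable oO.

Lemma slice_delta (y : 'rV[R]_n) (r0 e : R) : closure Omega (cons_rV (r0, y)) -> 0 < e ->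
  exists2 delta, 0 < delta & forall r, closure Omega (cons_rV (r, y)) -> `|r - r0| < delta ->
    `|u (cons_rV (r, y)) - u (cons_rV (r0, y))| <= e.
Proof.
move=> cr0 e0; have /subspace_continuousP/(_ _ cr0) := cu.
move=> /cvgrPdist_le/(_ _ e0); rewrite near_withinE => nu.
have := @continuous_cons_head R n y r0 _ nu.
move=> /nbhs_ballP[delta /= d0 H]; exists delta => // r cr rr0.
by rewrite distrC; apply: H => //; rewrite /ball/= distrC.
Qed.

Lemma open_slice (y : 'rV[R]_n) : open [set r : R | Omega (cons_rV (r, y))].
Proof.
apply: (@open_comp _ _ (fun r => cons_rV (r, y)) Omega) => // r _.
exact: continuous_cons_head.
Qed.

Lemma closure_right_limit (y : 'rV[R]_n) (a t : R) : a < t ->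
  (forall r, a < r <= t -> Omega (cons_rV (r, y))) -> closure Omega (cons_rV (a, y)).
Proof.
move=> lt_at atO B nB; have := @continuous_cons_head R n y a _ nB.
move=> /nbhs_ballP[e /= e0 H].
pose r := Num.min t (a + e / 2); exists (cons_rV (r, y)); split.
  by apply: atO; rewrite lt_min lt_at ltrDl divr_gt0//= ge_min lexx.
apply: H; rewrite /ball/= distrC ger0_norm.
  by rewrite ltrBlDl (le_lt_trans (_ : r <= a + e / 2)) ?ge_min ?lexx ?orbT// ltrD2l ltr_pdivrMr// ltr_pMr// ltr1n.
by rewrite subr_ge0 le_min (ltW lt_at) lerDl divr_ge0// ltW.
Qed.

(** A compact segment in Omega is surrounded by parallel segments in Omega. As their positions fill
    a rational box, countably many null sets take care of all segments with rational ends. *)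
Lemma slice_tube (y : 'rV[R]_n) (s t : R) :
  (forall r, s <= r <= t -> Omega (cons_rV (r, y))) ->
  exists c, obox (@rbox R n c).1 (rbox c).2 y /\
    forall r y', s <= r <= t -> cbox (@rbox R n c).1 (rbox c).2 y' -> Omega (cons_rV (r, y')).
Proof.
move=> stO.
have /compact_near_coveringP cov := @segment_compact R s t.
have : \forall y' \near nbhs y, `[s, t]%classic `<=` (fun r => Omega (cons_rV (r, y'))).
  apply: cov => r /=; rewrite in_itv/= => /stO Ory.
  have /nbhs_ballP[e /= e0 eO] : nbhs (cons_rV (r, y)) Omega by exact: open_nbhs_nbhs.
  exists (ball r e, ball y e); first by split => /=; apply: nbhsx_ballx.
  move=> [r' y'] [/= rr' [_ yy']]; apply: eO; split => // i j; rewrite (ord1 i).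
  have [k ->|->] := unliftP ord0 j; last by rewrite !cons_rV0.
  by rewrite !cons_rVS; exact: yy'.
rewrite nbhsE => -[U [oU Uy] UO].
have [c [cy cU]] := open_rbox oU Uy.
exists c; split => // r y' rst /cU /UO; apply.
by rewrite /= in_itv.
Qed.

Lemma integrable_G0 : muS.-integrable setT (EFin \o (G0 \_ Omega)).
Proof.
have L1 : L2 muS Omega (fun=> 1) by apply: continuous_L2 => //; exact: cst_continuous.
have := L2_mul_integrable mO (H1_grad_L2 u ord0) L1.
move/(iffLR (integrable_mkcond _ mO)).
rewrite (_ : _ \_ _ = EFin \o (G0 \_ Omega))//.
by apply/funext => x /=; rewrite !patchE; case: ifP => //= _; rewrite mulr1.
Qed.

Definition slice_grad (y : 'rV[R]_n) : R := \int[leb]_r `|(G0 \_ Omega) (cons_rV (r, y))|.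

Lemma slice_oscillation (y : 'rV[R]_n) (s t : R) : s < t ->
  (forall r, s <= r <= t -> Omega (cons_rV (r, y))) ->
  leb.-integrable setT (EFin \o (fun r => (G0 \_ Omega) (cons_rV (r, y)))) ->
  (forall k, 1 <= k.+1%:R * (t - s) -> slice_int u s t k y = 0) ->
  `|u (cons_rV (t, y)) - u (cons_rV (s, y))| <= slice_grad y.
Proof.
move=> st stO Gi H.
have mI : measurable (`[s, t]%classic : set (measurableTypeR R)) by exact: measurable_itv.
have GiI : leb.-integrable `[s, t] (EFin \o (fun r => (G0 \_ Omega) (cons_rV (r, y)))).
  by apply: integrableS Gi.
have cf : {within `[s, t], continuous (fun r => u (cons_rV (r, y)))}.
  apply/subspace_continuousP => r /= rst; apply/cvgrPdist_le => e e0.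
  have rcl r' : r' \in `[s, t] -> closure Omega (cons_rV (r', y)).
    by rewrite in_itv/= => h; apply: subset_closure; exact: stO.
  have [dl dl0 Hd] := slice_delta (rcl r rst) e0.
  rewrite near_withinE; apply/nbhs_ballP; exists dl => // r' /= rr' r'st.
  by rewrite distrC; apply: Hd; [exact: rcl|rewrite distrC].
apply: (@le_trans _ _ (\int[leb]_(r in `[s, t]) `|(G0 \_ Omega) (cons_rV (r, y))|)).
  apply: (oscillation_le st cf GiI) => k kts; rewrite -[RHS](H k kts) /slice_int.
  rewrite Rintegral_mkcond; congr Rintegral; apply/funext => r.
  rewrite patchE; case: ifPn => [|].
    rewrite inE /= in_itv/= => rst; have Or := stO r rst.
    by rewrite !patchE (mem_set Or) /slice_fun cons_rV0.
  rewrite notin_setE /= in_itv/= => rst; rewrite patchE; case: ifP => // _.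
  rewrite /slice_fun cons_rV0.
  have [/eqP->|/(hat'_support kts)//] := boolP (hat' s t k r == 0).
  have [/eqP->|/(hat_support kts)//] := boolP (hat s t k r == 0).
  by rewrite !mulr0 addr0.
rewrite Rintegral_mkcond; apply: le_Rintegral => //.
- have := iffLR (integrable_mkcond _ mI) (integrable_norm GiI).
  by rewrite restrict_EFin.
- exact: integrable_norm.
- by move=> r _; rewrite [leLHS]patchE; case: (r \in `[s, t]%classic); rewrite ?lexx ?normr_ge0.
Qed.

(** Going left from t along the line, one leaves Omega at a boundary point [a]. The oscillation
    bound needs a segment inside Omega with rational ends, so it is applied slightly inside ]a, t[,
    and continuity of u on the closure of Omega covers both gaps. The null set is uniform in t
    because P ranges over countable data. *)
Lemma slice_bound_ae : {ae mu, forall y, forall t, Omega (cons_rV (t, y)) ->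
  exists z, [/\ boundary Omega z, behead_rV z = y &
    `|u (cons_rV (t, y))| <= `|u z| + slice_grad y]}.
Proof.
pose I := ((('rV[rat]_n * 'rV[rat]_n) * (rat * rat)) * nat)%type.
pose P (i : I) y := let: (c, (s, t), k) := i in
  1 <= k.+1%:R * (ratr t - ratr s) :> R ->
  (forall r y, ratr s <= r <= ratr t -> cbox (@rbox R n c).1 (rbox c).2 y ->
    Omega (cons_rV (r, y))) ->
  obox (@rbox R n c).1 (rbox c).2 y -> slice_int u (ratr s) (ratr t) k y = 0.
have aeP : {ae mu, forall y, forall i, P i y}.
  apply: ae_forall_countable => -[[c [s t]] k] /=.
  have [kts|nkts] := pselect (1 <= k.+1%:R * (ratr t - ratr s) :> R); last first.
    by apply: aeW => y /nkts.
  have [stO|nstO] := pselect (forall r y, ratr s <= r <= ratr t ->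
      cbox (@rbox R n c).1 (rbox c).2 y -> Omega (cons_rV (r, y))); last first.
    by apply: aeW => y _ /nstO.
  by have := slice_int0_ae oO bO u kts stO; apply: filterS => y /= h _ _ /h.
have aeG := ae_integrable2 (integrable_cons integrable_G0).
apply: filterS2 aeP aeG => y Py Gy t Oty.
have [p [q pq]] := closure_domain_cbox bO.
have Um r : Omega (cons_rV (r, y)) -> p 0 ord0 <= r.
  by move=> Or; have := pq _ (subset_closure Or) ord0; rewrite cons_rV0 => /andP[].
have [a lt_at [na atO]] := open_left_endpoint (@open_slice y) Um Oty.
have cla := closure_right_limit lt_at atO.
exists (cons_rV (a, y)); split.
- by rewrite boundaryE.
- exact: behead_cons.
apply/ler_addgt0Pr => e e0; have e2 : 0 < e / 2 by rewrite divr_gt0.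
have [d1 d10 H1] := slice_delta cla e2.
have [d2 d20 H2] := slice_delta (subset_closure Oty) e2.
(* Rational a < s < t' < t, with s within [d1] of a and t' within [d2] of t: each gap then changes u
   by at most e / 2. *)
have [s] : exists s : rat, a < ratr s < Num.min t (a + d1).
  have /rat_in_itvoo[s] : a < Num.min t (a + d1) by rewrite lt_min lt_at ltrDl.
  by rewrite in_itv; exists s.
rewrite lt_min => /andP[lt_as /andP[lt_st sd1]].
have [t'] : exists t' : rat, Num.max (ratr s) (t - d2) < ratr t' < t.
  have /rat_in_itvoo[t'] : Num.max (ratr s) (t - d2) < t by rewrite gt_max lt_st gtrBl.
  by rewrite in_itv; exists t'.
rewrite gt_max => /andP[/andP[lt_st' td2] lt_t't].
have stO r : ratr s <= r <= ratr t' -> Omega (cons_rV (r, y)).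
  by move=> /andP[h1 h2]; apply: atO; rewrite (lt_le_trans lt_as h1) (le_trans h2)// ltW.
have [c [cy cO]] := slice_tube stO.
have osc : `|u (cons_rV (ratr t', y)) - u (cons_rV (ratr s, y))| <= slice_grad y.
  apply: slice_oscillation => // k kts.
  exact: (Py (c, (s, t'), k)).
have Os : Omega (cons_rV (ratr s, y)) by apply: stO; rewrite lexx ltW.
have Ot' : Omega (cons_rV (ratr t', y)) by apply: stO; rewrite lexx ltW.
have b1 : `|u (cons_rV (ratr s, y)) - u (cons_rV (a, y))| <= e / 2.
  apply: H1; first exact: subset_closure.
  by rewrite ger0_norm ?subr_ge0 ?(ltW lt_as)// ltrBlDl.
have b2 : `|u (cons_rV (ratr t', y)) - u (cons_rV (t, y))| <= e / 2.
  apply: H2; first exact: subset_closure.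
  by rewrite distrC ger0_norm ?subr_ge0 ?(ltW lt_t't)// ltrBlDl -ltrBlDr.
rewrite distrC in b2.
have -> : u (cons_rV (t, y)) = u (cons_rV (a, y)) +
    (u (cons_rV (ratr t', y)) - u (cons_rV (ratr s, y))) +
    ((u (cons_rV (ratr s, y)) - u (cons_rV (a, y))) +
     (u (cons_rV (t, y)) - u (cons_rV (ratr t', y)))) by ring.
rewrite (le_trans (ler_normD _ _))// [e]splitr lerD//.
  by rewrite (le_trans (ler_normD _ _))// lerD2l.
by rewrite (le_trans (ler_normD _ _))// lerD.
Qed.

End slice_bound.

Lemma sqr_restrict (T : Type) (R : realType) (D : set T) (f : T -> R) :
  (fun x => (f x ^+ 2)%:E) \_ D = (fun x => ((f \_ D) x ^+ 2)%:E).
Proof. by apply/funext => x; rewrite !patchE; case: ifP => // _; rewrite expr0n. Qed.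

Lemma restrict_sqr_integral d (T : measurableType d) (R : realType)
    (mu : {measure set T -> \bar R}) (D : set T) (f : T -> R) : measurable D -> L2 mu D f ->
  (L2_dot mu D f f)%:E = (\int[mu]_x ((f \_ D) x ^+ 2)%:E)%E.
Proof. by move=> mD Lf; rewrite L2_sq_integral// integral_mkcond sqr_restrict. Qed.

(** * From lines to the inequality on Omega *)

Section mazya.
Context {R : realType} {n : nat} (Omega : set 'rV[R]_n.+1).
Hypotheses (n_gt0 : (0 < n)%N) (oO : open Omega) (bO : bounded_set Omega).
Local Notation leb := (@lebesgue_measure R).
Local Notation mu := (lebesgue_rV R n).
Local Notation muS := (lebesgue_rV R n.+1).
Local Notation sigma := (surface_measure R n.+1).
Local Notation Gamma := (boundary Omega).
Let mO : measurable Omega := domain_measurable oO.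

Lemma measurable_restrict_L2 f : L2 muS Omega f -> measurable_fun setT (f \_ Omega).
Proof. by move=> Lf; apply/(measurable_restrictT _ mO); exact: L2_measurable Lf. Qed.

(** Cauchy-Schwarz with the indicator of [P, Q]. The summand 1 makes the factor positive, so that an
    infinite integral on the right stays infinite. *)
Lemma slice_grad_sqr (u : H1 Omega) (P Q : R) (y : 'rV[R]_n) : P <= Q ->
  (forall r, Omega (cons_rV (r, y)) -> P <= r <= Q) ->
  ((slice_grad u y ^+ 2)%:E <= (Q - P + 1)%:E *
    \int[leb]_r (((fun x => H1_grad u x 0 ord0) \_ Omega) (cons_rV (r, y)) ^+ 2)%:E)%E.
Proof.
move=> PQ OPQ; set G := _ \_ Omega; set J := (\int[_]_r _)%E.
have mG : measurable_fun setT (fun r : measurableTypeR R => G (cons_rV (r, y))).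
  apply: (measurableT_comp (measurable_restrict_L2 (H1_grad_L2 u ord0))).
  by apply: (measurableT_comp (@measurable_cons_rV R n)); exact: measurable_fun_pair.
have J0 : (0 <= J)%E by apply: integral_ge0 => r _; rewrite lee_fin sqr_ge0.
have L0 : 0 < Q - P + 1 by rewrite ltr_wpDl// subr_ge0.
have [->|Joo] := eqVneq J +oo%E; first by rewrite gt0_muley ?lte_fin// leey.
have mabs : measurable_fun setT (fun r : measurableTypeR R => `|G (cons_rV (r, y))|).
  exact: measurableT_comp.
have Lh : L2 leb setT (fun r => `|G (cons_rV (r, y))|).
  apply/L2P => //; split => //; apply/integrableP; split.
    by apply/measurable_EFinP; exact: measurable_funX.
  under eq_integral do rewrite gee0_abs ?lee_fin ?sqr_ge0// real_normK ?num_real//.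
  by rewrite -/J ltey.
have mI : measurable (`[P, Q]%classic : set (measurableTypeR R)) by exact: measurable_itv.
have L1 : L2 leb setT (fun r => \1_(`[P, Q]%classic) r : R).
  apply/L2P => //; split; first exact: measurable_indic.
  rewrite (_ : (fun _ => _) = EFin \o \1_(`[P, Q]%classic : set R)).
    exact: integrable_indic_itv.
  by apply/funext => r; rewrite /= indicE; case: (_ \in _); rewrite ?expr0n ?expr1n.
have -> : slice_grad u y = L2_dot leb setT (fun r => `|G (cons_rV (r, y))|) (fun r => \1_(`[P, Q]%classic) r).
  apply: eq_Rintegral => r _; rewrite indicE /= -/G.
  have [_|] := boolP (r \in _); first by rewrite mulr1.
  rewrite notin_setE/= in_itv/= => rPQ; rewrite mulr0 /G patchE ifN ?normr0//.
  by rewrite notin_setE => /OPQ.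
have := dot_CS measurableT Lh L1; rewrite -lee_fin => /le_trans; apply.
rewrite mulrC EFinM lee_pmul ?lee_fin ?dot_ge0//.
  rewrite -lee_fin L2_sq_integral//.
  rewrite (_ : (fun _ => _) = EFin \o \1_(`[P, Q]%classic : set R)).
    rewrite integral_indic// setIT [leLHS]lebesgue_measure_itv/=.
    by case: ifP => _; rewrite -?EFinB lee_fin ?lerDl// addr_ge0// subr_ge0.
  by apply/funext => r; rewrite /= indicE; case: (_ \in _); rewrite ?expr0n ?expr1n.
rewrite L2_sq_integral// /J.
by under eq_integral do rewrite real_normK ?num_real//.
Qed.

(** The line bound is squared and integrated over a line and over all lines; boundary values enter
    through [projection_majorant] applied to u ^ 2. Since only lines along the first axis occur, one
    component of the gradient is enough on the right. *)
Lemma mazya_inequality : (sigma Gamma < +oo)%E -> exists2 C : R, 0 <= C &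
  forall u : H1 Omega, H1_continuous u ->
  L2_dot muS Omega u u <= C * (L2_dot muS Omega (fun x => H1_grad u x 0 ord0)
    (fun x => H1_grad u x 0 ord0) + L2_dot sigma Gamma u u).
Proof.
move=> Goo; have [p [q pq]] := closure_domain_cbox bO.
pose P := p 0 ord0; pose Q := Num.max P (q 0 ord0).
have PQ : P <= Q by rewrite le_max lexx.
have OPQ y r : Omega (cons_rV (r, y)) -> P <= r <= Q.
  move=> Or; have := pq _ (subset_closure Or) ord0; rewrite cons_rV0 => /andP[h1 h2].
  by rewrite /P h1 le_max h2 orbT.
have [L LE] : exists L, L = Q - P + 1 by exists (Q - P + 1).
have L0 : 0 < L by rewrite LE ltr_wpDl// subr_ge0.
have Lw := ltW L0.
have [H HE] : exists H, H = @hausdorff_proj_const R n by eexists.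
have H0 : 0 <= H by rewrite HE; exact: hausdorff_proj_const_ge0.
have C0 : 0 <= 2 * L * (H + L) by rewrite !mulr_ge0 ?addr_ge0.
(* The 2 comes from (x + y)^2 <= 2 x^2 + 2 y^2, the outer L from integrating over a line, H from the
   projection, and the inner L from Cauchy-Schwarz on the line. *)
exists (2 * L * (H + L)) => // u cu.
have LuG := closure_continuous_L2_boundary oO bO Goo cu.
have Lu := H1_fun_L2 u; have LG0 := H1_grad_L2 u ord0.
set D0 := L2_dot muS Omega (fun x => H1_grad u x 0 ord0) _; set D1 := L2_dot sigma _ _ _.
suff key e : 0 < e -> L2_dot muS Omega u u <= 2 * L * (H * (D1 + e)) + 2 * L * (L * D0).
  (* The error e of [projection_majorant] is multiplied by 2 L H, so it is taken smaller by the
     factor k. *)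
  apply/ler_addgt0Pr => e e0; pose k := 2 * L * H + 1.
  have k0 : 0 < k by rewrite ltr_wpDl// !mulr_ge0.
  apply: (le_trans (key (e / k) _)); first by rewrite divr_gt0.
  have D00 : 0 <= D0 := dot_ge0 _ _ _; have D10 : 0 <= D1 := dot_ge0 _ _ _.
  have h1 : 2 * L * H * (e / k) <= e.
    by rewrite mulrA ler_pdivrMr// mulrC ler_wpM2l ?(ltW e0)// lerDl.
  have h2 : 0 <= 2 * L * H * D0 by rewrite !mulr_ge0.
  have h3 : 0 <= 2 * L * L * D1 by rewrite !mulr_ge0.
  rewrite -subr_ge0.
  rewrite (_ : _ - _ = (e - 2 * L * H * (e / k)) + 2 * L * H * D0 + 2 * L * L * D1); last by ring.
  by rewrite addr_ge0// addr_ge0// subr_ge0.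
move=> e0.
have [M M0 HM] := continuous_compact_bound (compact_closure_domain bO) cu.
have mG : measurable Gamma by exact: boundary_measurable.
have [m [mm m0 wm im]] : exists m : 'rV[R]_n -> R, [/\ measurable_fun setT m, forall y, 0 <= m y,
    forall x, Gamma x -> u x ^+ 2 <= m (behead_rV x) &
    (\int[mu]_y (m y)%:E <= H%:E * (\int[sigma]_(x in Gamma) (u x ^+ 2)%:E + e%:E))%E].
  rewrite HE; apply: (@projection_majorant R n Gamma (fun x => u x ^+ 2) (M ^+ 2)) => //.
    by apply: measurable_funX; exact: L2_measurable LuG.
  move=> x Gx; rewrite sqr_ge0/= -[leLHS]real_normK ?num_real//.
  by rewrite lerXn2r ?nnegrE// HM//; exact: boundary_sub_closure.
rewrite -L2_sq_integral// -/D1 in im.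
pose G := (fun x => H1_grad u x 0 ord0) \_ Omega.
pose J y := (\int[leb]_r (G (cons_rV (r, y)) ^+ 2)%:E)%E.
have mGr : measurable_fun setT G by exact: measurable_restrict_L2.
have mG2 : measurable_fun setT (fun x => (G x ^+ 2)%:E).
  by apply/measurable_EFinP; exact: measurable_funX.
have J0 y : (0 <= J y)%E by apply: integral_ge0 => r _; rewrite lee_fin sqr_ge0.
have mJ : measurable_fun setT J.
  apply: (@measurable_fun_fubini_tonelli_G _ _ _ _ _ leb
    (fun z => (G (cons_rV z) ^+ 2)%:E)).
    by apply: (measurableT_comp mG2); exact: measurable_cons_rV.
  by move=> z; rewrite lee_fin sqr_ge0.
have iJ : (\int[mu]_y J y = D0%:E)%E.
  by rewrite restrict_sqr_integral// tonelli_rV// => x; rewrite lee_fin sqr_ge0.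
pose U := u \_ Omega.
have mU2 : measurable_fun setT (fun x => (U x ^+ 2)%:E).
  by apply/measurable_EFinP; apply: measurable_funX; exact: measurable_restrict_L2.
rewrite -lee_fin restrict_sqr_integral// tonelli_rV//; last by move=> x; rewrite lee_fin sqr_ge0.
apply: (@le_trans _ _ (\int[mu]_y ((2 * L)%:E * (m y)%:E + (2 * L)%:E * (L%:E * J y)))%E); last first.
  have L20 : (0 <= (2 * L)%:E :> \bar R)%E by rewrite lee_fin mulr_ge0// ltW.
  have L0e : (0 <= L%:E :> \bar R)%E by rewrite lee_fin ltW.
  rewrite ge0_integralD//; first last.
  - by apply: measurable_funeM; exact: measurable_funeM.
  - by move=> y _; rewrite !mule_ge0.
  - by apply: measurable_funeM; exact/measurable_EFinP.
  - by move=> y _; rewrite mule_ge0// lee_fin.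
  rewrite !ge0_integralZl//; first last.
  - by move=> y _; rewrite lee_fin.
  - exact/measurable_EFinP.
  - by move=> y _; rewrite mule_ge0.
  - exact: measurable_funeM.
  rewrite iJ EFinD [in leRHS]EFinM (EFinM (2 * L) (L * D0)) (EFinM L D0); apply: leeD => //.
  by apply: lee_wpmul2l => //; rewrite EFinM EFinD.
apply: ae_ge0_le_integral => //.
- by move=> y _; apply: integral_ge0 => r _; rewrite lee_fin sqr_ge0.
- apply: (@measurable_fun_fubini_tonelli_G _ _ _ _ _ leb (fun z => (U (cons_rV z) ^+ 2)%:E)).
    by apply: (measurableT_comp mU2); exact: measurable_cons_rV.
  by move=> z; rewrite lee_fin sqr_ge0.
- by move=> y _; rewrite adde_ge0// !mule_ge0// lee_fin ?mulr_ge0// ltW.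
- apply: emeasurable_funD; apply: measurable_funeM; first exact/measurable_EFinP.
  exact: measurable_funeM.
have := slice_bound_ae oO bO cu; apply: filterS => y Hy _.
pose g := slice_grad u y.
have g0 : 0 <= g by apply: Rintegral_ge0 => r _; rewrite normr_ge0.
have gJ := slice_grad_sqr u PQ (OPQ y); rewrite -LE in gJ.
have mI : measurable (`[P, Q]%classic : set (measurableTypeR R)) by exact: measurable_itv.
pose c := 2 * m y + 2 * g ^+ 2.
have c0 : 0 <= c by rewrite addr_ge0// mulr_ge0// sqr_ge0.
apply: (@le_trans _ _ (\int[leb]_r (c%:E * (\1_(`[P, Q]%classic) r)%:E))%E).
  apply: ge0_le_integral => //.
  - by move=> r _; rewrite lee_fin sqr_ge0.
  - apply: (measurableT_comp mU2).
    by apply: (measurableT_comp (@measurable_cons_rV R n)); exact: measurable_fun_pair.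
  - by apply: measurable_funeM; apply/measurable_EFinP; exact: measurable_indic.
  move=> r _; rewrite -EFinM lee_fin.
  have [Or|nOr] := pselect (Omega (cons_rV (r, y))); last first.
    by rewrite /U patchE ifN ?notin_setE// expr0n mulr_ge0.
  rewrite /U patchE ifT ?inE// indicE mem_set/=; last by rewrite /= in_itv; exact: (OPQ y).
  have [z [Gz zy uz]] := Hy r Or.
  rewrite mulr1 -[leLHS]real_normK ?num_real//.
  have h1 : `|u (cons_rV (r, y))| ^+ 2 <= (`|u z| + g) ^+ 2.
    by rewrite lerXn2r ?nnegrE// addr_ge0.
  have h2 := wm _ Gz; rewrite zy -[leLHS]real_normK ?num_real// in h2.
  have h3 : 0 <= (`|u z| - g) ^+ 2 by exact: sqr_ge0.
  apply: (le_trans h1); rewrite /c.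
  have -> : (`|u z| + g) ^+ 2 = 2 * `|u z| ^+ 2 + 2 * g ^+ 2 - (`|u z| - g) ^+ 2 by ring.
  by rewrite lerBlDr ler_wpDr// lerD2r ler_wpM2l.
have ce0 : (0 <= c%:E)%E by rewrite lee_fin.
rewrite ge0_integralZl//; first last.
  by apply/measurable_EFinP; exact: measurable_indic.
rewrite integral_indic// setIT.
apply: (@le_trans _ _ (c%:E * L%:E)%E).
  apply: lee_wpmul2l => //.
  rewrite [leLHS]lebesgue_measure_itv/= LE.
  by case: ifP => _; rewrite -?EFinB lee_fin ?lerDl// addr_ge0// subr_ge0.
rewrite (_ : (c%:E * L%:E)%E = ((2 * L)%:E * (m y)%:E + (2 * L)%:E * (g ^+ 2)%:E)%E); last first.
  by rewrite -!EFinM -EFinD /c; congr EFin; ring.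
by apply: leeD => //; apply: lee_wpmul2l; rewrite // lee_fin mulr_ge0.
Qed.

End mazya.

(** * The Dirichlet-to-Neumann operator *)

Lemma sqrt_cvg0 (R : realType) (f : R^nat) : (forall n, 0 <= f n) ->
  (Num.sqrt (f n) @[n --> \oo] --> 0) <-> (f @ \oo --> 0).
Proof.
move=> f0; split=> [h|h].
  rewrite (_ : f = fun n => Num.sqrt (f n) * Num.sqrt (f n)).
    by rewrite -[X in _ --> X](mulr0 0); apply: cvgM.
  by apply/funext => n; rewrite -expr2 sqr_sqrtr.
by apply: (@cvg0_sqr_le _ _ f) => // n; rewrite sqr_sqrtr.
Qed.

Lemma cvg_sumr (R : realType) (I : finType) (f : I -> R^nat) (l : I -> R) :
  (forall i, f i @ \oo --> l i) -> \sum_i f i n @[n --> \oo] --> \sum_i l i.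
Proof.
move=> fl; elim: (index_enum I) => [|i r ih].
  rewrite big_nil (_ : (fun n => _) = cst 0); first exact: cvg_cst.
  by apply/funext => n; rewrite big_nil.
rewrite big_cons (_ : (fun n => _) = fun n => f i n + \sum_(j <- r) f j n).
  by apply: cvgD => //; exact: fl.
by apply/funext => n; rewrite big_cons.
Qed.

Lemma cvg_sum0 (R : realType) (I : finType) (f : I -> R^nat) : (forall i n, 0 <= f i n) ->
  (\sum_i f i n @[n --> \oo] --> 0) <-> (forall i, f i @ \oo --> 0).
Proof.
move=> f0; split=> [h i|h].
  apply: (squeeze_cvgr _ (cvg_cst 0) h); apply: nearW => n; rewrite f0/=.
  by rewrite (bigD1 i)//= lerDl sumr_ge0.
rewrite -[X in _ --> X](_ : \sum_(i : I) (0 : R) = 0); last by rewrite big1.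
exact: cvg_sumr.
Qed.

Lemma cvg_add0 (R : realType) (f g : R^nat) : (forall n, 0 <= f n) -> (forall n, 0 <= g n) ->
  (f n + g n @[n --> \oo] --> 0) <-> (f @ \oo --> 0 /\ g @ \oo --> 0).
Proof.
move=> f0 g0; split=> [h|[hf hg]]; last by rewrite -[X in _ --> X](addr0 0); apply: cvgD.
split; apply: (squeeze_cvgr _ (cvg_cst 0) h); apply: nearW => n.
  by rewrite f0 lerDl g0.
by rewrite g0 lerDr f0.
Qed.

Lemma Rintegral_sum d (T : measurableType d) (R : realType)
    (mu : {measure set T -> \bar R}) (D : set T) (I : finType) (f : I -> T -> R) :
  measurable D -> (forall i, mu.-integrable D (EFin \o f i)) ->
  \int[mu]_(x in D) \sum_i f i x = \sum_i \int[mu]_(x in D) f i x.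
Proof.
move=> mD fi; rewrite /Rintegral.
under eq_integral do rewrite -sumEFin.
rewrite integral_sum// -sum_fine// => i _; apply: (integrable_fin_num mD); exact: fi.
Qed.

(** * The Dirichlet form *)

Section dirichlet_form.
Context {R : realType} {d : nat} (Omega : set 'rV[R]_d).
Hypotheses (oO : open Omega) (bO : bounded_set Omega).
Local Notation mu := (lebesgue_rV R d).
Local Notation dot := (L2_dot mu Omega).
Implicit Types u v w : H1 Omega.
Let mO : measurable Omega := domain_measurable oO.

Definition dirichlet u v : R :=
  \sum_i dot (fun x => H1_grad u x 0 i) (fun x => H1_grad v x 0 i).

Lemma dirichletE u v :
  \int[mu]_(x in Omega) (\sum_(i < d) H1_grad u x 0 i * H1_grad v x 0 i) = dirichlet u v.
Proof.
by rewrite Rintegral_sum// => i; apply: L2_mul_integrable => //; exact: H1_grad_L2.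
Qed.

Lemma dirichletC u v : dirichlet u v = dirichlet v u.
Proof. by apply: eq_bigr => i _; exact: dotC. Qed.

Lemma dirichlet_ge0 u : 0 <= dirichlet u u.
Proof. by apply: sumr_ge0 => i _; exact: dot_ge0. Qed.

Lemma H1_comb_grad a u v i : (fun x => H1_grad (H1_comb oO bO a u v) x 0 i) =
  (fun x => a * H1_grad u x 0 i + H1_grad v x 0 i).
Proof. by apply/funext => x; rewrite !mxE. Qed.

Lemma dirichlet_comb a u v w :
  dirichlet (H1_comb oO bO a u v) w = a * dirichlet u w + dirichlet v w.
Proof.
rewrite /dirichlet mulr_sumr -big_split/=; apply: eq_bigr => i _.
by rewrite H1_comb_grad dotDl//; exact: H1_grad_L2.
Qed.

Lemma dirichlet_CS u v : dirichlet u v ^+ 2 <= dirichlet u u * dirichlet v v.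
Proof. exact: (psd_CS dirichlet_comb dirichletC dirichlet_ge0). Qed.

Lemma dot_grad_le_dirichlet u i :
  dot (fun x => H1_grad u x 0 i) (fun x => H1_grad u x 0 i) <= dirichlet u u.
Proof. by rewrite /dirichlet (bigD1 i)//= lerDl sumr_ge0// => j _; exact: dot_ge0. Qed.

Definition H1_cvg (u_ : nat -> H1 Omega) u :=
  dot (fun x => u_ n x - u x) (fun x => u_ n x - u x) @[n --> \oo] --> 0 /\
  forall i, dot (fun x => H1_grad (u_ n) x 0 i - H1_grad u x 0 i)
     (fun x => H1_grad (u_ n) x 0 i - H1_grad u x 0 i) @[n --> \oo] --> 0.

Lemma H1_distE u v : H1_dist u v = Num.sqrt (dot (fun x => u x - v x) (fun x => u x - v x) +
  \sum_i dot (fun x => H1_grad u x 0 i - H1_grad v x 0 i)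
     (fun x => H1_grad u x 0 i - H1_grad v x 0 i)).
Proof.
rewrite /H1_dist; congr (Num.sqrt (_ + _)).
rewrite -Rintegral_sum//.
by move=> i; apply: L2_mul_integrable => //; apply: L2_sub => //; exact: H1_grad_L2.
Qed.

Lemma H1_cvgE (u_ : nat -> H1 Omega) u :
  (H1_dist (u_ n) u @[n --> \oo] --> 0) <-> H1_cvg u_ u.
Proof.
under eq_fun do rewrite H1_distE; rewrite sqrt_cvg0; last first.
  by move=> n; rewrite addr_ge0 ?dot_ge0// sumr_ge0// => i _; exact: dot_ge0.
rewrite cvg_add0; [|by move=> n; exact: dot_ge0|]; last first.
  by move=> n; rewrite sumr_ge0// => i _; exact: dot_ge0.
by rewrite cvg_sum0// => i n; exact: dot_ge0.
Qed.

Lemma cvg_dirichlet (u_ : nat -> H1 Omega) u w : H1_cvg u_ u ->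
  dirichlet (u_ n) w @[n --> \oo] --> dirichlet u w.
Proof.
move=> [_ cg]; apply: cvg_sumr => i.
exact: (cvg_dotl mO (fun n => H1_grad_L2 (u_ n) i) (H1_grad_L2 u i) (H1_grad_L2 w i) (cg i)).
Qed.

End dirichlet_form.
Arguments dirichlet {R d Omega} u v.

Lemma L2_norm_cvg0 d (T : measurableType d) (R : realType)
    (mu : {measure set T -> \bar R}) (D : set T) (f_ : nat -> T -> R) :
  measurable D -> (forall n, L2 mu D (f_ n)) ->
  (L2_norm mu D (f_ n) @[n --> \oo] --> 0%E) <->
  (L2_dot mu D (f_ n) (f_ n) @[n --> \oo] --> 0).
Proof.
move=> mD Lf; rewrite (_ : (fun n => L2_norm mu D (f_ n)) =
    EFin \o (fun n => Num.sqrt (L2_dot mu D (f_ n) (f_ n)))); last first.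
  by apply/funext => n /=; rewrite L2_norm_dot.
rewrite -(sqrt_cvg0 (fun n => dot_ge0 mu D (f_ n))).
split=> [/fine_cvgP[]//|h].
by apply/fine_cvgP; split => //; exact: nearW.
Qed.

(** * The Robin problem *)

Section robin.
Context {R : realType} {d : nat} (Omega : set 'rV[R]_d).
Hypotheses (oO : open Omega) (bO : bounded_set Omega).
Local Notation mu := (lebesgue_rV R d).
Local Notation sigma := (surface_measure R d).
Local Notation Gamma := (boundary Omega).
Local Notation dot := (L2_dot mu Omega).
Local Notation dotG := (L2_dot sigma Gamma).
Hypothesis Goo : (sigma Gamma < +oo)%E.
Let mO : measurable Omega := domain_measurable oO.
Let mG : measurable Gamma := boundary_measurable oO.

Definition H1C := {v : H1 Omega | H1_continuous v}.
Implicit Types u v w : H1C.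

Definition H1C_comb a u v : H1C :=
  exist _ (H1_comb oO bO a (sval u) (sval v)) (H1_comb_continuous (svalP u) (svalP v)).

Definition C1_H1C f (Cf : C1 f) : H1C :=
  exist _ (C1_H1 oO bO Cf) (@C1_H1_continuous R d Omega oO bO f Cf).

(** Merely an inhabitant, required by [psd_riesz]; the zero function is later obtained by
    subtracting it from itself. *)
Definition H1C0 : H1C := C1_H1C (smooth_C1 (smooth_plateau 0 0 0)).

Lemma H1C_L2 u : L2 mu Omega (sval u). Proof. exact: H1_fun_L2. Qed.

Lemma H1C_L2_boundary u : L2 sigma Gamma (sval u).
Proof. exact: (closure_continuous_L2_boundary oO bO Goo (svalP u)). Qed.

Definition robin_form lambda u v :=
  dirichlet (sval u) (sval v) + lambda * dotG (sval u) (sval v).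

Lemma robin_form_comb lambda a u v w :
  robin_form lambda (H1C_comb a u v) w = a * robin_form lambda u w + robin_form lambda v w.
Proof.
rewrite /robin_form dirichlet_comb dotDl//; [ring|exact: H1C_L2_boundary..].
Qed.

Lemma robin_formC lambda u v : robin_form lambda u v = robin_form lambda v u.
Proof. by rewrite /robin_form dirichletC dotC. Qed.

Lemma robin_form_ge0 lambda u : 0 <= lambda -> 0 <= robin_form lambda u u.
Proof. by move=> l0; rewrite addr_ge0 ?dirichlet_ge0// mulr_ge0// dot_ge0. Qed.

Lemma robin_form_subE lambda u v :
  robin_form lambda (H1C_comb (-1) v u) (H1C_comb (-1) v u) =
  \sum_i dot (fun x => H1_grad (sval u) x 0 i - H1_grad (sval v) x 0 i)
             (fun x => H1_grad (sval u) x 0 i - H1_grad (sval v) x 0 i) +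
  lambda * dotG (fun x => sval u x - sval v x) (fun x => sval u x - sval v x).
Proof.
rewrite /robin_form; congr (_ + _).
  apply: eq_bigr => i _; rewrite H1_comb_grad.
  by congr (dot _ _); apply/funext => x; rewrite mulN1r addrC.
by congr (_ * dotG _ _); apply/funext => x /=; rewrite mulN1r addrC.
Qed.

Hypothesis mazya : exists2 C : R, 0 <= C & forall u,
  dot (sval u) (sval u) <= C * (dirichlet (sval u) (sval u) + dotG (sval u) (sval u)).

(** The form controls gradients and boundary values, whose limits exist by completeness; the
    functions themselves are Cauchy in L_2(Omega) only thanks to Maz'ya's inequality. The limits u
    and phi are obtained separately, tied together only by the common sequence. *)
Lemma robin_cauchy_limit (lambda : R) (v_ : nat -> H1C) : 0 < lambda ->
  (forall e, 0 < e -> exists N, forall m n, (N <= m)%N -> (N <= n)%N ->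
    robin_form lambda (H1C_comb (-1) (v_ m) (v_ n)) (H1C_comb (-1) (v_ m) (v_ n)) <= e) ->
  exists (u : H1 Omega) (phi : 'rV[R]_d -> R), [/\ L2 sigma Gamma phi,
    H1_cvg (fun n => sval (v_ n)) u &
    dotG (fun x => sval (v_ n) x - phi x) (fun x => sval (v_ n) x - phi x)
      @[n --> \oo] --> 0].
Proof.
move=> l0 cv; have [C C0 HC] := mazya.
have gradc i : exists2 g, L2 mu Omega g &
    dot (fun x => H1_grad (sval (v_ n)) x 0 i - g x) (fun x => H1_grad (sval (v_ n)) x 0 i - g x)
      @[n --> \oo] --> 0.
  apply: L2_complete => // [n|e e0]; first exact: H1_grad_L2.
  have [N HN] := cv _ e0; exists N => m n Nm Nn.
  apply: le_trans (HN n m Nn Nm); rewrite robin_form_subE (bigD1 i)//= -addrA lerDl.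
  by rewrite addr_ge0 ?sumr_ge0 ?mulr_ge0 ?dot_ge0// ?(ltW l0)// => j _; exact: dot_ge0.
have [phi Lphi cphi] : exists2 phi, L2 sigma Gamma phi &
    dotG (fun x => sval (v_ n) x - phi x) (fun x => sval (v_ n) x - phi x) @[n --> \oo] --> 0.
  apply: L2_complete => // [n|e e0]; first exact: H1C_L2_boundary.
  have [N HN] := cv _ (mulr_gt0 l0 e0); exists N => m n Nm Nn.
  rewrite -(ler_pM2l l0); apply: le_trans (HN n m Nn Nm); rewrite robin_form_subE lerDr.
  by rewrite sumr_ge0// => j _; exact: dot_ge0.
have [u Lu cu] : exists2 u, L2 mu Omega u &
    dot (fun x => sval (v_ n) x - u x) (fun x => sval (v_ n) x - u x) @[n --> \oo] --> 0.
  apply: L2_complete => // [n|e e0]; first exact: H1C_L2.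
  (* The Dirichlet part is at most the form and the boundary part at most the form over lambda; the
     last 1 makes K positive, as it is divided by. *)
  pose K := C * (1 + lambda^-1) + 1.
  have K0 : 0 < K by rewrite ltr_wpDl// mulr_ge0// addr_ge0// invr_ge0 ltW.
  have [N HN] := cv _ (divr_gt0 e0 K0); exists N => m n Nm Nn.
  have := HN n m Nn Nm; set z := H1C_comb _ _ _ => hz.
  have -> : dot (fun x => sval (v_ m) x - sval (v_ n) x) (fun x => sval (v_ m) x - sval (v_ n) x) =
      dot (sval z) (sval z).
    by congr (dot _ _); apply/funext => x /=; rewrite mulN1r addrC.
  have D0 := dirichlet_ge0 (sval z); have S0 := dot_ge0 sigma Gamma (sval z).
  have B0 := robin_form_ge0 z (ltW l0).
  apply: (le_trans (HC z)).
  have h1 : dirichlet (sval z) (sval z) <= robin_form lambda z z.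
    by rewrite lerDl mulr_ge0// ltW.
  have h2 : dotG (sval z) (sval z) <= lambda^-1 * robin_form lambda z z.
    by rewrite mulrC ler_pdivlMr// mulrC lerDr.
  apply: (@le_trans _ _ (K * robin_form lambda z z)).
    rewrite /K mulrDl mul1r ler_wpDr// -mulrA ler_wpM2l//.
    by rewrite mulrDl mul1r lerD.
  by rewrite mulrC -ler_pdivlMr.
have /choice[G HG] : forall i, exists g : 'rV[R]_d -> R, L2 mu Omega g /\
    dot (fun x => H1_grad (sval (v_ n)) x 0 i - g x)
      (fun x => H1_grad (sval (v_ n)) x 0 i - g x) @[n --> \oo] --> 0.
  by move=> i; have [g Lg cg] := gradc i; exists g.
pose Gv x : 'rV[R]_d := \row_i G i x.
have GvE i : (fun x => Gv x 0 i) = G i by apply/funext => x; rewrite mxE.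
have LG i : L2 mu Omega (fun x => Gv x 0 i) by rewrite GvE; case: (HG i).
have cG i : dot (fun x => H1_grad (sval (v_ n)) x 0 i - Gv x 0 i)
      (fun x => H1_grad (sval (v_ n)) x 0 i - Gv x 0 i) @[n --> \oo] --> 0.
  have [_ ci] := HG i.
  rewrite (_ : (fun n => _) = fun n => dot (fun x => H1_grad (sval (v_ n)) x 0 i - G i x)
      (fun x => H1_grad (sval (v_ n)) x 0 i - G i x))//.
  by apply/funext => n; congr (dot _ _); apply/funext => x; rewrite mxE.
have wG := weak_gradient_limit oO bO Lu LG cu cG.
by exists {| H1_fun := u; H1_grad := Gv; H1_fun_L2 := Lu; H1_grad_L2 := LG;
  H1_weak_gradient := wG |}, phi; split.
Qed.

Lemma trace_cvgP (u : H1 Omega) phi : is_trace u phi <-> L2 sigma Gamma phi /\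
  exists v_ : nat -> H1C, H1_cvg (fun n => sval (v_ n)) u /\
    dotG (fun x => sval (v_ n) x - phi x) (fun x => sval (v_ n) x - phi x)
      @[n --> \oo] --> 0.
Proof.
split=> -[Lphi].
  move=> [u_ [cu /(H1_cvgE oO) cvu ct]]; split => //.
  exists (fun n => exist _ (u_ n) (cu n)); split => //.
  apply: (iffLR (L2_norm_cvg0 mG _) ct) => n.
  by apply: L2_sub => //; exact: (H1C_L2_boundary (exist _ (u_ n) (cu n))).
move=> [v_ [cvu ct]]; split => //; exists (fun n => sval (v_ n)); split.
- by move=> n; exact: svalP.
- exact/H1_cvgE.
- apply: (iffRL (L2_norm_cvg0 mG _) ct) => n.
  by apply: L2_sub => //; exact: H1C_L2_boundary.
Qed.

Lemma robin_solution (lambda : R) psi : 0 < lambda -> L2 sigma Gamma psi ->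
  exists (u : H1 Omega) phi, is_trace u phi /\ forall v,
    dirichlet u (sval v) + lambda * dotG phi (sval v) = lambda * dotG psi (sval v).
Proof.
move=> l0 Lpsi.
have bound v : (lambda * dotG psi (sval v)) ^+ 2 <= (lambda * dotG psi psi) * robin_form lambda v v.
  rewrite exprMn expr2 -!mulrA ler_wpM2l ?(ltW l0)//.
  have := dot_CS mG Lpsi (H1C_L2_boundary v) => h.
  apply: (@le_trans _ _ (lambda * (dotG psi psi * dotG (sval v) (sval v)))).
    by rewrite ler_wpM2l// ltW.
  by rewrite mulrCA ler_wpM2l ?dot_ge0// lerDr dirichlet_ge0.
have comb a v w : lambda * dotG psi (sval (H1C_comb a v w)) =
    a * (lambda * dotG psi (sval v)) + lambda * dotG psi (sval w).
  by rewrite dotC dotDl ?(dotC _ _ _ psi)//; [ring|exact: H1C_L2_boundary..].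
have [v_ [cv lv]] := psd_riesz H1C0 (robin_form_comb lambda) (robin_formC lambda)
  (fun v => robin_form_ge0 v (ltW l0)) comb bound.
have [u [phi [Lphi cu cphi]]] := robin_cauchy_limit l0 cv.
exists u, phi; split; first by apply/trace_cvgP; split => //; exists v_.
move=> v; have c1 := cvg_dirichlet oO (w := sval v) cu.
have c2 := cvg_dotl mG (fun n => H1C_L2_boundary (v_ n)) Lphi (H1C_L2_boundary v) cphi.
have c3 : robin_form lambda (v_ n) v @[n --> \oo] -->
    dirichlet u (sval v) + lambda * dotG phi (sval v).
  by rewrite /robin_form; apply: cvgD => //; apply: cvgM => //; exact: cvg_cst.
exact: (cvg_unique (@norm_hausdorff _ _) c3 (lv v)).
Qed.

End robin.

Lemma Rintegral_eq0 d (T : measurableType d) (R : realType)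
    (mu : {measure set T -> \bar R}) (D : set T) (f : T -> R) :
  (forall x, D x -> f x = 0) -> \int[mu]_(x in D) f x = 0.
Proof. by move=> f0; rewrite /Rintegral integral0_eq// => x Dx; rewrite f0. Qed.

(** * The graph of the Dirichlet-to-Neumann operator *)

Section dirichlet_to_neumann.
Context {R : realType} {d : nat} (Omega : set 'rV[R]_d).
Hypotheses (oO : open Omega) (bO : bounded_set Omega).
Local Notation mu := (lebesgue_rV R d).
Local Notation sigma := (surface_measure R d).
Local Notation Gamma := (boundary Omega).
Local Notation dot := (L2_dot mu Omega).
Local Notation dotG := (L2_dot sigma Gamma).
Local Notation L2G := (L2 sigma Gamma).
Hypothesis Goo : (sigma Gamma < +oo)%E.
Local Notation X := (H1C Omega).
Hypothesis mazya : exists2 C : R, 0 <= C & forall u : X,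
  dot (sval u) (sval u) <= C * (dirichlet (sval u) (sval u) + dotG (sval u) (sval u)).
Let mO : measurable Omega := domain_measurable oO.
Let mG : measurable Gamma := boundary_measurable oO.
Implicit Types (u : H1 Omega) (v w : X) (phi psi f g h : 'rV[R]_d -> R).

(** The graph in weak form: one identity over V combines the harmonicity of u with psi being its
    normal derivative. *)
Definition DN phi psi := [/\ L2G phi, L2G psi & exists2 u : H1 Omega, is_trace u phi &
  forall v, dirichlet u (sval v) = dotG psi (sval v)].

(** A test function belongs to V and vanishes on the boundary, so the identity makes its Dirichlet
    product with u zero. The weak gradient identity, applied to each partial derivative of the test
    function, turns this product into minus the integral of u times the Laplacian. *)
Lemma harmonic_weak u psi : (forall v, dirichlet u (sval v) = dotG psi (sval v)) ->
  distributional_laplacian Omega u (fun=> 0).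
Proof.
move=> Hu eta teta; have [se _ _] := teta.
have -> : \int[mu]_(x in Omega) (0 * eta x) = 0.
  by apply: Rintegral_eq0 => x _; rewrite mul0r.
have := Hu (C1_H1C oO bO (smooth_C1 se)).
have -> : dotG psi (sval (C1_H1C oO bO (smooth_C1 se))) = 0.
  apply: Rintegral_eq0 => x Gx /=.
  by rewrite (test_eq0 teta) ?mulr0//; exact: boundary_disjoint.
rewrite /dirichlet => Hs; apply/eqP; rewrite -oppr_eq0 -Hs; apply/eqP.
under eq_Rintegral do rewrite mulr_sumr.
rewrite Rintegral_sum//; last first.
  move=> i; apply: L2_mul_integrable => //; first exact: H1_fun_L2.
  exact/test_L2/test_partial/test_partial.
rewrite -sumrN; apply: eq_bigr => i _.
rewrite (@H1_weak_gradient _ _ _ u _ (test_partial i teta) i) opprK.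
by apply: eq_Rintegral => x _; rewrite mxE.
Qed.

(** The normal derivative is defined with some L2 function representing the Laplacian of u; for
    harmonic u that function has to be identified with 0. *)
Lemma laplacian_unique u f g : L2 mu Omega f -> L2 mu Omega g ->
  distributional_laplacian Omega u f -> distributional_laplacian Omega u g ->
  f = g %[ae mu in Omega].
Proof.
move=> Lf Lg uf ug.
have Lfg := L2_sub mO Lf Lg.
have : (fun x => f x - g x) = (fun=> 0) %[ae mu in Omega].
  apply: plateau_integral0_ae => //.
    have L1 : L2 mu Omega (fun=> 1) by apply: continuous_L2 => //; exact: cst_continuous.
    have := L2_mul_integrable mO Lfg L1; congr integrable.
    by apply/funext => x /=; rewrite mulr1.
  move=> k p q pqO; have t := test_plateau k pqO.
  have := uf _ t; rewrite (ug _ t) => e.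
  have Lt := test_L2 oO bO t.
  by apply/eqP; rewrite [eqbLHS](dotBl mO Lf Lg Lt) subr_eq0; apply/eqP/esym.
by apply: filterS => x h Ox; apply/eqP; rewrite -subr_eq0; apply/eqP/h.
Qed.

Lemma DNP phi psi : L2G phi -> L2G psi -> DN phi psi <-> exists u : H1 Omega,
  [/\ distributional_laplacian Omega u (fun=> 0), is_trace u phi & is_normal_derivative u psi].
Proof.
move=> Lphi Lpsi; have L0 : L2 mu Omega (fun=> 0) by exact: L2_cst0.
have int0 v : \int[mu]_(x in Omega) (0 * sval v x) = 0.
  by apply: Rintegral_eq0 => x _; rewrite mul0r.
split=> [[_ _ [u tu Hu]]|[u [lu tu [_ [f [Lf luf Hf]]]]]].
  have lu := harmonic_weak Hu.
  exists u; split => //; split => //; exists (fun=> 0); split => // v cv.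
  by rewrite (int0 (exist _ v cv)) add0r dirichletE//; exact: (Hu (exist _ v cv)).
split => //; exists u => // v; rewrite -[RHS](Hf _ (svalP v)) dirichletE//.
rewrite [X in _ = X + _](_ : _ = 0) ?add0r// -[RHS](int0 v).
have Lv := L2_measurable mO (H1C_L2 v).
apply: (dot_ae mO (L2_measurable mO Lf) (L2_measurable mO L0) Lv Lv); last exact: aeW.
exact: laplacian_unique luf lu.
Qed.

Lemma DN_ae phi phi' psi psi' : L2G phi' -> L2G psi' -> phi = phi' %[ae sigma in Gamma] ->
  psi = psi' %[ae sigma in Gamma] -> DN phi psi -> DN phi' psi'.
Proof.
move=> Lphi' Lpsi' ephi epsi [Lphi Lpsi [u tu Hu]]; split => //; exists u.
  move/(trace_cvgP oO bO Goo) : tu => [_ [v_ [cu ct]]].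
  apply/(trace_cvgP oO bO Goo); split => //; exists v_; split => //.
  rewrite (_ : (fun n => _) = fun n =>
    dotG (fun x => sval (v_ n) x - phi x) (fun x => sval (v_ n) x - phi x))//.
  apply/funext => n; have Lv := H1C_L2_boundary oO bO Goo (v_ n).
  have e : (fun x => sval (v_ n) x - phi' x) = (fun x => sval (v_ n) x - phi x)
      %[ae sigma in Gamma].
    by apply: filterS ephi => x h Gx; rewrite h.
  have m1 := L2_measurable mG (L2_sub mG Lv Lphi).
  have m2 := L2_measurable mG (L2_sub mG Lv Lphi').
  exact: (dot_ae mG m2 m1 m2 m1 e e).
move=> v; rewrite Hu; have Lv := L2_measurable mG (H1C_L2_boundary oO bO Goo v).
by apply: (dot_ae mG (L2_measurable mG Lpsi) (L2_measurable mG Lpsi') Lv Lv) => //; exact: aeW.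
Qed.

Lemma DN0 : DN (fun=> 0) (fun=> 0).
Proof.
have L0 : L2G (fun=> 0) by exact: L2_cst0.
pose z := H1C_comb oO bO (-1) (H1C0 oO bO) (H1C0 oO bO).
split => //; exists (sval z).
  apply/(trace_cvgP oO bO Goo); split => //; exists (fun=> z); split.
    split=> [|i].
      rewrite (_ : (fun n => _) = cst 0); first exact: cvg_cst.
      by apply/funext => n; apply: Rintegral_eq0 => x _; rewrite subrr mulr0.
    rewrite (_ : (fun n => _) = cst 0); first exact: cvg_cst.
    by apply/funext => n; apply: Rintegral_eq0 => x _; rewrite subrr mulr0.
  rewrite (_ : (fun n => _) = cst 0); first exact: cvg_cst.
  by apply/funext => n; apply: Rintegral_eq0 => x _; rewrite subr0/= mulN1r addNr mulr0.
move=> v; rewrite dirichlet_comb mulN1r addNr.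
by apply/esym/Rintegral_eq0 => x _; rewrite mul0r.
Qed.

Lemma DN_lin a phi1 psi1 phi2 psi2 : DN phi1 psi1 -> DN phi2 psi2 ->
  DN (fun x => a * phi1 x + phi2 x) (fun x => a * psi1 x + psi2 x).
Proof.
move=> [Lphi1 Lpsi1 [u1 tu1 Hu1]] [Lphi2 Lpsi2 [u2 tu2 Hu2]].
split; [exact: L2_lin..|exists (H1_comb oO bO a u1 u2)]; last first.
  move=> v; rewrite dirichlet_comb Hu1 Hu2 dotDl//; exact: H1C_L2_boundary.
(* From |a f - g|^2 >= 0 one has |a f + g|^2 <= 2 a^2 |f|^2 + 2 |g|^2. The measure is a parameter
   because this is applied both on Omega and on the boundary. *)
have comb_cvg0 d' (T : measurableType d') (m : {measure set T -> \bar R}) (D : set T)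
    (f_ g_ : nat -> T -> R) : measurable D -> (forall n, L2 m D (f_ n)) -> (forall n, L2 m D (g_ n)) ->
    L2_dot m D (f_ n) (f_ n) @[n --> \oo] --> 0 ->
    L2_dot m D (g_ n) (g_ n) @[n --> \oo] --> 0 ->
    L2_dot m D (fun x => a * f_ n x + g_ n x) (fun x => a * f_ n x + g_ n x) @[n --> \oo] --> 0.
  move=> mD Lf Lg cf cg.
  have le n : L2_dot m D (fun x => a * f_ n x + g_ n x) (fun x => a * f_ n x + g_ n x) <=
      2 * a ^+ 2 * L2_dot m D (f_ n) (f_ n) + 2 * L2_dot m D (g_ n) (g_ n).
    have Ll := L2_lin mD a (Lf n) (Lg n).
    have := dot_ge0 m D (fun x => a * f_ n x + (-1) * g_ n x).
    have Lm : L2 m D (fun x => -1 * g_ n x) by exact: L2_scale.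
    have Lk := L2_lin mD a (Lf n) Lm.
    rewrite !(dotDl mD)// !(dotC _ _ (f_ n) (fun x => _ + _)) !(dotC _ _ (g_ n) (fun x => _ + _)) !(dotDl mD)//.
    rewrite !(dotC _ _ (fun x => -1 * _) (fun x => _ + _)) !(dotDl mD)// !(dotZl mD)// !(dotC _ _ _ (fun x => -1 * _)) !(dotZl mD)//.
    rewrite (dotC m D (g_ n) (f_ n)); lra.
  apply: (@squeeze_cvgr _ _ _ _ (cst 0) (fun n => 2 * a ^+ 2 * L2_dot m D (f_ n) (f_ n) + 2 * L2_dot m D (g_ n) (g_ n))).
  - by apply: nearW => n; rewrite dot_ge0 le.
  - exact: cvg_cst.
  - rewrite -[X in _ --> X](_ : 2 * a ^+ 2 * 0 + 2 * 0 = 0); last by rewrite !mulr0 addr0.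
    by apply: cvgD; apply: cvgM => //; exact: cvg_cst.
move/(trace_cvgP oO bO Goo) : tu1 => [_ [v1 [[cu1 cg1] ct1]]].
move/(trace_cvgP oO bO Goo) : tu2 => [_ [v2 [[cu2 cg2] ct2]]].
apply/(trace_cvgP oO bO Goo); split; first exact: L2_lin.
exists (fun n => H1C_comb oO bO a (v1 n) (v2 n)); split; first split.
- rewrite (_ : (fun n => _) = fun n => dot
    (fun x => a * (sval (v1 n) x - u1 x) + (sval (v2 n) x - u2 x))
    (fun x => a * (sval (v1 n) x - u1 x) + (sval (v2 n) x - u2 x))).
    by apply: comb_cvg0 => // n; apply: L2_sub => //; exact: H1_fun_L2.
  by apply/funext => n; congr (dot _ _); apply/funext => x /=; ring.
- move=> i; rewrite (_ : (fun n => _) = fun n => dot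
    (fun x => a * (H1_grad (sval (v1 n)) x 0 i - H1_grad u1 x 0 i) + (H1_grad (sval (v2 n)) x 0 i - H1_grad u2 x 0 i))
    (fun x => a * (H1_grad (sval (v1 n)) x 0 i - H1_grad u1 x 0 i) + (H1_grad (sval (v2 n)) x 0 i - H1_grad u2 x 0 i))).
    by apply: comb_cvg0 => // n; apply: L2_sub => //; exact: H1_grad_L2.
  by apply/funext => n; congr (dot _ _); apply/funext => x /=; rewrite !mxE; ring.
- rewrite (_ : (fun n => _) = fun n => dotG
    (fun x => a * (sval (v1 n) x - phi1 x) + (sval (v2 n) x - phi2 x))
    (fun x => a * (sval (v1 n) x - phi1 x) + (sval (v2 n) x - phi2 x))).
    by apply: comb_cvg0 => // n; apply: L2_sub => //; exact: H1C_L2_boundary.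
  by apply/funext => n; congr (dotG _ _); apply/funext => x /=; ring.
Qed.

(** Plateaus are smooth on the whole space, hence in V, and they tend to indicators of boxes; so g
    has integral 0 over the part of the boundary in any box. This is the density of V in dual
    form. *)
Lemma boundary_integral0_ae g : L2G g -> (forall v, dotG g (sval v) = 0) ->
  g = (fun=> 0) %[ae sigma in Gamma].
Proof.
move=> Lg g0.
have L1 : L2G (fun=> 1).
  apply: closure_continuous_L2_boundary => //.
  by apply: continuous_subspaceT; exact: cst_continuous.
have gi : sigma.-integrable Gamma (EFin \o g).
  have := L2_mul_integrable mG Lg L1; congr integrable.
  by apply/funext => x /=; rewrite mulr1.
have mg := L2_measurable mG Lg.
apply: obox_integral0_ae => // p q.
have [||||_] := @Rdominated_cvg _ _ _ sigma Gamma mG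
    (fun k x => g x * plateau k p q x) (fun x => g x * \1_(obox p q) x) (fun x => `|g x|).
- move=> k; apply: measurable_funM => //.
  have := H1C_L2_boundary oO bO Goo (C1_H1C oO bO (smooth_C1 (smooth_plateau k p q))).
  exact: L2_measurable.
- by move=> x _; apply: cvgM; [exact: cvg_cst|exact: cvg_plateau].
- exact: integrable_norm.
- move=> k x _; rewrite normrM (ger0_norm (plateau_ge0 _ _ _ _)).
  by rewrite ler_piMr// plateau_le1.
have c0 : (\int[sigma]_(x in Gamma) (g x * plateau k p q x)) @[k --> \oo] --> (0 : R).
  rewrite (_ : (fun k => _) = cst 0); first exact: cvg_cst.
  apply/funext => k.
  exact: (g0 (C1_H1C oO bO (smooth_C1 (smooth_plateau k p q)))).
move=> c1; exact: (cvg_unique (@norm_hausdorff _ _) c1 c0).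
Qed.

End dirichlet_to_neumann.

(** * The operator and its self-adjointness *)

Section dirichlet_to_neumann_operator.
Context {R : realType} {d : nat} (Omega : set 'rV[R]_d).
Hypotheses (oO : open Omega) (bO : bounded_set Omega).
Local Notation mu := (lebesgue_rV R d).
Local Notation sigma := (surface_measure R d).
Local Notation Gamma := (boundary Omega).
Local Notation dot := (L2_dot mu Omega).
Local Notation dotG := (L2_dot sigma Gamma).
Local Notation L2G := (L2 sigma Gamma).
Hypothesis Goo : (sigma Gamma < +oo)%E.
Local Notation X := (H1C Omega).
Hypothesis mazya : exists2 C : R, 0 <= C & forall u : X,
  dot (sval u) (sval u) <= C * (dirichlet (sval u) (sval u) + dotG (sval u) (sval u)).
Let mO : measurable Omega := domain_measurable oO.
Let mG : measurable Gamma := boundary_measurable oO.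
Implicit Types (u : H1 Omega) (v w : X) (phi psi f g h : 'rV[R]_d -> R).
Local Notation DN := (@DN R d Omega).

(** [psd_riesz] for the boundary inner product alone, with the functional given by f, produces a
    sequence in V tending to the projection p of f onto the closure of V. Then f - p is orthogonal
    to V, so it vanishes by [boundary_integral0_ae]. *)
Lemma boundary_approx f (e : R) : L2G f -> 0 < e ->
  exists v, dotG (fun x => f x - sval v x) (fun x => f x - sval v x) < e.
Proof.
move=> Lf e0; have Lv v : L2G (sval v) by exact: H1C_L2_boundary.
pose B v w := dotG (sval v) (sval w).
have Bcomb a v v' w : B (H1C_comb oO bO a v v') w = a * B v w + B v' w by rewrite /B dotDl.
have lcomb a v w : dotG f (sval (H1C_comb oO bO a v w)) = a * dotG f (sval v) + dotG f (sval w).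
  by rewrite dotC dotDl// !(dotC _ _ _ f).
have [v_ [cv lv]] := psd_riesz (H1C0 oO bO) Bcomb (fun v w => dotC _ _ _ _)
  (fun v => dot_ge0 _ _ _) lcomb (fun v => dot_CS mG Lf (Lv v)).
have [p Lp cp] : exists2 p, L2G p &
    dotG (fun x => sval (v_ n) x - p x) (fun x => sval (v_ n) x - p x) @[n --> \oo] --> 0.
  apply: L2_complete => // c c0; have [N HN] := cv _ c0; exists N => m n Nm Nn.
  apply: le_trans (HN n m Nn Nm); rewrite le_eqVlt; apply/orP; left; apply/eqP.
  by congr (dotG _ _); apply/funext => x /=; rewrite mulN1r addrC.
have fp : (fun x => f x - p x) = (fun=> 0) %[ae sigma in Gamma].
  apply: (boundary_integral0_ae oO bO Goo); first exact: L2_sub.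
  move=> v; rewrite dotBl//; apply/eqP; rewrite subr_eq0; apply/eqP.
  by apply: (cvg_unique (@norm_hausdorff _ _) (lv v)); exact: cvg_dotl.
have /cvgr0Pnorm_lt/(_ _ e0)[N _ /(_ N (leqnn N))] := cp.
rewrite ger0_norm ?dot_ge0// => HN; exists (v_ N); apply: le_lt_trans HN.
have Lvp := L2_sub mG (Lv (v_ N)) Lp; have Lfv := L2_sub mG Lf (Lv (v_ N)).
have Lpv := L2_sub mG Lp (Lv (v_ N)).
have efp : (fun x => f x - sval (v_ N) x) = (fun x => p x - sval (v_ N) x) %[ae sigma in Gamma].
  by apply: filterS fp => x h Gx; move/eqP: (h Gx); rewrite subr_eq0 => /eqP ->.
have m1 := L2_measurable mG Lfv; have m2 := L2_measurable mG Lpv.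
rewrite (dot_ae mG m1 m2 m1 m2 efp efp) le_eqVlt; apply/orP; left; apply/eqP.
by apply: eq_Rintegral => x _; ring.
Qed.

(** Extends the defining identity of u1 from V to any u2 with a trace phi, along the sequence that
    defines the trace. Symmetry and positivity of the graph follow by taking for u2 the function of
    another or the same graph element. *)
Lemma weak_neumann_trace u1 u2 psi phi : L2G psi ->
  (forall v, dirichlet u1 (sval v) = dotG psi (sval v)) -> is_trace u2 phi ->
  dirichlet u1 u2 = dotG psi phi.
Proof.
move=> Lpsi Hu /(trace_cvgP oO bO Goo)[Lphi [v_ [cu ct]]].
have c1 := cvg_dirichlet oO (w := u1) cu.
have c2 := cvg_dotl mG (fun n => H1C_L2_boundary oO bO Goo (v_ n)) Lphi Lpsi ct.
have e : (fun n => dirichlet (sval (v_ n)) u1) = (fun n => dotG (sval (v_ n)) psi).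
  by apply/funext => n; rewrite dirichletC Hu dotC.
rewrite e in c1; rewrite dirichletC (dotC _ _ psi).
exact: (cvg_unique (@norm_hausdorff _ _) c1 c2).
Qed.

Lemma DN_sym phi1 psi1 phi2 psi2 : DN phi1 psi1 -> DN phi2 psi2 ->
  dotG psi1 phi2 = dotG phi1 psi2.
Proof.
move=> [Lphi1 Lpsi1 [u1 t1 H1]] [Lphi2 Lpsi2 [u2 t2 H2]].
by rewrite -(weak_neumann_trace Lpsi1 H1 t2) dotC -(weak_neumann_trace Lpsi2 H2 t1) dirichletC.
Qed.

Lemma DN_ge0 phi psi : DN phi psi -> 0 <= dotG psi phi.
Proof.
by move=> [_ Lpsi [u t H]]; rewrite -(weak_neumann_trace Lpsi H t) dirichlet_ge0.
Qed.

Lemma DN_single_valued phi phi' psi psi' : DN phi psi -> DN phi' psi' ->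
  phi = phi' %[ae sigma in Gamma] -> psi = psi' %[ae sigma in Gamma].
Proof.
move=> D1 D2 ephi; have := DN_lin oO bO Goo (-1) D1 D2.
set ph := (fun x => -1 * phi x + _); set ps := (fun x => -1 * psi x + _).
move=> [Lph Lps [u t H]].
have ph0 : ph = (fun=> 0) %[ae sigma in Gamma].
  by apply: filterS ephi => x h Gx; rewrite /ph h// mulN1r addNr.
have uu : dirichlet u u = 0.
  rewrite (weak_neumann_trace Lps H t).
  have m0 := L2_measurable mG (L2_cst0 sigma mG).
  have mps := L2_measurable mG Lps; have mph := L2_measurable mG Lph.
  rewrite (dot_ae mG mps mps mph m0 _ ph0); last exact: aeW.
  by apply: Rintegral_eq0 => x _; rewrite mulr0.
have ps0 : ps = (fun=> 0) %[ae sigma in Gamma].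
  apply: (boundary_integral0_ae oO bO Goo Lps) => v; rewrite -H.
  apply/eqP; rewrite -sqrf_eq0 eq_le sqr_ge0 andbT.
  by have := dirichlet_CS oO bO u (sval v); rewrite uu mul0r.
apply: filterS ps0 => x h Gx; have /eqP := h Gx.
by rewrite /ps mulN1r addrC subr_eq0 => /eqP.
Qed.

Lemma DN_resolvent f (lambda : R) : 0 < lambda -> L2G f ->
  exists phi, DN phi (fun x => lambda * (f x - phi x)).
Proof.
move=> l0 Lf; have [u [phi [t H]]] := robin_solution oO bO Goo mazya l0 Lf.
have [Lphi _] := t.
exists phi; split => //; first by apply: L2_scale => //; exact: L2_sub.
exists u => // v; have Lv := H1C_L2_boundary oO bO Goo v.
rewrite dotZl//; last exact: L2_sub.
by rewrite dotBl// mulrBr -H addrK.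
Qed.

(* [lambda |phi - v|^2 = D(u, v) - D(u, u) <= D(v, v) / 4], where [D] is the
   Dirichlet form and [u] the harmonic function with trace [phi] *)
Lemma DN_resolvent_near v (lambda : R) : 0 < lambda ->
  exists phi psi, DN phi psi /\
    4 * lambda * dotG (fun x => sval v x - phi x) (fun x => sval v x - phi x) <=
    dirichlet (sval v) (sval v).
Proof.
move=> l0; have Lv := H1C_L2_boundary oO bO Goo v.
have [phi D] := DN_resolvent l0 Lv; exists phi, (fun x => lambda * (sval v x - phi x)).
split => //; case: D => Lphi Lpsi [u t H].
have Lvp := L2_sub mG Lv Lphi.
have h1 := H v; have h2 := weak_neumann_trace Lpsi H t.
have e : lambda * dotG (fun x => sval v x - phi x) (fun x => sval v x - phi x) =
    dirichlet u (sval v) - dirichlet u u.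
  by rewrite h1 h2 !dotZl// -mulrBr (dotC _ _ _ (sval v)) (dotC _ _ _ phi) -dotBl.
rewrite -mulrA e.
(* Nonnegativity of the form at v - 2 u is 4 (D(u, v) - D(u, u)) <= D(v, v). *)
have := dirichlet_ge0 (H1_comb oO bO (-2) u (sval v)).
rewrite dirichlet_comb (dirichletC u (H1_comb _ _ _ _ _)) (dirichletC (sval v) (H1_comb _ _ _ _ _)).
rewrite !dirichlet_comb (dirichletC (sval v) u); lra.
Qed.

Definition DN_dom : set ('rV[R]_d -> R) := [set phi | exists psi, DN phi psi].

(** A representative picked by choice, with default value 0 outside the domain. It is determined
    only almost everywhere, so linearity too holds only in that sense. *)
Definition DN_op phi : 'rV[R]_d -> R :=
  if pselect (exists psi, DN phi psi) is left h then sval (cid h) else fun=> 0.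

Lemma DN_opP phi : DN_dom phi -> DN phi (DN_op phi).
Proof. by rewrite /DN_op => h; case: pselect => // h'; exact: svalP. Qed.

Definition DN_operator : L2_operator sigma Gamma.
Proof.
refine {| L2_dom := DN_dom; L2_op := DN_op |}.
- by move=> phi [psi []].
- by move=> phi /DN_opP[].
- move=> f g [psi Df] Lg fg; exists psi; have [_ Lpsi _] := Df.
  by apply: (DN_ae oO bO Goo Lg Lpsi fg _ Df); exact: aeW.
- by move=> f g /DN_opP Df /DN_opP Dg fg; exact: DN_single_valued Df Dg fg.
- by exists (fun=> 0); exact: DN0.
- by move=> a f g /DN_opP Df /DN_opP Dg; exists (fun x => a * DN_op f x + DN_op g x); exact: DN_lin.
- move=> a f g /DN_opP Df /DN_opP Dg; have D := DN_lin oO bO Goo a Df Dg.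
  have Dfg : DN_dom (fun x => a * f x + g x) by eexists; exact: D.
  by apply: (DN_single_valued (DN_opP Dfg) D); exact: aeW.
Defined.

Lemma DN_operatorP phi psi : L2G psi ->
  (L2_dom DN_operator phi /\ DN_operator phi = psi %[ae sigma in Gamma]) <-> DN phi psi.
Proof.
move=> Lpsi; split=> [[/DN_opP D e]|D].
  by have [Lphi _ _] := D; apply: (DN_ae oO bO Goo Lphi Lpsi _ e D); exact: aeW.
have dphi : DN_dom phi by exists psi.
by split => //; apply: (DN_single_valued (DN_opP dphi) D); exact: aeW.
Qed.

Lemma DN_operator_positive : L2_positive DN_operator.
Proof. by move=> phi /DN_opP; exact: DN_ge0. Qed.

Lemma DN_operator_dense : L2_dense sigma Gamma (L2_dom DN_operator).
Proof.
(* With |f - v|^2 < c and |v - phi|^2 < c, the square of the distance from f to phi is below 4 c =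
   e^2 / 2. *)
move=> f Lf e e0; pose c : R := e ^+ 2 / 8; have c0 : 0 < c by rewrite divr_gt0// exprn_gt0.
have [v fv] := boundary_approx Lf c0.
have Lv := H1C_L2_boundary oO bO Goo v.
set A := dirichlet (sval v) (sval v); have A0 : 0 <= A by exact: dirichlet_ge0.
(* Chosen so that 4 lambda c = A + 1 exceeds A, which forces |v - phi|^2 < c in the estimate of
   [DN_resolvent_near]. *)
pose lambda := (A + 1) / (4 * c).
have l0 : 0 < lambda by rewrite divr_gt0 ?mulr_gt0// ltr_wpDl.
have [phi [psi [D h]]] := DN_resolvent_near v l0; exists phi; first by exists psi.
have [Lphi _ _] := D.
have vphi : dotG (fun x => sval v x - phi x) (fun x => sval v x - phi x) < c.
  rewrite ltNge; apply/negP => hc.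
  have : 4 * lambda * c <= A.
    by apply: le_trans h; rewrite ler_wpM2l// mulr_ge0// ltW.
  rewrite /lambda (_ : _ * _ * c = A + 1); first by rewrite leNgt ltrDl ltr01.
  by field; rewrite gt_eqF.
have L1 := L2_sub mG Lf Lv; have L2' := L2_sub mG Lv Lphi; have L3 := L2_sub mG Lf Lphi.
rewrite (L2_norm_dot mG) ?lte_fin//.
have : dotG (f \- phi) (f \- phi) < e ^+ 2.
  have L12 := L2_add mG L1 L2'; have Lm := L2_sub mG L1 L2'.
  have := dot_ge0 sigma Gamma (fun x => (f x - sval v x) - (sval v x - phi x)).
  have -> : dotG (f \- phi) (f \- phi) =
      dotG (fun x => 1 * (f x - sval v x) + (sval v x - phi x))
           (fun x => 1 * (f x - sval v x) + (sval v x - phi x)).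
    by congr (dotG _ _); apply/funext => x /=; ring.
  have L13 := L2_lin mG 1 L1 L2'.
  rewrite (dotBl mG L1 L2' Lm) (dotDl mG 1 L1 L2' L13).
  rewrite !(dotC _ _ (fun x => f x - sval v x) (fun x => _ - (sval v x - phi x))).
  rewrite !(dotC _ _ (fun x => sval v x - phi x) (fun x => _ - (sval v x - phi x))).
  rewrite !(dotC _ _ (fun x => f x - sval v x) (fun x => 1 * _ + _)).
  rewrite !(dotC _ _ (fun x => sval v x - phi x) (fun x => 1 * _ + _)).
  rewrite !(dotBl mG L1 L2')// !(dotDl mG 1 L1 L2')//.
  rewrite (dotC _ _ (fun x => sval v x - phi x) (fun x => f x - sval v x)).
  have : c = e ^+ 2 / 8 by []. lra.
by move=> hs; rewrite -[ltRHS]ger0_norm ?(ltW e0)// -sqrtr_sqr ltr_sqrt// exprn_gt0.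
Qed.

(** If (g, h) is in the adjoint graph, surjectivity of 1 + D_0 gives k in the domain with D_0 k = g
    + h - k. By symmetry g - k is orthogonal to the range of 1 + D_0, which is everything, so g = k
    and h = D_0 k. *)
Lemma DN_operator_adjoint g h : L2G g -> L2G h ->
  L2_adjoint DN_operator g h <-> DN g h.
Proof.
move=> Lg Lh; split=> [[_ _ H]|D]; last first.
  split => // f /DN_opP Df; exact: DN_sym Df D.
have Lgh := L2_add mG Lg Lh.
have [k Dk] := DN_resolvent ltr01 Lgh; have [Lk Ldk _] := Dk.
have Lgk := L2_sub mG Lg Lk.
have gk : (fun x => g x - k x) = (fun=> 0) %[ae sigma in Gamma].
  apply: dot0_ae => //.
  (* Here f + D_0 f = g - k, so pairing the range of 1 + D_0 with g - k includes pairing g - k with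
     itself. *)
  have [f Df] := DN_resolvent ltr01 Lgk; have [Lf Ldf _] := Df.
  have df : DN_dom f by eexists; exact: Df.
  have Dopf := DN_opP df; have [_ Lopf _] := Dopf.
  have eop := DN_single_valued Dopf Df (aeW sigma (fun x _ => erefl)).
  have m1 := L2_measurable mG Lopf; have m2 := L2_measurable mG Ldf.
  have mg := L2_measurable mG Lg.
  have := H f df; rewrite (dot_ae mG m1 m2 mg mg eop); last exact: aeW.
  have := DN_sym Df Dk.
  have Lghk := L2_sub mG Lgh Lk; have Lgkf := L2_sub mG Lgk Lf.
  rewrite (dotZl mG 1 Lgkf Lk) (dotZl mG 1 Lgkf Lg) (dotC _ _ f (fun x => 1 * _)).
  rewrite (dotZl mG 1 Lghk Lf) !mul1r (dotBl mG Lgh Lk Lf) (dotBl mG Lgk Lf Lk) (dotBl mG Lgk Lf Lg).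
  have -> : dotG (fun x => g x + h x) f = dotG g f + dotG h f.
    by rewrite -[dotG g f]mul1r -dotDl//; congr dotG; apply/funext => x; rewrite mul1r.
  rewrite (dotC _ _ f h) (dotC _ _ f k) (dotC _ _ f g) (dotC _ _ (fun x => g x - k x) k)
    (dotC _ _ (fun x => g x - k x) g) => e1 e2.
  have : dotG (fun x => g x - k x) (fun x => g x - k x) =
      dotG g (fun x => g x - k x) - dotG k (fun x => g x - k x) by exact: dotBl.
  lra.
apply: (DN_ae oO bO Goo Lg Lh _ _ Dk).
  by apply: filterS gk => x e Gx; apply/esym/eqP; rewrite -subr_eq0; apply/eqP; exact: e.
apply: filterS gk => x e Gx; have /eqP := e Gx; rewrite subr_eq0 => /eqP ->.
by rewrite mul1r addrC addKr.
Qed.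

Lemma DN_operator_self_adjoint : L2_self_adjoint DN_operator.
Proof.
split; first exact: DN_operator_dense.
by move=> g h Lg Lh; rewrite DN_operator_adjoint// DN_operatorP.
Qed.

End dirichlet_to_neumann_operator.

Theorem theorem3p3 (R : realType) (d : nat) (Omega : set 'rV[R]_d)
    (d_ge2 : (2 <= d)%N) (Omega_open : open Omega)
    (Omega_bounded : bounded_set Omega) (Omega_connected : connected Omega)
    (Gamma_finite : (surface_measure R d (boundary Omega) < +oo)%E) :
  exists D0 : L2_operator (surface_measure R d) (boundary Omega),
    (forall phi psi : 'rV[R]_d -> R,
      L2 (surface_measure R d) (boundary Omega) phi ->
      L2 (surface_measure R d) (boundary Omega) psi ->
      (L2_dom D0 phi /\ D0 phi = psi %[ae surface_measure R d in boundary Omega]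
       <->
       exists u : H1 Omega,
         [/\ distributional_laplacian Omega u (fun=> 0),
             is_trace u phi &
             is_normal_derivative u psi])) /\
    L2_positive D0 /\ L2_self_adjoint D0.
Proof.
case: d Omega d_ge2 Omega_open Omega_bounded Omega_connected Gamma_finite => // n Omega n_gt0 oO bO _ Goo.
have mazya : exists2 C : R, 0 <= C & forall u : H1C Omega,
    L2_dot (lebesgue_rV R n.+1) Omega (sval u) (sval u) <=
    C * (dirichlet (sval u) (sval u) +
         L2_dot (surface_measure R n.+1) (boundary Omega) (sval u) (sval u)).
  have [C C0 HC] := mazya_inequality n_gt0 oO bO Goo; exists C => // u.
  apply: (le_trans (HC (sval u) (svalP u))).
  by rewrite ler_wpM2l// lerD2r dot_grad_le_dirichlet.
exists (DN_operator oO bO Goo); split; last first.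
  by split; [exact: DN_operator_positive|exact: DN_operator_self_adjoint].
move=> phi psi Lphi Lpsi.
by rewrite DN_operatorP// DNP.
Qed.
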